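(* Let $w\in S_n$ be such that $D^\circ(w)$ consists of a single rectangle of size $l\times k$. Denote by $(a,b)$ the unique element of $\mathrm{Ess}(w)$ and let $m:=r_w(a,b)$. Let $v\le w$ and denote by $p$ the complexity of $\mathcal N_{v,w}$. \begin{enumerate} \item If $r_v(a,b)<m$, then $p=\nu(G_{v,w})-|D^\circ(w)|=|P_v|-kl$. \item If $r_v(a,b)=m$, then $p=\nu(G_{v,w})$, and $\mathcal N_{v,w}$ is toric if and only if $G_{v,w}$ is a forest. \end{enumerate}
   Context: A permutation $v\in S_n$ is identified with the permutation matrix having $1$s at $(v(j),j)$; $r_v(a,b)$ is the rank of its submatrix with rows $a,\dots,n$ and columns $1,\dots,b$. $D^\circ(v)=\{(i,j): v(j)<i,\ v^{-1}(i)>j\}$ is the opposite Rothe diagram, and $\mathrm{Ess}(v)$ is the set of north-east corners of its connected components. $\le$ is the Bruhat order, $\ell$ the Coxeter length, $t_{a,b}$ the transposition of $a$ and $b$. Let $B$ (resp. $B_-$) be the upper (resp. lower) triangular Borel subgroup of $G=GL_n(\mathbb C)$ and $T$ the diagonal torus. For $v\le w$ the Kazhdan-Lusztig variety is $\mathcal N_{v,w}=\overline{BwB/B}\cap B_-vB/B\subset G/B$, of dimension $\ell(w)-\ell(v)=|D^\circ(v)|-|D^\circ(w)|$. The usual torus action is that of $T$ by left multiplication; its weight cone is $\sigma_{v,w}=\mathrm{Cone}(e_{v(j)}-e_i : (i,j)\in D^\circ(v),\ t_{v(j),i}\,v\le w)\subset\mathbb R^n$. The complexity is $\dim\mathcal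 N_{v,w}-\dim\sigma_{v,w}$; toric means complexity $0$. $G_{v,w}$ is the directed graph with vertex set $[n]$ and edges $v(j)\to i$ for $(i,j)\in D^\circ(v)$ with $t_{v(j),i}\,v\le w$; being a forest refers to the underlying undirected graph. The cyclomatic number of a graph is $\nu(G)=|E(G)|-|V(G)|+\#(\text{connected components of }G)$. For $(i,j),(k,l)\in D^\circ(v)$ with $i<k$ and $j<l$ put $d((i,j),(k,l))=(k-i)+(l-j)$. The set $P_v\subseteq D^\circ(v)\times D^\circ(v)$ is defined recursively by increasing distance $d$: (i) $((i,j),(i+1,j+1))\in P_v$ whenever $(i,j),(i+1,j+1)\in D^\circ(v)$; (ii) a pair $((i,j),(k,l))$ of elements of $D^\circ(v)$ with $i<k$, $j<l$ and $d((i,j),(k,l))=d$ is in $P_v$ if there is not already some $((i,j),(k',l'))\in P_v$ with $d((i,j),(k',l'))<d$ or some $((i',j'),(k,l))\in P_v$ with $d((i',j'),(k,l))<d$. *)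

(* Defs.v *)
From HB Require Import structures.
From mathcomp Require Import all_boot all_order all_algebra all_fingroup.
From mathcomp Require Import all_classical.
From mathcomp Require Import reals ereal topology.
From mathcomp Require Import generic_quotient complex.
From mathcomp Require Import -(notations) mpoly.

Set Implicit Arguments.
Unset Strict Implicit.
Unset Printing Implicit Defensive.

Import Order.TTheory GRing.Theory Num.Theory.
Local Open Scope ring_scope.

(** Rows, columns and values are numbered from 0, so that [n] is ['I_n]; all
    inequalities between indices are unaffected by the shift.  The product of
    ['S_n] is [(s * t) x = t (s x)], so the composite t_{a,b} v (v first, then
    the transposition) is [(v * tperm a b)%g]. *)

Section Combinatorics.
Variable n : nat.
Implicit Types v w : 'S_n.

Definition perm_len v : nat :=
  #|[set q : 'I_n * 'I_n | (q.1 < q.2)%N && (v q.2 < v q.1)%N]|.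

(** Bruhat order: reflexive transitive closure of multiplication by a
    transposition that increases the length. *)
Definition bruhat_step : rel 'S_n := fun u u' =>
  [exists a, exists b, u' == (u * tperm a b)%g] && (perm_len u < perm_len u')%N.

Definition bruhat : rel 'S_n := connect bruhat_step.

(** 1s at (v(j), j); this is mathcomp's [perm_mx v^-1]. *)
Definition pmx (K : pzSemiRingType) v : 'M[K]_n :=
  \matrix_(i, j) (v j == i)%:R.

Definition sw_rank v (a b : 'I_n) : nat :=
  \rank (mxsub (fun i : 'I_#|[set i : 'I_n | (a <= i)%N]| => enum_val i)
               (fun j : 'I_#|[set j : 'I_n | (j <= b)%N]| => enum_val j)
               (pmx rat v)).

Definition oRothe v : {set 'I_n * 'I_n} :=
  [set q : 'I_n * 'I_n | (v q.2 < q.1)%N && (q.2 < (v^-1)%g q.1)%N].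

(** A box is the north-east corner of its connected component iff neither its
    north nor its east neighbour is in the diagram. *)
Definition Ess v : {set 'I_n * 'I_n} :=
  [set q in oRothe v |
     [forall i : 'I_n, (i.+1 == q.1 :> nat) ==> ((i, q.2) \notin oRothe v)] &&
     [forall j : 'I_n, (j == q.2.+1 :> nat) ==> ((q.1, j) \notin oRothe v)]].

Definition is_rectangle (l k : nat) (D : {set 'I_n * 'I_n}) : Prop :=
  (0 < l)%N /\ (0 < k)%N /\
  exists i0 j0 : nat, [/\ (i0 + l <= n)%N, (j0 + k <= n)%N &
    D = [set q : 'I_n * 'I_n | (i0 <= q.1 < i0 + l)%N && (j0 <= q.2 < j0 + k)%N]].

(** Boxes of the diagram indexing both the cone generators and the edges. *)
Definition adm_boxes v w : {set 'I_n * 'I_n} :=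
  [set q in oRothe v | bruhat (v * tperm (v q.2) q.1)%g w].

Definition KLgraph v w : {set 'I_n * 'I_n} :=
  [set (v q.2, q.1) | q in adm_boxes v w].

(** P_v.  [Pset_upto v s] consists of the pairs of P_v at distance at most
    s + 2; distances are at most 2 n. *)
Definition box_pair := (('I_n * 'I_n) * ('I_n * 'I_n))%type.

Definition nw_se v (q : box_pair) : bool :=
  [&& q.1 \in oRothe v, q.2 \in oRothe v,
      (q.1.1 < q.2.1)%N & (q.1.2 < q.2.2)%N].

Definition box_dist (q : box_pair) : nat :=
  ((q.2.1 - q.1.1) + (q.2.2 - q.1.2))%N.

Fixpoint Pset_upto v (s : nat) : {set box_pair} :=
  match s with
  | 0 => [set q : box_pair | [&& q.1 \in oRothe v, q.2 \in oRothe v,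
                      q.2.1 == q.1.1.+1 :> nat & q.2.2 == q.1.2.+1 :> nat]]
  | s'.+1 =>
      let P := Pset_upto v s' in
      P :|: [set q : box_pair | [&& nw_se v q, box_dist q == s'.+3 &
                         ~~ ([exists y, (q.1, y) \in P] ||
                             [exists x, (x, q.2) \in P])]]
  end.

Definition Pset v : {set box_pair} := Pset_upto v (n + n).

End Combinatorics.

Section Graphs.
Variable V : finType.

(** A directed graph on V is its set of edges. *)
Definition und_adj (E : {set V * V}) : rel V :=
  fun x y => ((x, y) \in E) || ((y, x) \in E).

Definition cyclomatic (E : {set V * V}) : int :=
  #|E|%:Z - #|V|%:Z + (n_comp (und_adj E) predT)%:Z.

(** No simple cycle of length at least 3 in the underlying undirected simple
    graph; the graphs [KLgraph v w] have neither loops nor antiparallel edges,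
    since their edges v(j) -> i satisfy v(j) < i. *)
Definition is_forest (E : {set V * V}) : Prop :=
  forall c : seq V, ucycle (und_adj E) c -> (size c <= 2)%N.

End Graphs.

Local Open Scope classical_set_scope.

(** Krull dimension of a subspace A of a topological space. *)
Section KrullDimension.
Variable T : topologicalType.

Definition irreducible_set (Z : set T) : Prop :=
  Z !=set0 /\ forall F1 F2 : set T, closed F1 -> closed F2 ->
    Z `<=` F1 `|` F2 -> Z `<=` F1 \/ Z `<=` F2.

Definition closed_in (A Z : set T) : Prop :=
  exists2 F : set T, closed F & Z = A `&` F.

Definition irreducible_chain (A : set T) (d : nat) : Prop :=
  exists Z : nat -> set T,
    (forall i, (i <= d)%N -> closed_in A (Z i) /\ irreducible_set (Z i)) /\
    (forall i, (i < d)%N -> Z i `<` Z i.+1).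

Definition krull_dim (R : realType) (A : set T) : \bar R :=
  ereal_sup [set d%:R%:E | d in irreducible_chain A].

End KrullDimension.

(** GL_n(K) with its Zariski topology, and the quotient G/B. *)
Section FlagVariety.
Variables (K : fieldType) (n : nat).

Definition GL := {A : 'M[K]_n | A \in unitmx}.

HB.instance Definition _ := SubType.on GL.
HB.instance Definition _ := Choice.on GL.

Definition poly_eval (p : mpoly.mpoly (n * n) K) (g : GL) : K :=
  mpoly.meval (fun k => mxvec (val g) 0 k) p.

(** Complements of the common zero loci of sets of polynomials. *)
Definition zariski_open : set_system GL :=
  [set U | exists S : set (mpoly.mpoly (n * n) K),
     U = ~` [set g | forall p, S p -> poly_eval p g = 0]].

Lemma zariski_openT : zariski_open setT.
Proof.
exists [set 1]; apply/seteqP; split => // g _ /= /(_ 1 erefl).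
by rewrite /poly_eval mpoly.meval1 => /eqP; rewrite oner_eq0.
Qed.

Lemma zariski_openI : setI_closed zariski_open.
Proof.
move=> _ _ [S1 ->] [S2 ->].
exists [set p | exists2 a, S1 a & exists2 b, S2 b & p = a * b].
rewrite -setCU; congr (~` _); apply/seteqP; split => g /=.
  move=> [] h _ [a Sa [b Sb ->]]; rewrite /poly_eval mpoly.mevalM.
    by rewrite -/(poly_eval a g) h// mul0r.
  by rewrite -/(poly_eval b g) h// mulr0.
move=> h; have [h1|/existsNP[a /not_implyP[Sa a0]]] :=
  pselect (forall p, S1 p -> poly_eval p g = 0); first by left.
right => b Sb; have := h _ (ex_intro2 _ _ a Sa (ex_intro2 _ _ b Sb erefl)).
rewrite /poly_eval mpoly.mevalM => /eqP; rewrite mulf_eq0 => /orP[]/eqP//.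
Qed.

Lemma zariski_open_bigU (I : Type) (f : I -> set GL) :
  (forall i, zariski_open (f i)) -> zariski_open (\bigcup_i f i).
Proof.
move=> /choice[S fS]; exists (\bigcup_i S i).
rewrite -[LHS]setCK setC_bigcup; congr (~` _); apply/seteqP; split => g /=.
  by move=> h p [i _ Sp]; have := h i Logic.I; rewrite fS setCK; exact.
by move=> h i _; rewrite fS setCK => p Sp; apply: h; exists i.
Qed.

HB.instance Definition _ := isOpenTopological.Build GL
  zariski_openT zariski_openI zariski_open_bigU.

Definition borel : set 'M[K]_n := [set b | b \in unitmx /\ is_trig_mx b^T].
Definition borel_opp : set 'M[K]_n := [set b | b \in unitmx /\ is_trig_mx b].

Definition lcosetB (g : GL) : set 'M[K]_n := [set val g *m b | b in borel].

Definition eqB (g h : GL) : bool := `[< lcosetB g = lcosetB h >].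

Lemma eqB_refl : reflexive eqB.
Proof. by move=> g; apply/asboolP. Qed.

Lemma eqB_sym : ssrbool.symmetric eqB.
Proof. by move=> g h; apply/asboolP/asboolP => ->. Qed.

Lemma eqB_trans : transitive eqB.
Proof. by move=> h g k /asboolP gh /asboolP hk; apply/asboolP; rewrite gh. Qed.

Canonical eqB_equiv := EquivRel eqB eqB_refl eqB_sym eqB_trans.

Definition GB := quotient_topology {eq_quot eqB_equiv}%qT.

HB.instance Definition _ := Topological.on GB.

Definition piB (g : GL) : GB := (\pi_GB g)%qT.

(** The subset H x B / B of G/B, where x is the permutation matrix of u. *)
Definition orbit_in_GB (H : set 'M[K]_n) (u : 'S_n) : set GB :=
  [set piB g | g in [set g : GL | exists2 h, H h &
     exists2 b, borel b & val g = h *m pmx K u *m b]].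

Definition schubert (w : 'S_n) : set GB := closure (orbit_in_GB borel w).

Definition KLvariety (v w : 'S_n) : set GB :=
  schubert w `&` orbit_in_GB borel_opp v.

End FlagVariety.

Section Complexity.
Variables (R : realType) (n : nat).
Implicit Types v w : 'S_n.

Definition weight_cone v w : set 'rV[R]_n :=
  [set x | exists2 c : 'I_n * 'I_n -> R, (forall q, 0 <= c q) &
     x = \sum_(q in adm_boxes v w)
           c q *: (delta_mx 0 (v q.2) - delta_mx 0 q.1)].

(** Dimension of the linear span: the largest number of linearly independent
    vectors in the cone. *)
Definition cone_dim (S : set 'rV[R]_n) : nat :=
  \max_(d < n.+1 | `[< exists X : d.-tuple 'rV[R]_n,
                        free X /\ forall x, x \in X -> S x >]) d.

Definition complexity v w : \bar R :=
  (krull_dim R (KLvariety (K := R[i]) v w)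
   - (cone_dim (weight_cone v w))%:R%:E)%E.

Definition is_toric v w : Prop := complexity v w = 0%E.

End Complexity.

(* Main.v *)
(** The complexity is dim N_{v,w} minus the dimension of the weight cone, and the
    latter is the rank of the graph G_{v,w}.

    Since D°(w) is a rectangle with corner (a, b), the Schubert variety of w is
    cut out by the single condition that the south-west block at (a, b) has rank
    at most m, and u <= w iff r_u(a, b) <= m.  Hence an admissible box of v is one
    whose transposition keeps r(a, b) <= m: all boxes if r_v(a, b) < m, and all but
    the kl boxes of a free block of the slice if r_v(a, b) = m.

    For the dimension, take the Schur complement of the rows and columns of the 1s
    of v in the south-west block: N_{v,w} becomes the product of an affine space
    and a determinantal variety.  It is covered by finitely many images of
    polynomial maps from K^D, D = |D°(v)| - kl, one for each choice of spanning
    rows.  A chain of length d of irreducible closed subsets yields d algebraically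
    independent functions on one of the charts, so that d <= D; releasing the
    coordinates of a chart one by one gives a chain of length D.

    For |P_v|, the recursion selects an explicit matching of the boxes, and the
    edges of the boxes that are not the first member of a pair form a basis of the
    span of all edges. *)

Require Import Defs.
From mathcomp Require Import all_boot all_order all_algebra all_fingroup.
From mathcomp Require Import all_classical.
From mathcomp Require Import reals ereal topology.
From mathcomp Require Import zify complex.
From mathcomp Require Import -(notations) mpoly.

Set Implicit Arguments.
Unset Strict Implicit.
Unset Printing Implicit Defensive.

Import Order.TTheory GRing.Theory Num.Theory.
Local Open Scope ring_scope.

(** * Rank of a graph *)

Section Families.
Variables (F : fieldType) (vT : vectType F) (T : finType).
Implicit Types (A B : {set T}) (g : T -> vT).

(** The dimension is that of a subspace of a quotient space, with no coordinate ring at hand. The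
    obstacle is to find functions on G/B that are polynomial on the slice and have closed zero sets
    there: quotients of minors of equal B-weight serve, because [Delta] is 1 on the slice. Given
    such a ring, d <= D needs neither transcendence degrees nor irreducibility of the variety: s^d
    independent monomials do not fit into a space of dimension (s B + 1)^D for large s. Covering by
    charts matters for this bound only; the lower bound takes one chart whose parameters can be read
    off one after another. With r = r_v(a, b) and indices from 0, the Schur complement has n - a - r
    rows, b + 1 - r columns and rank at most m - r. The codimension of this condition is (n - a -
    m)(b + 1 - m), from which r cancels; for v = w the same product counts D°(w), so it is kl. Hence
    kl is subtracted from |D°(v)| in both cases: if r < m the graph has all boxes as edges and kl
    stays as a correction, and if r = m exactly kl boxes are missing from it. *)

Definition fam_span A g : {vspace vT} := <<[seq g x | x <- enum A]>>%VS.

Lemma mem_fam_span A g x : x \in A -> g x \in fam_span A g.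
Proof. by move=> xA; apply/memv_span/map_f; rewrite mem_enum. Qed.

Lemma fam_span_sum A g (c : T -> F) :
  \sum_(x in A) c x *: g x \in fam_span A g.
Proof. by apply: memv_suml => x xA; apply/memvZ/mem_fam_span. Qed.

Lemma fam_spanP A g u : u \in fam_span A g ->
  exists c : T -> F, u = \sum_(x in A) c x *: g x.
Proof.
rewrite /fam_span span_def big_map big_enum => /memv_sumP[w wP ->].
have /fin_all_exists[c cP] x : exists k : F, x \in A -> w x = k *: g x.
  have [/wP/vlineP[k ->]|//] := boolP (x \in A); first by exists k.
  by exists 0.
by exists c; apply: eq_bigr => x /cP.
Qed.

Lemma fam_span_sub A g (U : {vspace vT}) :
  {in A, forall x, g x \in U} -> (fam_span A g <= U)%VS.
Proof.
by move=> AU; apply/span_subvP => _ /mapP[x xA ->]; apply: AU; rewrite -mem_enum.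
Qed.

Lemma free_familyP A g :
  reflect (forall c : T -> F, \sum_(x in A) c x *: g x = 0 ->
             {in A, forall x, c x = 0})
          (free [seq g x | x <- enum A]).
Proof.
have szE : size [seq g x | x <- enum A] = #|A| by rewrite size_map -cardE.
pose X := @Tuple #|A| _ [seq g x | x <- enum A] (introT eqP szE).
have XE (i : 'I_#|A|) : X`_i = g (enum_val i).
  by rewrite (nth_map (enum_val i)) -?cardE ?ltn_ord // -enum_val_nth.
rewrite -[[seq g x | x <- enum A]]/(tval X).
apply: (iffP (@freeP _ _ _ X)) => [fX c c0 x xA | fA k k0 i].
  have := fX (fun i => c (enum_val i)).
  under eq_bigr do rewrite XE.
  rewrite -(big_enum_val (fun x => c x *: g x)) => /(_ c0).
  by move=> /(_ (enum_rank_in xA x)); rewrite enum_rankK_in.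
have iA := enum_valP i.
have := fA (fun x => k (enum_rank_in iA x)).
move=> /(_ _ _ iA); rewrite enum_valK_in; apply.
rewrite big_enum_val -[RHS]k0; apply: eq_bigr => j _.
by rewrite enum_valK_in XE.
Qed.

Lemma free_fam_dim A g :
  free [seq g x | x <- enum A] = (\dim (fam_span A g) == #|A|).
Proof. by rewrite /free size_map -cardE. Qed.

End Families.

(** The basis is taken among the given vectors: in [cone_dimE] the independent vectors must lie in
    the cone, not merely in its span. *)
Lemma span_free_subseq (F : fieldType) (vT : vectType F) (X : seq vT) :
  exists Y, [/\ {subset Y <= X}, free Y & <<Y>>%VS = <<X>>%VS].
Proof.
elim: X => [|x X [Y [YX fY YE]]]; first by exists [::]; rewrite nil_free.
have [xY|xY] := boolP (x \in <<Y>>%VS).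
  exists Y; split=> //; first by move=> y /YX; rewrite inE orbC => ->.
  by rewrite span_cons -YE; apply/esym/addv_idPr; rewrite -memvE.
exists (x :: Y); split; last by rewrite !span_cons YE.
  by move=> y; rewrite !inE => /orP[->//|/YX ->]; rewrite orbT.
by rewrite free_cons xY.
Qed.

Section GraphRank.
Variables (F : fieldType) (n : nat).
Implicit Types (E : {set 'I_n * 'I_n}) (e : 'I_n * 'I_n).

Definition edge_vec e : 'rV[F]_n := delta_mx 0 e.1 - delta_mx 0 e.2.

Notation edge_span E := (fam_span E edge_vec).

Lemma edge_vecE e x : edge_vec e 0 x = (x == e.1)%:R - (x == e.2)%:R.
Proof. by rewrite !mxE. Qed.

Lemma edge_vecN x y : edge_vec (y, x) = - edge_vec (x, y).
Proof. by rewrite /edge_vec opprB. Qed.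

Lemma edge_vecD x y z : edge_vec (x, y) + edge_vec (y, z) = edge_vec (x, z).
Proof. by rewrite /edge_vec /= addrA subrK. Qed.

Lemma path_edge_span E x p :
  path (und_adj E) x p -> edge_vec (x, last x p) \in edge_span E.
Proof.
elim: p x => [|y p IH] x /=; first by rewrite /edge_vec subrr mem0v.
case/andP=> xy /IH yp; rewrite -(edge_vecD x y); apply: memvD yp.
case/orP: xy => xy; first exact: mem_fam_span.
by rewrite edge_vecN memvN; exact: mem_fam_span.
Qed.

Lemma connect_edge_span E x y :
  connect (und_adj E) x y -> edge_vec (x, y) \in edge_span E.
Proof. by case/connectP=> p pE ->; exact: path_edge_span. Qed.

Lemma und_adj_sym E : ssrbool.symmetric (und_adj E).
Proof. by move=> x y; rewrite /und_adj orbC. Qed.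

Lemma edge_vec_functional e (f : 'I_n -> F) :
  \sum_x edge_vec e 0 x * f x = f e.1 - f e.2.
Proof.
under eq_bigr => x _ do rewrite edge_vecE mulrBl.
rewrite sumrB (bigD1 e.1) //= [X in _ - X](bigD1 e.2) //= !eqxx !mul1r.
by rewrite !big1 ?addr0 // => x /negPf ->; rewrite mul0r.
Qed.

Lemma edge_span_functional E (f : 'I_n -> F) u :
  {in E, forall e, f e.1 = f e.2} -> u \in edge_span E ->
  \sum_x u 0 x * f x = 0.
Proof.
move=> fE /fam_spanP[c ->].
transitivity (\sum_(e in E) c e * \sum_x edge_vec e 0 x * f x).
  under eq_bigr => x _ do rewrite summxE mulr_suml.
  rewrite exchange_big; apply: eq_bigr => e _.
  by rewrite mulr_sumr; apply: eq_bigr => x _; rewrite mxE mulrA.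
by rewrite big1 // => e eE; rewrite edge_vec_functional fE // subrr mulr0.
Qed.

Lemma edge_span_connect E x y :
  edge_vec (x, y) \in edge_span E -> connect (und_adj E) x y.
Proof.
move=> xyE.
have cs : connect_sym (und_adj E) by apply/sym_connect_sym/und_adj_sym.
(* The indicator of the component of x is constant along edges, so pairing with it kills the edge
   span; on [edge_vec (x, y)] it gives 1 unless y is in that component. *)
have := @edge_span_functional E (fun z => (connect (und_adj E) x z)%:R) _ _ xyE.
rewrite edge_vec_functional /= connect0 => h.
have [//|nxy] := boolP (connect _ x y).
have := h _; rewrite (negPf nxy) subr0 => /(_ _)/eqP; rewrite oner_eq0 => -> //.
move=> [s t] st /=; congr ((nat_of_bool _)%:R); apply/idP/idP => /connect_trans; apply.
  by apply: connect1; rewrite /und_adj st.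
by apply: connect1; rewrite /und_adj st orbT.
Qed.

(** The vectors [edge_vec (x, r x)], x not a root, form a basis: every edge is a difference of two
    such vectors (that of a root being 0), and coordinate x is nonzero only at the member x, because
    every [r y] is a root. *)
Lemma dim_edge_span E : \dim (edge_span E) = (n - n_comp (und_adj E) predT)%N.
Proof.
have cs : connect_sym (und_adj E) by apply/sym_connect_sym/und_adj_sym.
pose r := fingraph.root (und_adj E); pose A := [set x | r x != x].
pose g x := edge_vec (x, r x).
have -> : fam_span E edge_vec = fam_span A g.
  apply/eqP; rewrite eqEsubv; apply/andP; split; apply: fam_span_sub.
    move=> [x y] xyE.
    have rxy : r x = r y.
      by apply/eqP; rewrite root_connect //; apply: connect1; rewrite /und_adj xyE.
    have gA z : g z \in fam_span A g.
      have [zA|] := boolP (z \in A); first exact: mem_fam_span.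
      by rewrite inE negbK => /eqP zE; rewrite /g zE /edge_vec subrr mem0v.
    have -> : edge_vec (x, y) = g x - g y by rewrite /g -rxy -edge_vecN edge_vecD.
    exact: memvB.
  by move=> x _; apply/connect_edge_span/connect_root.
have : free [seq g x | x <- enum A].
  apply/free_familyP => c c0 x xA.
  move/matrixP/(_ 0 x): c0; rewrite summxE mxE (bigD1 x) //= big1 => [|y].
    move: xA; rewrite addr0 mxE edge_vecE /= eqxx inE eq_sym => /negPf ->.
    by rewrite subr0 mulr1.
  case/andP=> yA yx; rewrite mxE edge_vecE /= eq_sym (negPf yx).
  suff /negPf -> : x != r y by rewrite subrr mulr0.
  by apply: contraTneq xA => ->; rewrite inE negbK /r root_root.
rewrite free_fam_dim => /eqP ->.
rewrite -[LHS](addnK #|[set x | r x == x]|).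
have -> : [set x | r x == x] = ~: A by apply/setP => x; rewrite !inE negbK.
rewrite cardsC card_ord; congr (_ - _)%N; apply: eq_card => x.
by rewrite !inE negbK andbT.
Qed.

Lemma n_comp_le E : (n_comp (und_adj E) predT <= n)%N.
Proof. by rewrite -[X in (_ <= X)%N](card_ord n); exact: max_card. Qed.

Lemma cyclomatic_rank E :
  cyclomatic E = #|E|%:Z - (\dim (edge_span E))%:Z.
Proof.
rewrite /cyclomatic dim_edge_span -subzn ?n_comp_le // card_ord.
by rewrite opprB addrA addrAC.
Qed.

(** [is_forest] does not see cycles of length at most 2, and the hypothesis excludes the loops and
    antiparallel edges that would be dependent without a longer cycle. A dependent edge is bypassed
    by a path in the other edges, which closes to a cycle; conversely a cycle telescopes to a
    dependency. *)
Lemma forest_free E : (forall e, e \in E -> (e.1 < e.2)%N) ->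
  is_forest E <-> free [seq edge_vec e | e <- enum E].
Proof.
move=> Elt; split=> [fE|fE c].
  apply/free_familyP => c c0 e eE.
  apply/eqP/negP => /negP ce0.
  have : edge_vec e \in fam_span (E :\ e) edge_vec.
    have -> : edge_vec e = \sum_(x in E :\ e) (- (c e)^-1 * c x) *: edge_vec x.
      move: c0; rewrite (bigD1 e) //= => /eqP; rewrite addr_eq0 => /eqP h.
      rewrite -[LHS](scalerK ce0) h scalerN -scaleNr scaler_sumr.
      apply: eq_big => [x|x _]; first by rewrite !inE andbC.
      by rewrite scalerA.
    exact: fam_span_sum.
  case: e eE ce0 => x y xyE _ /edge_span_connect /connectP[p pE yE].
  case/shortenP: pE yE => q qE uq _ yE.
  have sub : subrel (und_adj (E :\ (x, y))) (und_adj E).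
    by move=> s t /orP[]; rewrite inE /und_adj => /andP[_ ->]; rewrite ?orbT.
  have := fE (x :: q); rewrite /ucycle uq andbT /= rcons_path (sub_path sub qE) -yE.
  rewrite /und_adj xyE orbT => /(_ isT).
  have xy := Elt _ xyE; rewrite /= in xy.
  (* An empty path would make the edge a loop, and a path of one edge would use (y, x); the order on
     edges rules out both. *)
  case: q qE yE {uq} => [_ /= yx|z [|//] /=]; first by rewrite yx ltnn in xy.
  rewrite andbT => + yz; rewrite -yz /und_adj !inE eqxx /=.
  by case/andP=> _ /Elt /=; rewrite ltnNge ltnW.
rewrite /ucycle; case: c => [//|x [//|y [//|z p]]] /andP[/= + uc].
case/and3P=> xy yz zp; exfalso.
pose e := if (x, y) \in E then (x, y) else (y, x).
have eE : e \in E by rewrite /e; case: ifP xy => // xyE /orP[]; rewrite ?xyE.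
have : edge_vec (y, x) \in fam_span (E :\ e) edge_vec.
  have -> : x = last y (z :: rcons p x) by rewrite /= last_rcons.
  apply: path_edge_span => /=.
  (* An edge with an endpoint outside {x, y} differs from e; the rest of the cycle consists of such
     edges, its vertices being distinct. *)
  have adj s t : und_adj E s t -> [|| (s \notin [:: x; y]) | (t \notin [:: x; y])] ->
      und_adj (E :\ e) s t.
    rewrite /und_adj => /orP[] h1 h2; rewrite !in_setD1 h1 ?andbT; apply/orP; [left|right];
    apply: contraTneq h2 => h; move: h; rewrite /e !inE; case: ifP => _ [-> ->];
    by rewrite !eqxx ?orbT.
  move: uc => /= /and3P[]; rewrite !inE !negb_or => /and3P[xny xnz xp] /andP[ynz yp] _.
  rewrite adj //=; last by rewrite !inE !negb_or (eq_sym z x) xnz (eq_sym z y) ynz orbT.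
  move: zp xp yp xnz ynz; elim: p z {yz} => [|t p IH] z /=.
    by rewrite !andbT => zx _ _ xz yz; rewrite adj // !inE !negb_or (eq_sym z x) xz eq_sym yz.
  rewrite !inE !negb_or => /andP[zt tp] /andP[xt xp] /andP[yt yp] xz yz.
  by rewrite IH // adj // !inE !negb_or (eq_sym z x) xz eq_sym yz.
have : edge_vec e \notin fam_span (E :\ e) edge_vec.
  apply/negP => /fam_spanP[c cE].
  move/free_familyP: fE => /(_ (fun x => if x == e then 1 else - c x)) h.
  suff /h /(_ e eE) /eqP : \sum_(x in E) (if x == e then 1 else - c x) *: edge_vec x = 0.
    by rewrite eqxx oner_eq0.
  rewrite (bigD1 e) //= eqxx scale1r {1}cE.
  rewrite [X in _ + X](eq_bigl (mem (E :\ e))) => [|s]; last by rewrite !inE andbC.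
  rewrite -big_split big1 // => s; rewrite in_setD1 => /andP[/negPf /= -> _].
  by rewrite scaleNr subrr.
by rewrite /e; case: ifP => _; rewrite // edge_vecN memvN => /negP.
Qed.

End GraphRank.

Notation edge_span F E := (fam_span E (@edge_vec F _)).

(** * The set P_v *)

Section NestedPairs.
Variables (n : nat) (v : 'S_n).
Local Notation vi := (v^-1)%g.
Implicit Types (p q : 'I_n * 'I_n) (i j k l : 'I_n).

Lemma in_oRothe i j : ((i, j) \in oRothe v) = (v j < i)%N && (j < vi i)%N.
Proof. by rewrite inE. Qed.

(** The recursion defining P_v selects exactly these pairs: l is the first
    column after j with v(l) <= i, and k the first row after i whose 1 is east
    of column l.  Conversely i is the last row before k with v^-1(i) >= l, and
    j the last column before l with v(j) < i. *)
Definition nested (q : box_pair n) : bool :=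
  [&& nw_se v q, (v q.2.2 <= q.1.1)%N, (q.2.2 <= vi q.1.1)%N,
      [forall l : 'I_n, (q.1.2 < l < q.2.2)%N ==> (q.1.1 < v l)%N] &
      [forall k : 'I_n, (q.1.1 < k < q.2.1)%N ==> (vi k <= q.2.2)%N]].

Lemma nestedP i j k l :
  reflect ([/\ (v j < i)%N, (j < vi i)%N, (v l < k)%N & (l < vi k)%N] /\
           [/\ (i < k)%N, (j < l)%N, (v l <= i)%N & (l <= vi i)%N] /\
           (forall l' : 'I_n, (j < l')%N -> (l' < l)%N -> (i < v l')%N) /\
           (forall k' : 'I_n, (i < k')%N -> (k' < k)%N -> (vi k' <= l)%N))
          (nested ((i, j), (k, l))).
Proof.
rewrite /nested /nw_se /= !in_oRothe.
apply: (iffP idP) => [/and5P[/and4P[/andP[h1 h2] /andP[h3 h4] h5 h6] h7 h8 /forallP h9 /forallP h10]|].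
  split=> //; split=> //; split=> [l' a b|k' a b].
    by have := h9 l'; rewrite a b.
  by have := h10 k'; rewrite a b.
case=> -[-> -> -> ->] [[-> -> -> ->]] [h9 h10] /=.
apply/andP; split; apply/forallP => z; apply/implyP => /andP[]; first exact: h9.
exact: h10.
Qed.

Lemma nested_injr p q q' : nested (p, q) -> nested (p, q') -> q = q'.
Proof.
case: p q q' => i j [k l] [k' l'].
case/nestedP=> -[_ _ a1 a2] [[a3 a4 a5 a6] [a7 a8]].
case/nestedP=> -[_ _ b1 b2] [[b3 b4 b5 b6] [b7 b8]].
have ll : l = l'.
  apply: val_inj; case: (ltngtP l l') => // h.
    by have := b7 l a4 h; rewrite ltnNge a5.
  by have := a7 l' b4 h; rewrite ltnNge b5.
subst l'; congr (_, _); apply: val_inj; case: (ltngtP k k') => // h.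
  by have := b8 k a3 h; rewrite leqNgt a2.
by have := a8 k' b3 h; rewrite leqNgt b2.
Qed.

Lemma nested_injl p p' q : nested (p, q) -> nested (p', q) -> p = p'.
Proof.
wlog : p p' / (p.1 <= p'.1)%N => [W h h'|].
  by case/orP: (leq_total p.1 p'.1) => le; [|symmetry]; exact: W.
case: p p' q => i j [i' j'] [k l] /= ii.
case/nestedP=> -[c1 c2 a1 a2] [[a3 a4 a5 a6] [a7 a8]].
case/nestedP=> -[d1 d2 b1 b2] [[b3 b4 b5 b6] [b7 b8]].
have {}ii : i = i'.
  apply: val_inj; case: ltngtP ii => // h _.
  (* Row i' lies strictly between i and k, hence [vi i' <= l]; with [l <= vi i'] the 1 of row i' is
     in column l, against [v l <= i]. *)
  have lE : l = vi i' by apply/val_inj/eqP; rewrite eqn_leq b6 a8.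
  by move: a5; rewrite lE permKV leqNgt h.
subst i'; congr (_, _); apply: val_inj; case: (ltngtP j j') => // h.
  by have := a7 j' h b4; rewrite ltnNge ltnW.
by have := b7 j h a4; rewrite ltnNge ltnW.
Qed.

Lemma nested_right i j k l : (i, j) \in oRothe v ->
  (i < k)%N -> (j < l)%N -> (v l <= i)%N -> (l < vi k)%N ->
  exists k' l', nested ((i, j), (k', l')) /\ (k' <= k)%N /\ (l' <= l)%N.
Proof.
rewrite in_oRothe => /andP[vji jvi] ik jl vli lvk.
pose Ph0 := fun l0 : 'I_n => (j < l0)%N && (v l0 <= i)%N.
have h0 : Ph0 l by rewrite /Ph0 jl.
case: (@arg_minnP _ _ Ph0 (fun x : 'I_n => x : nat) h0) => l0 /andP[jl0 vl0] min0.
have l0l : (l0 <= l)%N by apply: min0; rewrite /Ph0 jl vli.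
pose Ph1 := fun k0 : 'I_n => (i < k0)%N && (l0 < vi k0)%N.
have h1 : Ph1 k.
  by rewrite /Ph1 ik (leq_ltn_trans l0l).
case: (@arg_minnP _ _ Ph1 (fun x : 'I_n => x : nat) h1) => k0 /andP[ik0 lk0] min1.
have k0k : (k0 <= k)%N by apply: min1; exact: h1.
exists k0, l0; split=> //; apply/nestedP; split; first by split=> //; exact: leq_ltn_trans ik0.
split; [split=> //|split].
(* Column [vi i] competes in the choice of l0, its 1 being in row i. *)
- by apply: min0; rewrite /Ph0 jvi permKV leqnn.
- move=> l' jl' l'l0; rewrite ltnNge; apply/negP => vl'.
  by move: l'l0; rewrite ltnNge min0 // /Ph0 jl' vl'.
- move=> k' ik' k'k0; rewrite leqNgt; apply/negP => lk'.
  by move: k'k0; rewrite ltnNge min1 // /Ph1 ik' lk'.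
Qed.

Lemma nested_left i j k l : nw_se v ((i, j), (k, l)) -> (l <= vi i)%N ->
  exists i' j', nested ((i', j'), (k, l)) /\ (i <= i')%N /\ (j <= j')%N.
Proof.
rewrite /nw_se /= !in_oRothe => /and4P[/andP[vji jvi] /andP[vlk lvk] ik jl] lvi.
pose Ph0 := fun i0 : 'I_n => (i0 < k)%N && (l <= vi i0)%N.
have h0 : Ph0 i by rewrite /Ph0 ik lvi.
case: (@arg_maxnP _ _ Ph0 (fun x : 'I_n => x : nat) h0) => i0 /andP[i0k li0] m0.
have max0 y : Ph0 y -> (y <= i0)%N by exact: m0.
have ii0 : (i <= i0)%N by apply: max0; exact: h0.
pose Ph1 := fun j0 : 'I_n => (j0 < l)%N && (v j0 < i0)%N.
have h1 : Ph1 j.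
  by rewrite /Ph1 jl (leq_trans vji).
case: (@arg_maxnP _ _ Ph1 (fun x : 'I_n => x : nat) h1) => j0 /andP[j0l vj0] m1.
have max1 y : Ph1 y -> (y <= j0)%N by exact: m1.
have jj0 : (j <= j0)%N by apply: max1; exact: h1.
exists i0, j0; split=> //; apply/nestedP; split; first by split=> //; exact: leq_trans li0.
(* Row [v l] itself competes in the maximum defining i0. *)
have vli0 : (v l <= i0)%N by apply: max0; rewrite /Ph0 vlk permK leqnn.
split; [by split|split].
- move=> l' jl' l'l; rewrite ltnNge; apply/negP => vl'.
  have [E|ne] := eqVneq (v l') i0.
    by move: li0; rewrite -E permK leqNgt l'l.
  move: jl'; rewrite ltnNge max1 // /Ph1 l'l /= ltn_neqAle vl' andbT.
  by apply: contra_neq ne => /val_inj.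
- move=> k' ik' k'k; rewrite leqNgt; apply/negP => lk'.
  by move: ik'; rewrite ltnNge max0 // /Ph0 k'k ltnW.
Qed.

(** Stability: a pair that is not nested is preceded, in the recursion, by a
    nested pair with the same first or the same second box. *)
Lemma nested_blocks p q : nw_se v (p, q) ->
  (exists q', nested (p, q') /\ (q'.1 <= q.1)%N /\ (q'.2 <= q.2)%N) \/
  (exists p', nested (p', q) /\ (p.1 <= p'.1)%N /\ (p.2 <= p'.2)%N).
Proof.
case: p q => i j [k l] pq; have [lvi|vil] := leqP l (vi i).
  by have [i' [j' ?]] := nested_left pq lvi; right; exists (i', j').
have /and4P[pD qD /= ik jl] := pq.
have := pD; rewrite in_oRothe => /andP[_ jvi].
have := qD; rewrite in_oRothe => /andP[_ lvk].
(* Here [vi i < l], and column [vi i] replaces l: its 1 is in row i, and it is still west of the 1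
   of row k. *)
have [|k' [l' [h [h1 h2]]]] := @nested_right i j k (vi i) pD ik jvi _ (ltn_trans vil lvk).
  by rewrite permKV.
by left; exists (k', l'); rewrite h h1 (leq_trans h2) // ltnW.
Qed.

Lemma nested_nw_se (q : box_pair n) : nested q -> nw_se v q. Proof. by case/and5P. Qed.

(** Boxes in north-west to south-east position are at distance at least 2, whence the offset. At
    each new distance, a pair that is not nested is blocked by a strictly closer nested pair given
    by [nested_blocks]; a nested pair is never blocked, since distinct nested pairs share neither a
    first nor a second box. *)
Lemma Pset_upto_nested s :
  Pset_upto v s = [set q | nested q && (box_dist q <= s.+2)%N].
Proof.
elim: s => [|s IH] /=; apply/setP => -[[i j] [k l]]; rewrite !inE /=.
  apply/and4P/andP => [[ijD klD /eqP kE /eqP lE]|].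
    rewrite /box_dist /= kE lE !subSn // !subnn; split=> //; apply/nestedP.
    move: ijD klD => /andP[vji jvi] /andP[vlk lvk]; split; first by [].
    split; [by rewrite kE lE; split=> //; rewrite -ltnS -?kE|split].
      by move=> l' jl'; rewrite lE ltnS leqNgt jl'.
    by move=> k' ik'; rewrite kE ltnS leqNgt ik'.
  case=> /nestedP[[h1 h2 h3 h4] [[h5 h6 _ _] _]]; rewrite /box_dist /= => d.
  rewrite h1 h2 h3 h4; split=> //.
    by move: h5 h6 d; clear; lia.
  by move: h5 h6 d; clear; lia.
rewrite IH inE /=.
have [le|gt] /= := leqP (box_dist ((i, j), (k, l))) s.+2.
  rewrite andbT (leqW le) andbT; have [//|_ /=] := boolP (nested _).
  by rewrite (ltn_eqF (leq_ltn_trans le _)) ?andbF.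
rewrite andbF /= [in RHS]leq_eqVlt [in RHS]ltnS (leqNgt _ s.+2) gt orbF.
have [dE|_] := eqVneq (box_dist _) s.+3; last by rewrite !andbF.
rewrite andbT /=; apply/andP/idP => [[pq /norP[nL nR]]|pqM].
  case: (nested_blocks pq) => [[[k' l'] /= [h [hk hl]]]|[[i' j'] /= [h [hi hj]]]].
    have [qE|ne] := eqVneq (k', l') (k, l); first by rewrite -qE.
    case/negP: nL; apply/existsP; exists (k', l'); rewrite inE h /=.
    move: (nested_nw_se h) pq dE ne => /and4P[_ _ /= a1 a2] /and4P[_ _ /= b1 b2].
    rewrite /box_dist /= xpair_eqE -!val_eqE /= negb_and.
    by move: hk hl a1 a2 b1 b2; clear; lia.
  have [qE|ne] := eqVneq (i', j') (i, j); first by rewrite -qE.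
  case/negP: nR; apply/existsP; exists (i', j'); rewrite inE h /=.
  move: (nested_nw_se h) pq dE ne => /and4P[_ _ /= a1 a2] /and4P[_ _ /= b1 b2].
  rewrite /box_dist /= xpair_eqE -!val_eqE /= negb_and.
  by move: hi hj a1 a2 b1 b2; clear; lia.
split; first exact: nested_nw_se.
apply/norP; split; apply/existsPn => z; rewrite inE; apply/negP => /andP[h].
  by rewrite -(nested_injr pqM h) dE ltnn.
by rewrite -(nested_injl pqM h) dE ltnn.
Qed.

Lemma Pset_nested : Pset v = [set q | nested q].
Proof.
rewrite /Pset Pset_upto_nested; apply/setP => -[[i j] [k l]]; rewrite !inE.
rewrite (_ : (box_dist _ <= _)%N) ?andbT // /box_dist /=.
by move: (ltn_ord k) (ltn_ord l); clear; lia.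
Qed.

Definition unpaired : {set 'I_n * 'I_n} :=
  [set p in oRothe v | [forall q, ~~ nested (p, q)]].

Lemma card_Pset : (#|Pset v| + #|unpaired|)%N = #|oRothe v|.
Proof.
have -> : #|Pset v| = #|[set q.1 | q in Pset v]|.
  rewrite card_in_imset // => -[p q] [p' q']; rewrite Pset_nested !inE /=.
  by move=> h h' E; subst p'; rewrite (nested_injr h h').
rewrite -(cardsID [set q.1 | q in Pset v] (oRothe v)).
congr (_ + _)%N; apply: eq_card => p; rewrite !inE.
  apply/idP/andP => [pP|[]//]; split=> //; case/imsetP: pP => q; rewrite Pset_nested inE.
  by case/nested_nw_se/and4P => + _ _ _ ->; rewrite inE.
rewrite andbC; congr (_ && _); apply/forallP/negP => [h /imsetP[[p' q]]|h q].
  by rewrite Pset_nested inE /= => pq E; subst p'; have := h q; rewrite pq.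
by apply/negP => pq; apply: h; apply/imsetP; exists (p, q) => //; rewrite Pset_nested inE.
Qed.

Lemma unpairedP i j k l : (i, j) \in unpaired ->
  (i < k)%N -> (j < l)%N -> (v l <= i)%N -> (vi k <= l)%N.
Proof.
rewrite inE => /andP[D /forallP h] ik jl vl; rewrite leqNgt; apply/negP => lk.
by have [k' [l' [N _]]] := nested_right D ik jl vl lk; have := h (k', l'); rewrite N.
Qed.

Section Basis.
Variable F : fieldType.

Definition box_vec q : 'rV[F]_n := edge_vec F (v q.2, q.1).

(** The box (i, j) of a nested pair is the sum of later edges: the other two
    sides of a triangle if v(l) = i, else the other three sides of a 4-cycle. *)
Lemma unpaired_span : fam_span unpaired box_vec = fam_span (oRothe v) box_vec.
Proof.
apply/eqP; rewrite eqEsubv; apply/andP; split; apply: fam_span_sub => -[i j].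
  by rewrite inE => /andP[? _]; exact: mem_fam_span.
have [s] := ubnP (n + n - (i + j)); elim: s i j => // s IH i j sle ijD.
have [ijU|] := boolP ((i, j) \in unpaired); first exact: mem_fam_span.
rewrite inE ijD => /forallPn[[k l]]; rewrite negbK => /nestedP.
case=> -[h1 h2 h3 h4] [[h5 h6 h7 h8] _].
have mem (i' j' : 'I_n) : (i + j < i' + j')%N -> (v j' < i')%N -> (j' < vi i')%N ->
    box_vec (i', j') \in fam_span unpaired box_vec.
  move=> lt a b; apply: IH; rewrite ?in_oRothe ?a //.
  by move: (ltn_ord i') (ltn_ord j') sle lt; clear; lia.
have kj : box_vec (k, j) \in fam_span unpaired box_vec.
  by apply: mem; rewrite ?ltn_add2r // ?(ltn_trans h1 h5) // (ltn_trans h6 h4).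
have kl : box_vec (k, l) \in fam_span unpaired box_vec.
  by apply: mem => //; rewrite -addnS leq_add // ltnW.
have [E|ne] := eqVneq (v l) i.
  have -> : box_vec (i, j) = box_vec (k, j) - box_vec (k, l).
    by rewrite /box_vec /= E -edge_vecN edge_vecD.
  exact: memvB.
have il : box_vec (i, l) \in fam_span unpaired box_vec.
  apply: mem; first by rewrite ltn_add2l.
    by rewrite ltn_neqAle h7 andbT; apply: contra_neq ne => /val_inj.
  rewrite ltn_neqAle h8 andbT; apply: contra_neq ne => /val_inj ->.
  by rewrite permKV.
have -> : box_vec (i, j) = box_vec (k, j) - box_vec (k, l) + box_vec (i, l).
  by rewrite /box_vec /= -edge_vecN !edge_vecD.
by rewrite memvD // memvB.
Qed.

Lemma unpaired_free : free [seq box_vec q | q <- enum unpaired].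
Proof.
apply/free_familyP => c c0.
(* The number i n + j orders the boxes row by row: the coefficients of earlier boxes vanish by
   induction, and the functional f below removes the later boxes. *)
suff H s (i j : 'I_n) : (i * n + j < s)%N -> (i, j) \in unpaired -> c (i, j) = 0.
  by move=> [i j]; apply: (H (i * n + j).+1).
elim: s i j => // s IH i j sle ijU.
(* f vanishes on the edges of the unpaired boxes (i', j') with i' > i, or with
   i' = i and j' > j. *)
pose f (x : 'I_n) : F := ((j < vi x)%N && (x <= i)%N)%:R.
have ijD : (v j < i)%N && (j < vi i)%N by move: ijU; rewrite inE in_oRothe => /andP[].
have : \sum_(q in unpaired) c q * (f (v q.2) - f q.1) = 0.
  transitivity (\sum_x (\sum_(q in unpaired) c q *: box_vec q) 0 x * f x).
    under [RHS]eq_bigr => x _ do rewrite summxE mulr_suml.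
    rewrite exchange_big; apply: eq_bigr => q _ /=.
    rewrite -[f _ - _](edge_vec_functional (v q.2, q.1)) mulr_sumr.
    by apply: eq_bigr => x _; rewrite !mxE mulrA.
  by rewrite c0; apply: big1 => x _; rewrite mxE mul0r.
rewrite (bigD1 (i, j)) //= big1 => [|[i' j'] /andP[U' ne]].
  case/andP: ijD => ij jvi.
  rewrite addr0 /f permK ltnn jvi leqnn /= sub0r => /eqP.
  by rewrite mulrN1 oppr_eq0 => /eqP.
have D' : (v j' < i')%N && (j' < vi i')%N by move: U'; rewrite inE in_oRothe => /andP[].
case/andP: D' => vji' jvi'; rewrite /= /f permK.
have [lt|gt|/val_inj iE] := ltngtP i' i.
- rewrite (IH i' j') ?mul0r //; apply: (@leq_trans (i * n + j)) => //.
  have : (i'.+1 * n <= i * n)%N by rewrite leq_mul2r lt orbT.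
  by rewrite mulSn; move: (ltn_ord j'); clear; lia.
- rewrite andbF subr0; have [jj'|] := ltnP j j'; last by rewrite mulr0.
  have [vj'|] := leqP (v j') i; last by rewrite mulr0.
  by have := unpairedP ijU gt jj' vj'; rewrite leqNgt jvi'.
subst i'; case/andP: ijD => ij ->; rewrite ?leqnn (ltnW vji') /=.
have [lt|gt|/val_inj jE] := ltngtP j j'.
- by rewrite subrr mulr0.
- by rewrite (IH i j') ?mul0r //; apply: (@leq_trans (i * n + j)); rewrite // ltn_add2l.
by subst j'; rewrite eqxx in ne.
Qed.

Lemma card_Pset_rank :
  #|Pset v|%:Z = #|oRothe v|%:Z - (\dim (fam_span (oRothe v) box_vec))%:Z.
Proof.
have := unpaired_free; rewrite free_fam_dim -unpaired_span => /eqP ->.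
by rewrite -card_Pset PoszD addrK.
Qed.

End Basis.
End NestedPairs.

(** * The Bruhat order below w *)

Section OrdinalCounts.
Variable n : nat.

Lemma card_ord_lt c : (c <= n)%N -> #|[set x : 'I_n | (x < c)%N]| = c.
Proof.
by move=> cn; rewrite -sum1dep_card (big_ord_narrow cn) sum1_card card_ord.
Qed.

Lemma card_ord_ge c : #|[set x : 'I_n | (c <= x)%N]| = (n - c)%N.
Proof.
have [cn|/ltnW nc] := leqP c n.
  rewrite -[X in (X - _)%N](card_ord n) -(cardsC [set x : 'I_n | (x < c)%N]).
  by rewrite card_ord_lt // addKn; apply: eq_card => x; rewrite !inE -leqNgt.
apply/eqP; rewrite (eqP nc) cards_eq0; apply/eqP/setP => x; rewrite !inE.
by rewrite leqNgt (leq_trans (ltn_ord x)) // -subn_eq0.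
Qed.

Lemma card_ord_itv c d : (c + d <= n)%N -> #|[set x : 'I_n | (c <= x < c + d)%N]| = d.
Proof.
move=> cd; have := cardsID [set x : 'I_n | (x < c)%N] [set x : 'I_n | (x < c + d)%N].
rewrite (card_ord_lt cd) (_ : _ :&: _ = [set x : 'I_n | (x < c)%N]); last first.
  by apply/setP => x; rewrite !inE andb_idl // => /leq_trans -> //; apply: leq_addr.
rewrite card_ord_lt; last exact: leq_trans (leq_addr _ _) cd.
move/addnI => E; rewrite -[RHS]E; apply: eq_card => x; rewrite !inE -leqNgt //.
Qed.

Lemma card_perm_pre (u : 'S_n) (P : pred 'I_n) : #|[set x | P (u x)]| = #|[set x | P x]|.
Proof.
rewrite -[RHS](card_imset _ (@perm_inj _ u^-1%g)); apply: eq_card => x.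
rewrite inE; apply/idP/imsetP => [Px|[y + ->]]; last by rewrite inE permKV.
by exists (u x); rewrite ?inE ?permK.
Qed.

Lemma down_closed_ltn (X : {set 'I_n}) :
  (forall x y : 'I_n, (x < y)%N -> y \in X -> x \in X) ->
  forall x : 'I_n, (x \in X) = (x < #|X|)%N.
Proof.
move=> dc x; apply/idP/idP => [xX|].
  rewrite -(card_ord_lt (ltn_ord x)); apply: subset_leq_card; apply/fintype.subsetP => y.
  rewrite inE ltnS leq_eqVlt => /orP[/eqP/val_inj -> //|/dc]; exact.
apply: contraTT => xX; rewrite -leqNgt -(card_ord_lt (ltnW (ltn_ord x))).
apply: subset_leq_card; apply/fintype.subsetP => y yX; rewrite inE ltnNge; apply: contraNN xX.
by rewrite leq_eqVlt => /orP[/eqP/val_inj -> //|/dc]; apply.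
Qed.

Lemma perm_val_count (u : 'S_n) x : (u x : nat) = #|[set y | (u y < u x)%N]|.
Proof.
by rewrite (card_perm_pre u (fun y => (y < u x)%N)) card_ord_lt // ltnW.
Qed.

(** [u x] is the number of y with [u y < u x], so relative orders determine u. *)
Lemma eq_perm_pattern (u w : 'S_n) :
  (forall i j : 'I_n, (i < j)%N -> (u i < u j)%N = (w i < w j)%N) -> u = w.
Proof.
move=> uw; apply/permP => x; apply: val_inj => /=.
rewrite [LHS]perm_val_count [RHS]perm_val_count; apply: eq_card => y; rewrite !inE.
case: (ltngtP y x) => [/uw -> //|h|/val_inj ->]; last by rewrite !ltnn.
have neq (s : 'S_n) : (s y < s x)%N = ~~ (s x < s y)%N.
  rewrite -leqNgt ltn_neqAle val_eqE (inj_eq perm_inj).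
  by rewrite (_ : y != x) // -val_eqE neq_ltn h orbT.
by rewrite !neq uw.
Qed.

End OrdinalCounts.

Section Bruhat.
Variable n : nat.
Implicit Types u v w : 'S_n.

Lemma mul_tperm_perm u i j x : (u * tperm (u i) (u j))%g x = u (tperm i j x).
Proof.
rewrite permM; case: (tpermP i j x) => [->|->|/eqP xi /eqP xj]; rewrite ?tpermL ?tpermR //.
by rewrite tpermD // (inj_eq perm_inj) eq_sym.
Qed.

Lemma perm_len_lt_tperm u (i j : 'I_n) : (i < j)%N -> (u i < u j)%N ->
  (perm_len u < perm_len (u * tperm (u i) (u j))%g)%N.
Proof.
move=> ij uij; set u' := (_ * _)%g; pose t := tperm i j.
have u'E x : u' x = u (t x) by exact: mul_tperm_perm.
(* phi injects the inversions of u into those of u' other than (i, j). *)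
pose phi (q : 'I_n * 'I_n) := if (t q.1 < t q.2)%N then (t q.1, t q.2) else q.
set I := [set q : 'I_n * 'I_n | (q.1 < q.2)%N && (u q.2 < u q.1)%N].
have ijI : (i, j) \notin [set phi q | q in I].
  apply/imsetP => -[[p q]]; rewrite inE /= /phi /= => /andP[pq uqp].
  case: ifP => [tt' [iE jE]|_ [iE jE]].
    have : (j < i)%N by move: pq; rewrite -(tpermK i j p) -(tpermK i j q) -iE -jE tpermL tpermR.
    by rewrite ltnNge ltnW.
  by move: uqp; rewrite -iE -jE ltnNge ltnW.
have injphi : {in I &, injective phi}.
  move=> [p q] [p' q']; rewrite !inE /phi /= => /andP[pq _] /andP[p'q' _].
  case: ifP => [h|h]; case: ifP => [h'|h'] // [pE qE].
  - by rewrite -(tpermK i j p) -/t pE tpermK -(tpermK i j q) -/t qE tpermK.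
  - by move: h'; rewrite -pE -qE !tpermK pq.
  - by move: h; rewrite pE qE !tpermK p'q'.
rewrite /perm_len -/I -(card_in_imset injphi).
apply: (@leq_trans #|(i, j) |: [set phi q | q in I]|); first by rewrite cardsU1 ijI.
apply: subset_leq_card; apply/fintype.subsetP => r; rewrite in_setU1 => /orP[/eqP ->|/imsetP[[p q]]].
  by rewrite inE /= !u'E /t tpermL tpermR ij.
rewrite [in X in X -> _]inE inE /= => /andP[pq uqp] ->; rewrite /phi /=; case: ifP => /= h.
  by rewrite h !u'E !tpermK.
rewrite pq /= !u'E; move: h; rewrite /t.
case: (tpermP i j p) => [pi|pj|/eqP pi /eqP pj]; case: (tpermP i j q) => [qi|qj|/eqP qi /eqP qj].
- by move: pq; rewrite pi qi ltnn.
- by move: uqp; rewrite pi qj ltnNge ltnW.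
- by move=> _; apply: ltn_trans uij; rewrite -pi.
- by rewrite ij.
- by move: pq; rewrite pj qj ltnn.
- by rewrite (ltn_trans ij) // -pj.
- by rewrite (ltn_trans _ ij) // -qi.
- by move=> _; rewrite -qj in uij uqp *; apply: ltn_trans uqp; move: uij; rewrite qj.
- by rewrite pq.
Qed.

Definition sw_count u (a b : 'I_n) : nat := #|[set x : 'I_n | (x <= b)%N && (a <= u x)%N]|.

(** Only columns i and j change their contribution; the additive form avoids truncated
    subtraction. *)
Lemma sw_count_tperm u (a b i j : 'I_n) : i != j ->
  (sw_count u a b + ((i <= b) && (a <= u j) + ((j <= b) && (a <= u i))) =
   sw_count (u * tperm (u i) (u j))%g a b +
     ((i <= b) && (a <= u i) + ((j <= b) && (a <= u j))))%N.
Proof.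
move=> ij; pose f (s : 'S_n) (x : 'I_n) : nat := (x <= b)%N && (a <= s x)%N.
have E s : sw_count s a b = (f s i + (f s j + \sum_(x | (x != i) && (x != j)) f s x))%N.
  rewrite /sw_count -sum1dep_card big_mkcond /= (bigD1 i) //= (bigD1 j) /=; last by rewrite eq_sym.
  by [].

rewrite !{}E.
have -> : (\sum_(x | (x != i) && (x != j)) f (u * tperm (u i) (u j))%g x =
           \sum_(x | (x != i) && (x != j)) f u x)%N.
  apply: eq_bigr => x /andP[xi xj].
  by rewrite /f mul_tperm_perm tpermD // eq_sym.
rewrite /f !mul_tperm_perm tpermL tpermR; move: (\sum_(_ | _) _)%N => S.
by do 4! case: (_ && _) => /=; lia.
Qed.

Lemma bruhat_stepP u u' : bruhat_step u u' -> exists i j : 'I_n,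
  [/\ (i < j)%N, (u i < u j)%N & u' = (u * tperm (u i) (u j))%g].
Proof.
case/andP=> /existsP[c /existsP[d /eqP ->]].
rewrite -(permKV u c) -(permKV u d).
move: (u^-1%g c) (u^-1%g d) => i j.
wlog : i j / (i <= j)%N => [W|].
  case/orP: (leq_total i j) => /W // h; rewrite tpermC => /h[i' [j' [? ? E]]].
  by exists i', j'; split=> //; rewrite -E tpermC.
rewrite leq_eqVlt => /orP[/eqP/val_inj ->|ij]; first by rewrite tperm1 mulg1 ltnn.
move=> lt; exists i, j; split=> //.
rewrite ltnNge leq_eqVlt val_eqE (inj_eq perm_inj) -val_eqE (gtn_eqF ij) /=.
apply/negP => uji; set s := (_ * _)%g in lt.
have si : s i = u j by rewrite mul_tperm_perm tpermL.
have sj : s j = u i by rewrite mul_tperm_perm tpermR.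
have := @perm_len_lt_tperm s i j ij; rewrite si sj => /(_ uji).
by rewrite tpermC /s -mulgA tperm2 mulg1 => /(ltn_trans lt); rewrite ltnn.
Qed.

Lemma sw_count_step u u' (a b : 'I_n) : bruhat_step u u' ->
  (sw_count u a b <= sw_count u' a b)%N.
Proof.
case/bruhat_stepP => i [j [ij uij ->]].
have /(sw_count_tperm u a b) : i != j by rewrite -val_eqE neq_ltn ij.
have : (j <= b -> i <= b)%N by apply: leq_trans; exact: ltnW.
have : (a <= u i -> a <= u j)%N by move=> h; apply: leq_trans h (ltnW uij).
by move: (a <= u i)%N (a <= u j)%N (i <= b)%N (j <= b)%N => [] [] [] [] /=; lia.
Qed.

Lemma sw_count_bruhat u w (a b : 'I_n) : bruhat u w ->
  (sw_count u a b <= sw_count w a b)%N.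
Proof.
case/connectP=> p + ->; elim: p u => //= x p IH u /andP[/sw_count_step h /IH].
exact: leq_trans.
Qed.

(** A pair i < j with [u i < u j] is the box (u j, i) of D°(u), so the condition confines the
    diagram to the part of the south-west block free of 1s. The Bruhat criterion and the dimension
    formula use the rectangle only through this property. *)
Definition crossing u (a b : 'I_n) : Prop := forall i j : 'I_n,
  (i < j)%N -> (u i < u j)%N -> [/\ (i <= b)%N, (b < j)%N, (u i < a)%N & (a <= u j)%N].

Lemma card_ge_perm u (a : 'I_n) : #|[set x | (a <= u x)%N]| = (n - a)%N.
Proof. by rewrite (card_perm_pre u (fun y : 'I_n => (a <= y)%N)) card_ord_ge. Qed.

(** u decreases on the columns up to b and on those after b, so the values at least a occupy the
    first m columns on the left and the first n - a - m on the right. A noninversion joins a low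
    column on the left to a high one on the right. *)
Lemma crossing_pattern u (a b : 'I_n) (i j : 'I_n) : crossing u a b -> (i < j)%N ->
  (u i < u j)%N = [&& (sw_count u a b <= i)%N, (i <= b)%N, (b < j)%N &
                     (j < b.+1 + (n - a - sw_count u a b))%N].
Proof.
move=> cr; set m := sw_count u a b.
have dec (x y : 'I_n) : (x < y)%N -> (y <= b)%N || (b < x)%N -> (u y < u x)%N.
  move=> xy h; rewrite ltnNge leq_eqVlt val_eqE (inj_eq perm_inj) -val_eqE (ltn_eqF xy) /=.
  by apply/negP => /(cr _ _ xy)[h1 h2 _ _]; move: h; rewrite leqNgt h2 ltnNge h1.
have lo (x : 'I_n) : (x <= b)%N -> (a <= u x)%N = (x < m)%N.
  move=> xb; have := @down_closed_ltn _ [set x : 'I_n | (x <= b)%N && (a <= u x)%N].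
  move=> /(_ _ x); rewrite inE xb /=; apply=> y z yz; rewrite !inE => /andP[zb az].
  rewrite (leq_trans (ltnW yz) zb); apply: leq_trans az (ltnW (dec _ _ yz _)).
  by rewrite zb.
(* Adding all the columns up to b to the high ones again gives an initial segment, whose size comes
   from inclusion-exclusion. *)
have hi (x : 'I_n) : (b < x)%N -> (a <= u x)%N = (x < b.+1 + (n - a - m))%N.
  move=> bx; have := @down_closed_ltn _ [set x : 'I_n | (x <= b)%N || (a <= u x)%N].
  move=> /(_ _ x); rewrite inE leqNgt bx /= => ->.
    congr (_ < _)%N; have := cardsUI [set x : 'I_n | (x < b.+1)%N] [set x | (a <= u x)%N].
    rewrite card_ge_perm card_ord_lt //.
    rewrite (_ : #|_ :&: _| = m); last by apply: eq_card => y; rewrite !inE.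
    rewrite (_ : #|_ :|: _| = #|[set x : 'I_n | (x <= b)%N || (a <= u x)%N]|); last first.
      by apply: eq_card => y; rewrite !inE.
    have : (m <= n - a)%N.
      by rewrite -(card_ge_perm u); apply: subset_leq_card; apply/fintype.subsetP => y; rewrite !inE => /andP[].
    by move=> h E; rewrite addnBA //; apply: (canRL (addnK _)); exact: E.
  move=> y z yz; rewrite !inE => /orP[zb|az]; first by rewrite (leq_trans (ltnW yz) zb).
  have [//|by_ /=] := leqP y b.
  by apply: leq_trans az (ltnW (dec _ _ yz _)); rewrite by_ orbT.
move=> ij; apply/idP/idP => [/(cr _ _ ij)[h1 h2 h3 h4]|/and4P[h1 h2 h3 h4]].
  by rewrite h1 h2 -hi // h4 !andbT leqNgt -lo // -ltnNge.
by apply: (@leq_trans a); rewrite ?hi // ltnNge lo // -leqNgt.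
Qed.

Lemma crossing_uniq u w (a b : 'I_n) : crossing u a b -> crossing w a b ->
  sw_count u a b = sw_count w a b -> u = w.
Proof.
move=> cu cw E; apply: eq_perm_pattern => i j ij.
by rewrite (crossing_pattern cu ij) (crossing_pattern cw ij) E.
Qed.

(** If some length-increasing transposition keeps the count within that of w, induction on the room
    left for the length applies. If none does, each of them raises the count, which forces u to be
    crossing with the count of w; then u = w. *)
Lemma bruhat_crossing u w (a b : 'I_n) : crossing w a b ->
  (sw_count u a b <= sw_count w a b)%N -> bruhat u w.
Proof.
move=> cw; have len_le (s : 'S_n) : (perm_len s <= #|{: 'I_n * 'I_n}|)%N by exact: max_card.
have [s] := ubnP (#|{: 'I_n * 'I_n}| - perm_len u)%N; elim: s u => // s IH u sle uw.
have step (i j : 'I_n) : (i < j)%N -> (u i < u j)%N ->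
    (sw_count (u * tperm (u i) (u j))%g a b <= sw_count w a b)%N -> bruhat u w.
  move=> ij uij le; have lt := perm_len_lt_tperm ij uij.
  apply: (connect_trans (y := (u * tperm (u i) (u j))%g)).
    by apply: connect1; rewrite /bruhat_step lt andbT; apply/existsP; exists (u i);
       apply/existsP; exists (u j).
  by apply: IH => //; move: sle (len_le u) (len_le (u * tperm (u i) (u j))%g) lt; clear; lia.
have [//|nb] := boolP (bruhat u w).
have cr (i j : 'I_n) : (i < j)%N -> (u i < u j)%N ->
    [&& (i <= b)%N, (b < j)%N, (u i < a)%N, (a <= u j)%N & sw_count u a b == sw_count w a b].
  move=> ij uij.
  have : ~~ (sw_count (u * tperm (u i) (u j))%g a b <= sw_count w a b)%N.
    by apply: contraNN nb; exact: step.
  have /(sw_count_tperm u a b) : i != j by rewrite -val_eqE neq_ltn ij.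
  have : (j <= b -> i <= b)%N by apply: leq_trans; exact: ltnW.
  have : (a <= u i -> a <= u j)%N by move=> h; apply: leq_trans h (ltnW uij).
  rewrite !(ltnNge b) !(ltnNge _ a).
  by move: uw; move: (a <= u i)%N (a <= u j)%N (i <= b)%N (j <= b)%N => [] [] [] [] /=; lia.
suff E : sw_count u a b = sw_count w a b.
  suff uE : u = w by move: nb; rewrite uE /bruhat connect0.
  by apply: (@crossing_uniq u w a b) => // i j ij uij; have /and5P[] := cr i j ij uij.
(* [cr] yields equality only from a noninversion of u. Without one, either all columns up to b have
   their 1 in the block, or all rows from a on do; the count b + 1 or n - a is then maximal. *)
apply/eqP; rewrite eqn_leq uw /=.
have [/existsP[j0 /andP[j0b uj0]]|/existsPn all_] :=
  boolP [exists x : 'I_n, (x <= b)%N && (u x < a)%N]; last first.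
  apply: subset_leq_card; apply/fintype.subsetP => x; rewrite !inE => /andP[xb _]; rewrite xb /= leqNgt.
  by have := all_ x; rewrite xb.
have [E|ne] := eqVneq (sw_count u a b) (sw_count w a b); first by rewrite E.
apply: (@leq_trans (n - a)%N).
  by rewrite -(card_ge_perm w); apply: subset_leq_card; apply/fintype.subsetP => y; rewrite !inE => /andP[].
rewrite -(card_ge_perm u); apply: subset_leq_card; apply/fintype.subsetP => y; rewrite !inE => ay.
rewrite ay andbT leqNgt; apply/negP => by_.
have /and5P[_ _ _ _] := cr j0 y (leq_ltn_trans j0b by_) (leq_trans uj0 ay).
by rewrite (negPf ne).
Qed.

Lemma bruhatE u w (a b : 'I_n) : crossing w a b ->
  bruhat u w = (sw_count u a b <= sw_count w a b)%N.
Proof.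
move=> cw; apply/idP/idP; [exact: sw_count_bruhat|exact: bruhat_crossing].
Qed.

(** The product of the rows and of the columns of the south-west block that contain no 1 of v inside
    it. Its boxes are those whose transposition raises r(a, b). *)
Definition free_block v (a b : 'I_n) : {set 'I_n * 'I_n} :=
  [set q : 'I_n * 'I_n | [&& (a <= q.1)%N, (b < v^-1%g q.1)%N, (q.2 <= b)%N & (v q.2 < a)%N]].

Lemma free_block_sub v a b : free_block v a b \subset oRothe v.
Proof.
apply/fintype.subsetP => q; rewrite !inE => /and4P[h1 h2 h3 h4].
by rewrite (leq_trans h4 h1) (leq_ltn_trans h3 h2).
Qed.

Lemma card_free_rows v (a b : 'I_n) :
  #|[set i : 'I_n | (a <= i)%N && (b < v^-1%g i)%N]| = (n - a - sw_count v a b)%N.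
Proof.
have := cardsID [set i : 'I_n | (v^-1%g i <= b)%N] [set i : 'I_n | (a <= i)%N].
rewrite card_ord_ge => <-.
rewrite (_ : #|_ :&: _| = sw_count v a b); last first.
  have -> : [set i : 'I_n | (a <= i)%N] :&: [set i | (v^-1%g i <= b)%N] =
      [set i : 'I_n | (a <= i)%N && (v^-1%g i <= b)%N] by apply/setP => x; rewrite !inE.
  rewrite -(card_perm_pre v (fun i : 'I_n => (a <= i)%N && (v^-1%g i <= b)%N)).
  by apply: eq_card => x; rewrite !inE permK andbC.
by rewrite addKn; apply: eq_card => i; rewrite !inE -ltnNge andbC.
Qed.

Lemma card_free_cols v (a b : 'I_n) :
  #|[set j : 'I_n | (j <= b)%N && (v j < a)%N]| = (b.+1 - sw_count v a b)%N.
Proof.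
have := cardsID [set j : 'I_n | (a <= v j)%N] [set j : 'I_n | (j < b.+1)%N].
rewrite card_ord_lt // => <-.
rewrite (_ : _ :&: _ = [set x : 'I_n | (x <= b)%N && (a <= v x)%N]); last first.
  by apply/setP => x; rewrite !inE.
by rewrite addKn; apply: eq_card => i; rewrite !inE -ltnNge ltnS andbC.
Qed.

Lemma card_free_block v (a b : 'I_n) :
  #|free_block v a b| = ((n - a - sw_count v a b) * (b.+1 - sw_count v a b))%N.
Proof.
rewrite -card_free_rows -card_free_cols -cardsX; apply: eq_card => q.
by rewrite !inE -!andbA.
Qed.

Lemma adm_boxesE v w (a b : 'I_n) : crossing w a b ->
  (sw_count v a b <= sw_count w a b)%N ->
  adm_boxes v w = if (sw_count v a b < sw_count w a b)%N then oRothe v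
                  else oRothe v :\: free_block v a b.
Proof.
move=> cw vw; apply/setP => -[i j].
have -> : ((i, j) \in adm_boxes v w) =
    ((i, j) \in oRothe v) && bruhat (v * tperm (v j) i)%g w by rewrite inE.
have -> : ((i, j) \in if (sw_count v a b < sw_count w a b)%N then oRothe v
                      else oRothe v :\: free_block v a b) =
    ((i, j) \in oRothe v) && ((sw_count v a b < sw_count w a b)%N ||
       ~~ [&& (a <= i)%N, (b < v^-1%g i)%N, (j <= b)%N & (v j < a)%N]).
  by case: ifP => _; rewrite ?andbT // finset.in_setD andbC [_ \in free_block _ _ _]inE.
have [D|//] := boolP ((i, j) \in oRothe v).
rewrite (bruhatE _ cw) /= -{1}(permKV v i).
move: D; rewrite inE /= => /andP[vji jvi].
have /(sw_count_tperm v a b) : j != v^-1%g i by rewrite -val_eqE neq_ltn jvi.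
rewrite permKV.
have : (v^-1%g i <= b -> j <= b)%N by apply: leq_trans; exact: ltnW.
have : (a <= v j -> a <= i)%N by move=> h; apply: leq_trans h (ltnW vji).
rewrite (ltnNge b) (ltnNge _ a).
by move: vw; move: (a <= v j)%N (a <= i)%N (j <= b)%N (v^-1%g i <= b)%N => [] [] [] [] /=; lia.
Qed.

End Bruhat.

(** * South-west ranks and the weight cone *)

Section Masks.
Variables (n : nat).
Implicit Types X Y : {set 'I_n}.

(** Coordinate projections replace submatrices, so that all blocks stay n by n and no cardinal
    enters a type. *)
Definition mask_mx (K : pzRingType) X : 'M[K]_n := diag_mx (\row_i (i \in X)%:R).

Lemma mask_mxl (K : pzRingType) m X (A : 'M[K]_(n, m)) i j :
  (mask_mx K X *m A) i j = if i \in X then A i j else 0.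
Proof. by rewrite mul_diag_mx !mxE; case: (i \in X); rewrite ?mul1r ?mul0r. Qed.

Lemma mask_mxr (K : pzRingType) m X (A : 'M[K]_(m, n)) i j :
  (A *m mask_mx K X) i j = if j \in X then A i j else 0.
Proof. by rewrite mul_mx_diag !mxE; case: (j \in X); rewrite ?mulr1 ?mulr0. Qed.

Lemma mask_mxM (K : pzRingType) X Y : mask_mx K X *m mask_mx K Y = mask_mx K (X :&: Y).
Proof.
apply/matrixP => i j; rewrite mask_mxl !mxE !inE.
by case: (i \in X); rewrite ?mul0rn //=; case: eqP => // <-.
Qed.

Variable K : fieldType.

Definition sel_mx X : 'M[K]_(#|X|, n) := rowsub (fun i : 'I_#|X| => enum_val i) 1%:M.

Lemma sel_mxK X : sel_mx X *m (sel_mx X)^T = 1%:M.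
Proof.
apply/matrixP => i j; rewrite !mxE (bigD1 (enum_val i)) //= !mxE eqxx mul1r.
rewrite big1 ?addr0 => [|k ki]; last by rewrite !mxE eq_sym (negPf ki) mul0r.
by rewrite (inj_eq enum_val_inj) eq_sym.
Qed.

Lemma sel_mx_mask X : (sel_mx X)^T *m sel_mx X = mask_mx K X.
Proof.
apply/matrixP => i j; rewrite !mxE.
under eq_bigr do rewrite !mxE.
rewrite -(big_enum_val (fun x => (x == i)%:R * (x == j)%:R)) /=.
have [iX|iX] := boolP (i \in X).
  rewrite (bigD1 i) //= eqxx mul1r big1 ?addr0 => [|x /andP[_ /negPf ->]].
    by case: (i == j).
  by rewrite mul0r.
rewrite mul0rn big1 // => x xX; case: eqP => [xi|]; last by rewrite mul0r.
by rewrite -xi xX in iX.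
Qed.

Lemma rank_mxsub X Y (A : 'M[K]_n) :
  \rank (mxsub (fun i : 'I_#|X| => enum_val i) (fun j : 'I_#|Y| => enum_val j) A) =
  \rank (mask_mx K X *m A *m mask_mx K Y).
Proof.
have -> : mxsub (fun i : 'I_#|X| => enum_val i) (fun j : 'I_#|Y| => enum_val j) A =
    sel_mx X *m A *m (sel_mx Y)^T.
  rewrite mul_rowsub_mx mul1mx; apply/matrixP => i j; rewrite !mxE.
  rewrite (bigD1 (enum_val j)) //= !mxE eqxx mulr1 big1 ?addr0 // => k kj.
  by rewrite !mxE eq_sym (negPf kj) mulr0.
apply/eqP; rewrite eqn_leq; apply/andP; split.
  have -> : sel_mx X *m A *m (sel_mx Y)^T =
      sel_mx X *m (mask_mx K X *m A *m mask_mx K Y) *m (sel_mx Y)^T.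
    by rewrite -!sel_mx_mask !mulmxA sel_mxK mul1mx -!mulmxA sel_mxK mulmx1.
  by apply: leq_trans (mxrankM_maxl _ _) _; exact: mxrankM_maxr.
rewrite -!sel_mx_mask -!mulmxA; apply: leq_trans (mxrankM_maxr _ _) _.
by rewrite !mulmxA; exact: mxrankM_maxl.
Qed.

Lemma rank_mask X : \rank (mask_mx K X) = #|X|.
Proof.
apply/eqP; rewrite eqn_leq; apply/andP; split.
  by rewrite -sel_mx_mask; apply: leq_trans (mxrankM_maxr _ _) _; exact: rank_leq_row.
have -> : #|X| = \rank (sel_mx X *m (mask_mx K X) *m (sel_mx X)^T).
  by rewrite -sel_mx_mask !mulmxA sel_mxK mul1mx sel_mxK mxrank1.
by apply: leq_trans (mxrankM_maxl _ _) _; exact: mxrankM_maxr.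
Qed.

Lemma pmx_unit (u : 'S_n) : pmx K u \in unitmx.
Proof.
suff -> : pmx K u = perm_mx (u^-1)%g by exact: unitmx_perm.
by apply/matrixP => i j; rewrite !mxE (canF_eq (permKV u)) eq_sym.
Qed.

Lemma mul_pmx m (u : 'S_n) (A : 'M[K]_(m, n)) i j : (A *m pmx K u) i j = A i (u j).
Proof.
rewrite mxE (bigD1 (u j)) //= !mxE eqxx mulr1 big1 ?addr0 // => k.
by rewrite eq_sym => /negPf kj; rewrite !mxE kj mulr0.
Qed.

Lemma rank_mask_pmx (u : 'S_n) X Y :
  \rank (mask_mx K X *m pmx K u *m mask_mx K Y) = #|[set j | (u j \in X) && (j \in Y)]|.
Proof.
have -> : mask_mx K X *m pmx K u *m mask_mx K Y =
    mask_mx K (X :&: [set u j | j in Y]) *m pmx K u.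
  apply/matrixP => i j; rewrite mask_mxr !mul_pmx !mxE.
  have [->|_] := eqVneq i (u j); last by rewrite !mulr0n if_same.
  by rewrite finset.in_setI (mem_imset _ _ perm_inj) !mulr1n; case: (j \in Y); rewrite ?andbT ?andbF.
rewrite mxrankMfree ?row_free_unit ?pmx_unit // rank_mask.
rewrite -[RHS](card_imset _ (@perm_inj _ u)); apply: eq_card => x; rewrite !inE.
apply/andP/imsetP => [[xX /imsetP[y yY xE]]|[y + ->]].
  by exists y; rewrite // inE -xE xX.
by rewrite inE => /andP[-> yY]; rewrite imset_f.
Qed.
End Masks.

Lemma sw_rankE n (u : 'S_n) (a b : 'I_n) : sw_rank u a b = sw_count u a b.
Proof.
rewrite /sw_rank rank_mxsub rank_mask_pmx.
by apply: eq_card => x; rewrite !inE andbC.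
Qed.

Section RectangleDiagram.
Variables (n l k : nat) (w : 'S_n) (a b : 'I_n).
Hypotheses (hrect : is_rectangle l k (oRothe w)) (hess : Ess w = [set (a, b)]).

(** Rows are numbered downwards, so the north-east corner of the rectangle is in its first row and
    last column; as the only element of [Ess w], (a, b) fixes both. *)
Lemma rectangleE : [/\ (0 < l)%N, (0 < k)%N, (a + l <= n)%N &
  exists2 j0, (b.+1 = j0 + k)%N & forall i j : 'I_n, ((i, j) \in oRothe w) =
    (a <= i < a + l)%N && (j0 <= j < j0 + k)%N].
Proof.
case: hrect => l0 [k0 [i0 [j0 [il jk DE]]]].
have inD i j : ((i, j) \in oRothe w) = (i0 <= i < i0 + l)%N && (j0 <= j < j0 + k)%N.
  by rewrite DE inE.
have i0n : (i0 < n)%N by apply: leq_trans il; rewrite -addn1 leq_add2l.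
have b0n : ((j0 + k).-1 < n)%N by move: k0 jk; clear; lia.
have : (Ordinal i0n, Ordinal b0n) \in Ess w.
  rewrite inE inD /= leqnn; apply/and3P; split; first by move: l0 k0; clear; lia.
    by apply/forallP => i; apply/implyP => /eqP iE; rewrite inD; move: iE; clear; lia.
  by apply/forallP => j; apply/implyP => /eqP jE; rewrite inD; move: jE k0; clear; lia.
rewrite hess inE => /eqP[aE bE]; rewrite -aE -bE /=; split=> //.
by exists j0; [move: k0; clear; lia | exact: inD].
Qed.

(** A noninversion i < j is the box (w j, i). Sliding it inside the rectangle to column b shows b <
    j; sliding it to row a shows [w i < a]. *)
Lemma rectangle_crossing : crossing w a b.
Proof.
have [l0 k0 al [j0 bE inD]] := rectangleE; move=> i j ij wij.
have : (w j, i) \in oRothe w by rewrite in_oRothe permK wij.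
rewrite inD => /andP[/andP[h1 h2] /andP[h3 h4]].
have : (w j, b) \in oRothe w by rewrite inD h1 h2 /=; move: bE h3 h4; clear; lia.
rewrite in_oRothe permK => /andP[_ bj].
have : (a, i) \in oRothe w by rewrite inD leqnn h3 h4 /= andbT -[X in (X < _)%N]addn0 ltn_add2l.
rewrite in_oRothe => /andP[wia _].
by split=> //; rewrite -ltnS bE.
Qed.

Lemma rectangle_free_block : free_block w a b = oRothe w.
Proof.
apply/setP => -[i j]; apply/idP/idP => [|ijD]; first exact: (fintype.subsetP (free_block_sub _ _ _)).
move: (ijD); rewrite in_oRothe => /andP[wj jw].
have := rectangle_crossing jw; rewrite permKV => /(_ wj)[h1 h2 h3 h4].
by rewrite inE /= h1 h2 h3 h4.
Qed.

(** This counts column b of the diagram: (a, b) being a box, [w b < a], so a row from a on meets the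
    diagram in column b exactly when its 1 is east of b. *)
Lemma rectangle_rows : (n - a - sw_count w a b)%N = l.
Proof.
have [l0 k0 al [j0 bE inD]] := rectangleE.
rewrite -card_free_rows -[RHS](card_ord_itv al); apply: eq_card => i; rewrite !inE.
have := inD i b; rewrite in_oRothe.
have -> : (j0 <= b < j0 + k)%N by move: bE k0; clear; lia.
rewrite andbT => <-; have [ai|ia /=] := leqP a i; last first.
  have := inD i b; rewrite [X in _ = X]andbC [(a <= i)%N]leqNgt ia andbF in_oRothe => ->.
  by [].
rewrite (leq_trans _ ai) //.
have : (a, b) \in oRothe w by rewrite inD leqnn -[X in (X < _)%N]addn0 ltn_add2l l0; move: bE k0; clear; lia.
by rewrite in_oRothe => /andP[].
Qed.

Lemma rectangle_cols : (b.+1 - sw_count w a b)%N = k.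
Proof.
have [l0 k0 al [j0 bE inD]] := rectangleE.
have jk : (j0 + k <= n)%N by rewrite -bE.
rewrite -card_free_cols -[RHS](card_ord_itv jk); apply: eq_card => j; rewrite !inE.
have := inD a j; rewrite leqnn -[X in (X < _)%N]addn0 ltn_add2l l0 /= => E.
have [jb|bj /=] := leqP j b; last by rewrite -bE ltnS [(j <= b)%N]leqNgt bj andbF.
rewrite -E in_oRothe.
have : (a, b) \in oRothe w by rewrite inD leqnn -[X in (X < _)%N]addn0 ltn_add2l l0; move: bE k0; clear; lia.
by rewrite in_oRothe => /andP[_ bw]; rewrite (leq_ltn_trans jb bw) andbT.
Qed.

Lemma card_rectangle : #|oRothe w| = (l * k)%N.
Proof. by rewrite -rectangle_free_block card_free_block rectangle_rows rectangle_cols. Qed.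

End RectangleDiagram.

Section ConeDimension.
Variables (R : realType) (n : nat) (v w : 'S_n).

Lemma cone_dimE :
  cone_dim (@weight_cone R n v w) = \dim (fam_span (adm_boxes v w) (box_vec v R)).
Proof.
set U := fam_span _ _; apply/eqP; rewrite eqn_leq; apply/andP; split.
  apply/bigmax_leqP => d /asboolP[X [fX XS]].
  have : (<<X>> <= U)%VS.
    apply/span_subvP => x /XS [c _ ->]; apply: memv_suml => q qA.
    exact/memvZ/mem_fam_span.
  by move/dimvS; rewrite (eqP (fX : \dim <<X>> == size X)) size_tuple.
have [Y [YX fY YE]] := span_free_subseq [seq box_vec v R x | x <- enum (adm_boxes v w)].
have dY : size Y = \dim U by rewrite /U /fam_span -YE; apply/esym/eqP.
have dn : (\dim U < n.+1)%N by rewrite ltnS (leq_trans (dimvS (subvf U))) // dimvf /dim /= mul1n.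
apply: (@leq_bigmax_cond _ _ (fun d : 'I_n.+1 => d : nat) (Ordinal dn)).
apply/asboolP; exists (@Tuple _ _ Y (introT eqP dY)); split=> // x /YX /mapP[q].
rewrite mem_enum => qA ->; exists (fun q' => (q' == q)%:R) => [q'|]; first exact: ler0n.
rewrite (bigD1 q) //= eqxx scale1r big1 ?addr0 // => q' /andP[_ /negPf ->].
by rewrite scale0r.
Qed.

Lemma fam_span_KLgraph (F : fieldType) :
  fam_span (adm_boxes v w) (box_vec v F) = edge_span F (KLgraph v w).
Proof.
apply/eqP; rewrite eqEsubv; apply/andP; split; apply: fam_span_sub => q qA.
  by apply: (@mem_fam_span _ _ _ _ _ (v q.2, q.1)); apply: imset_f.
by case/imsetP: qA => q' q'A ->; exact: (@mem_fam_span _ _ _ _ (box_vec v F)).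
Qed.

Lemma card_KLgraph : #|KLgraph v w| = #|adm_boxes v w|.
Proof. by apply: card_imset => -[i j] [i' j'] [/perm_inj -> ->]. Qed.

Lemma KLgraph_lt e : e \in KLgraph v w -> (e.1 < e.2)%N.
Proof. by case/imsetP=> -[i j]; rewrite !inE => /andP[/andP[h _] _] ->. Qed.

Lemma cyclomatic_cone :
  cyclomatic (KLgraph v w) = #|adm_boxes v w|%:Z - (cone_dim (@weight_cone R n v w))%:Z.
Proof. by rewrite (cyclomatic_rank R) cone_dimE fam_span_KLgraph card_KLgraph. Qed.

Lemma forest_cyclomatic : is_forest (KLgraph v w) <-> cyclomatic (KLgraph v w) = 0.
Proof.
rewrite (forest_free R KLgraph_lt) free_fam_dim (cyclomatic_rank R).
split=> [/eqP ->|/eqP]; first by rewrite subrr.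
by rewrite subr_eq0 => /eqP[->].
Qed.

End ConeDimension.

(** * Krull dimension from polynomial charts *)

Section FunctionRings.
Variable K : fieldType.

(** Rings of functions are sets here, so that one list of closure lemmas serves polynomials in the
    parameters, in the matrix entries and in one variable, as well as functions on G/B. *)
Definition function_ring (X : Type) (A : set (X -> K)) : Prop :=
  [/\ forall c, A (fun=> c),
      forall f g, A f -> A g -> A (fun x => f x + g x) &
      forall f g, A f -> A g -> A (fun x => f x * g x)].

Section Closure.
Variables (X : Type) (A : set (X -> K)).
Hypothesis frA : function_ring A.

Lemma fr_const c : A (fun=> c). Proof. by case: frA. Qed.

Lemma fr_add f g : A f -> A g -> A (fun x => f x + g x).
Proof. by case: frA => _ h _; exact: h. Qed.

Lemma fr_mul f g : A f -> A g -> A (fun x => f x * g x).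
Proof. by case: frA => _ _ h; exact: h. Qed.

Lemma fr_sub f g : A f -> A g -> A (fun x => f x - g x).
Proof.
move=> Af Ag; rewrite (_ : (fun x => _) = (fun x => f x + (-1) * g x)).
  by apply: fr_add => //; apply: fr_mul => //; exact: fr_const.
by apply/funext => x; rewrite mulN1r.
Qed.

Lemma fr_sum I (r : seq I) (P : pred I) (f : I -> X -> K) :
  (forall i, P i -> A (f i)) -> A (fun x => \sum_(i <- r | P i) f i x).
Proof.
move=> Af; elim: r => [|i r IH].
  by rewrite (_ : (fun x => _) = fun=> 0); [exact: fr_const|apply/funext => x; rewrite big_nil].
have [Pi|nPi] := boolP (P i); last first.
  rewrite (_ : (fun x => _) = (fun x => \sum_(i <- r | P i) f i x)) //.
  by apply/funext => x; rewrite big_cons (negPf nPi).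
rewrite (_ : (fun x => _) = (fun x => f i x + \sum_(i <- r | P i) f i x)).
  by apply: fr_add => //; exact: Af.
by apply/funext => x; rewrite big_cons Pi.
Qed.

Lemma fr_prod I (r : seq I) (P : pred I) (f : I -> X -> K) :
  (forall i, P i -> A (f i)) -> A (fun x => \prod_(i <- r | P i) f i x).
Proof.
move=> Af; elim: r => [|i r IH].
  by rewrite (_ : (fun x => _) = fun=> 1); [exact: fr_const|apply/funext => x; rewrite big_nil].
have [Pi|nPi] := boolP (P i); last first.
  rewrite (_ : (fun x => _) = (fun x => \prod_(i <- r | P i) f i x)) //.
  by apply/funext => x; rewrite big_cons (negPf nPi).
rewrite (_ : (fun x => _) = (fun x => f i x * \prod_(i <- r | P i) f i x)).
  by apply: fr_mul => //; exact: Af.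
by apply/funext => x; rewrite big_cons Pi.
Qed.

Lemma fr_exp f k : A f -> A (fun x => f x ^+ k).
Proof.
move=> Af; rewrite (_ : (fun x => _) = (fun x => \prod_(i < k) f x)).
  exact: fr_prod.
by apply/funext => x; rewrite prodr_const card_ord.
Qed.

Lemma fr_det n (M : X -> 'M[K]_n) :
  (forall i j, A (fun x => M x i j)) -> A (fun x => \det (M x)).
Proof.
move=> AM; apply: fr_sum => s _; apply: fr_mul; first exact: fr_const.
by apply: fr_prod => i _; exact: AM.
Qed.

Lemma fr_mulmx m n p (M : X -> 'M[K]_(m, n)) (N : X -> 'M[K]_(n, p)) :
  (forall i j, A (fun x => M x i j)) -> (forall i j, A (fun x => N x i j)) ->
  forall i j, A (fun x => (M x *m N x) i j).
Proof.
move=> AM AN i j.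
rewrite (_ : (fun x => _) = (fun x => \sum_k M x i k * N x k j)).
  by apply: fr_sum => k _; exact: fr_mul.
by apply/funext => x; rewrite mxE.
Qed.

Lemma fr_adj n (M : X -> 'M[K]_n) :
  (forall i j, A (fun x => M x i j)) -> forall i j, A (fun x => (\adj (M x)) i j).
Proof.
move=> AM i j.
rewrite (_ : (fun x => _) = (fun x => (-1) ^+ (j + i) * \det (row' j (col' i (M x))))).
  apply: fr_mul; first exact: fr_const.
  apply: fr_det => i' j'; rewrite (_ : (fun x => _) = (fun x => M x (lift j i') (lift i j'))) //.
  by apply/funext => x; rewrite !mxE.
by apply/funext => x; rewrite mxE.
Qed.

Lemma fr_meval d (p : mpoly.mpoly d K) (u : X -> 'I_d -> K) :
  (forall i, A (fun x => u x i)) -> A (fun x => mpoly.meval (u x) p).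
Proof.
move=> Au; rewrite (_ : (fun x => _) = (fun x => \sum_(m <- mpoly.msupp p)
   mpoly.mcoeff m p * \prod_i u x i ^+ mpoly.fun_of_multinom m i)).
  apply: fr_sum => m _; apply: fr_mul; first exact: fr_const.
  by apply: fr_prod => i _; apply: fr_exp.
by apply/funext => x; rewrite mpoly.mevalE.
Qed.

End Closure.

Definition polyfun d : set (('I_d -> K) -> K) :=
  [set f | exists p : mpoly.mpoly d K, forall x, f x = mpoly.meval x p].

Lemma polyfun_ring d : function_ring (@polyfun d).
Proof.
split=> [c|f g [p pE] [q qE]|f g [p pE] [q qE]].
- by exists (mpoly.mpolyC _ c) => x; rewrite mpoly.mevalC.
- by exists (p + q) => x; rewrite mpoly.mevalD pE qE.
- by exists (p * q) => x; rewrite mpoly.mevalM pE qE.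
Qed.

Lemma polyfun_coord d i : polyfun (fun x : 'I_d -> K => x i).
Proof. by exists (mpoly.mpolyX _ (mpoly.mnm1 i)) => x; rewrite mpoly.mevalXU. Qed.

Definition unifun : set (K -> K) := [set f | exists p : {poly K}, forall x, f x = p.[x]].

Lemma unifun_ring : function_ring unifun.
Proof.
split=> [c|f g [p pE] [q qE]|f g [p pE] [q qE]].
- by exists c%:P => x; rewrite hornerC.
- by exists (p + q) => x; rewrite hornerD pE qE.
- by exists (p * q) => x; rewrite hornerM pE qE.
Qed.

Lemma unifun_id : unifun id. Proof. by exists 'X => x; rewrite hornerX. Qed.

End FunctionRings.

(** Stands in for the limit at 0 in degenerations: the numbers 1, 2, 3, ... supply more roots than
    the degree allows. *)
Lemma unifun_eq0 (K : numFieldType) (f : K -> K) : unifun f ->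
  (forall x, x != 0 -> f x = 0) -> forall x, f x = 0.
Proof.
move=> [p pE] f0 x; suff p0 : p = 0 by rewrite pE p0 horner0.
apply/eqP/negP => /negP p0.
pose s := [seq (i.+1)%:R : K | i <- iota 0 (size p)].
have /(max_poly_roots p0) : all (root p) s.
  by apply/allP => _ /mapP[i _ ->]; apply/eqP; rewrite -pE f0 // pnatr_eq0.
rewrite size_map size_iota ltnn => h; suff /h : uniq s by [].
by rewrite map_inj_uniq ?iota_uniq // => i j /eqP; rewrite eqr_nat => /eqP[].
Qed.

(** Applied along lines in the parameter space, it makes images of affine spaces irreducible. *)
Lemma unifun_mul_eq0 (K : numFieldType) (f g : K -> K) : unifun f -> unifun g ->
  (forall x, f x * g x = 0) -> (forall x, f x = 0) \/ (forall x, g x = 0).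
Proof.
move=> [p pE] [q qE] fg.
have /eqP : p * q = 0.
  apply/eqP/negP => /negP pq0.
  pose s := [seq i%:R : K | i <- iota 0 (size (p * q))].
  have /(max_poly_roots pq0) : all (root (p * q)) s.
    by apply/allP => _ /mapP[i _ ->]; apply/eqP; rewrite hornerM -pE -qE fg.
  rewrite size_map size_iota ltnn => h; suff /h : uniq s by [].
  by rewrite map_inj_uniq ?iota_uniq // => i j /eqP; rewrite eqr_nat => /eqP.
by rewrite mulf_eq0 => /orP[]/eqP h; [left|right] => x; rewrite ?pE ?qE h horner0.
Qed.

Section LinearIndependence.
Variables (K : fieldType).

(** Size at most e means degree below e, so all monomials are among the e^D ones with every exponent
    below e; more than e^D polynomials are dependent. *)
Lemma mpoly_dependent D e (J : finType) (p : J -> mpoly.mpoly D K) :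
  (forall j, (mpoly.mmeasure mpoly.mdeg (p j) <= e)%N) -> (e ^ D < #|J|)%N ->
  exists c : J -> K, (exists j, c j != 0) /\ \sum_j c j *: p j = 0.
Proof.
move=> pe lt; pose M := {ffun 'I_D -> 'I_e}.
pose mon (m : M) : mpoly.multinom D := mpoly.Multinom [tuple (m i : nat) | i < D].
pose A : 'M[K]_(#|J|, #|M|) := \matrix_(i, k) mpoly.mcoeff (mon (enum_val k)) (p (enum_val i)).
have : kermx A != 0.
  rewrite kermx_eq0 /row_free neq_ltn; apply/orP; left.
  by apply: leq_ltn_trans (rank_leq_col A) _; rewrite card_ffun !card_ord.
case/rowV0Pn => u /sub_kermxP uA u0.
exists (fun j => u 0 (enum_rank j)); split.
  have /rV0Pn[i ui] := u0; exists (enum_val i); by rewrite enum_valK.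
apply/mpoly.mpolyP => m; rewrite mpoly.mcoeff0 raddf_sum /=.
have [m_le|/forallPn[i mi]] := boolP [forall i, (mpoly.fun_of_multinom m i < e)%N].
  pose k : M := [ffun i => Ordinal (forallP m_le i)].
  have kE : mon k = m.
    by apply/mpoly.mnmP => i; rewrite mpoly.multinomE tnth_mktuple ffunE.
  move/matrixP/(_ 0 (enum_rank k)): uA; rewrite !mxE => E; rewrite -[RHS]E.
  rewrite [RHS](reindex_onto enum_rank enum_val) /=; last by move=> ? _; exact: enum_valK.
  apply: eq_big => [j|j _]; first by rewrite enum_rankK eqxx.
  by rewrite mpoly.mcoeffZ mxE !enum_rankK kE.
apply: big1 => j _; rewrite mpoly.mcoeffZ mpoly.memN_msupp_eq0 ?mulr0 //.
apply: mpoly.msize_mdeg_ge; apply: leq_trans (pe j) _; rewrite -leqNgt in mi.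
by apply: leq_trans mi _; rewrite mpoly.mdegE (bigD1 i) //= leq_addr.
Qed.

End LinearIndependence.

(** * Krull dimension of a subspace with a separating ring of functions *)

Section AbstractKrull.
Local Open Scope classical_set_scope.
Variables (K : numFieldType) (T : topologicalType) (N : set T) (good : set (T -> K)).
Hypothesis good_ring : function_ring good.
Hypothesis good_closed : forall f, good f ->
  exists2 F : set T, closed F & forall x, N x -> (F x <-> f x = 0).
Hypothesis good_sep : forall (F : set T) x, closed F -> N x -> ~ F x ->
  exists f, [/\ good f, forall y, N y -> F y -> f y = 0 & f x <> 0].

Lemma irreducible_prime (Z : set T) f g : Z `<=` N -> irreducible_set Z ->
  good f -> good g -> (forall x, Z x -> f x * g x = 0) ->
  (forall x, Z x -> f x = 0) \/ (forall x, Z x -> g x = 0).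
Proof.
move=> ZN [_ irr] /good_closed[F Fc FE] /good_closed[G Gc GE] fg.
case: (irr F G Fc Gc) => [x Zx|ZF|ZG].
- have /eqP := fg x Zx; rewrite mulf_eq0 => /orP[]/eqP h; [left|right].
    by apply/FE => //; exact: ZN.
  by apply/GE => //; exact: ZN.
- by left=> x Zx; apply/FE; [exact: ZN|exact: ZF].
- by right=> x Zx; apply/GE; [exact: ZN|exact: ZG].
Qed.

Lemma irreducible_bigcup (Z : set T) (I : choiceType) (r : seq I) (C : I -> set T) :
  irreducible_set Z -> (forall i, closed (C i)) ->
  (forall x, Z x -> exists2 i, i \in r & C i x) -> exists2 i, i \in r & Z `<=` C i.
Proof.
move=> [[z Zz] irr] Cc; elim: r => [|i r IH] cov; first by have [] := cov z Zz.
have cl : closed (\bigcup_(j in [set j | j \in r]) C j).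
  by rewrite (bigcup_seq r C); apply: closed_bigsetU.
have [|h|h] := irr (C i) _ (Cc i) cl.
- move=> x /cov[j]; rewrite inE => /orP[/eqP ->|jr] Cx; first by left.
  by right; exists j.
- by exists i; rewrite ?inE ?eqxx.
- have [|j jr ZC] := IH; first by move=> x /h[j /= jr Cx]; exists j.
  by exists j; rewrite // inE jr orbT.
Qed.

Definition indep (Z : set T) (J : finType) (g : J -> T -> K) : Prop :=
  forall c : J -> K, (forall x, Z x -> \sum_j c j * g j x = 0) -> forall j, c j = 0.

(** Adjoining to an independent family on Z the powers of a function that
    vanishes on Z but not on Z': setting f = 0 gives the constant coefficient,
    and f can be cancelled since the ideal of Z' is prime. *)
Lemma indep_step (Z Z' : set T) (J : finType) (g : J -> T -> K) f s :
  Z `<=` Z' -> Z' `<=` N -> irreducible_set Z' -> (forall j, good (g j)) -> good f ->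
  (forall x, Z x -> f x = 0) -> (exists2 x, Z' x & f x <> 0) -> indep Z g ->
  indep Z' (fun (q : 'I_s * J) x => g q.2 x * f x ^+ q.1).
Proof.
move=> ZZ' Z'N irr gg gf f0 [x0 Z'x0 fx0] ig c c0.
suff H s' (e : nat -> J -> K) : (forall x, Z' x ->
    \sum_(k < s') (\sum_j e k j * g j x) * f x ^+ k = 0) ->
    forall k j, (k < s')%N -> e k j = 0.
  move=> [k j]; pose e k j := if insub k is Some k' then c (k', j) else 0.
  have -> : c (k, j) = e k j by rewrite /e valK.
  apply: (H s) => // x Zx; rewrite -[RHS](c0 x Zx).
  pose h (k : 'I_s) j := c (k, j) * (g j x * f x ^+ k).
  rewrite [RHS](eq_bigr (fun q => h q.1 q.2)) => [|[] //]; rewrite -pair_bigA /=.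
  apply: eq_bigr => i _; rewrite mulr_suml; apply: eq_bigr => i' _.
  by rewrite /e valK /h mulrA.
elim: s' e => // s' IH e e0.
have split_ x : \sum_(k < s'.+1) (\sum_j e k j * g j x) * f x ^+ k =
    \sum_j e 0 j * g j x + f x * \sum_(k < s') (\sum_j e k.+1 j * g j x) * f x ^+ k.
  rewrite big_ord_recl expr0 mulr1 mulr_sumr; congr (_ + _); apply: eq_bigr => k _.
  by rewrite exprS mulrCA.
have e00 j : e 0 j = 0.
  by apply: (ig (e 0)) => x Zx; have := e0 x (ZZ' _ Zx); rewrite split_ f0 // mul0r addr0.
have [||f00|/(IH (fun k => e k.+1)) h] := @irreducible_prime Z' f
    (fun x => \sum_(k < s') (\sum_j e k.+1 j * g j x) * f x ^+ k) Z'N irr gf.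
- apply: fr_sum => // k _; apply: fr_mul => //; last exact: fr_exp.
  by apply: fr_sum => // j _; apply: fr_mul => //; exact: fr_const.
- move=> x Zx; have := e0 x Zx; rewrite split_ big1 ?add0r // => j _.
  by rewrite e00 mul0r.
- by case: fx0; exact: f00.
- by move=> [|k] j; rewrite ?e00 // ltnS; exact: h.
Qed.

(** Each f t vanishes on [Z t] but not on [Z t.+1], and [indep_step] adjoins its powers at that
    link. The functions are chosen before s, so their degrees on a chart stay fixed while s grows; E
    records the exponents. *)
Lemma chain_indep (Z : nat -> set T) d :
  (forall i, (i <= d)%N -> closed_in N (Z i) /\ irreducible_set (Z i)) ->
  (forall i, (i < d)%N -> Z i `<` Z i.+1) ->
  exists f : nat -> T -> K, (forall t, good (f t)) /\
    forall s i, (i <= d)%N -> exists (J : finType) (E : J -> nat -> nat),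
      [/\ #|J| = (s ^ i)%N, forall j t, (E j t <= s)%N &
          indep (Z i) (fun j x => \prod_(t < i) f t x ^+ E j t)].
Proof.
move=> Zci Zlt.
have ZN i : (i <= d)%N -> Z i `<=` N by move=> /Zci[[F _ ->] _] x [].
have /choice[f fP] t : exists f, good f /\ ((t < d)%N ->
    (forall x, Z t x -> f x = 0) /\ exists2 x, Z t.+1 x & f x <> 0).
  have [td|_] := ltnP t d; last by exists (fun=> 0); split=> //; exact: fr_const.
  have [[F Fc ZE] _] := Zci t (ltnW td).
  have [_ /existsNP[x /not_implyP[Zx nZx]]] := Zlt t td.
  have Nx : N x by apply: (ZN t.+1).
  have nF : ~ F x by move=> Fx; apply: nZx; rewrite ZE.
  have [g [gg gF gx]] := good_sep Fc Nx nF.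
  exists g; split=> // _; split; last by exists x.
  by move=> y; rewrite ZE => -[]; exact: gF.
exists f; split=> [t|s i]; first by have [] := fP t.
elim: i => [_|i IH id].
  exists unit, (fun _ _ => 0%N); split=> // [|c c0 []]; first by rewrite card_unit.
  have [_ [[z Zz] _]] := Zci 0%N isT.
  by have := c0 z Zz; rewrite (bigD1 tt) //= big_ord0 mulr1 big_pred0 ?addr0.
have [J [E [JE Es ig]]] := IH (ltnW id).
exists ('I_s * J)%type, (fun (q : 'I_s * J) t => if t == i then q.1 : nat else E q.2 t); split.
- by rewrite card_prod card_ord JE expnS.
- by move=> [k j] t /=; case: eqP => // _; exact: ltnW.
have [gf /(_ id)[f0 fx]] := fP i.
have [sub _] := Zlt i id; have [_ irr] := Zci i.+1 id.
have := @indep_step (Z i) (Z i.+1) J _ (f i) s sub (ZN _ id) irr _ gf f0 fx ig.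
have -> : (fun (q : 'I_s * J) x => \prod_(t < i.+1) f t x ^+ (if t == i :> nat then q.1 : nat else E q.2 t)) =
    (fun (q : 'I_s * J) x => (\prod_(t < i) f t x ^+ E q.2 t) * f i x ^+ q.1).
  apply/funext => q; apply/funext => x; rewrite big_ord_recr /= eqxx; congr (_ * _).
  by apply: eq_bigr => t _; rewrite (ltn_eqF (ltn_ord t)).
apply=> j; apply: fr_prod => // t _; apply: fr_exp => //.
by have [] := fP t.
Qed.

(** A chain of length d gives d functions whose monomials of exponents < s are
    independent on some chart; there are s^d of them, in a space of polynomials
    in D variables of dimension O(s^D). *)
Lemma krull_upper D (I : finType) (ok : pred I) (phi : I -> ('I_D -> K) -> T) :
  (forall x, N x -> exists i t, ok i /\ phi i t = x) ->
  (forall i t, ok i -> N (phi i t)) ->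
  (forall i f, ok i -> good f -> polyfun (fun t => f (phi i t))) ->
  forall d, irreducible_chain N d -> (d <= D)%N.
Proof.
move=> cov phiN pull d [Z [Zci Zlt]].
have [f [gf indf]] := chain_indep Zci Zlt.
have [[F Fc ZE] irr] := Zci d (leqnn d).
have ZN : Z d `<=` N by rewrite ZE => x [].
(* The top of the chain, being irreducible, lies in the closure of the image of one chart. *)
pose C i := closure [set phi i t | t in setT].
have [|x Zx|i + ZC] := @irreducible_bigcup (Z d) I (enum ok) C irr.
- by move=> i; exact: closed_closure.
- have [i [t [oki E]]] := cov x (ZN _ Zx); exists i; first by rewrite mem_enum.
  by apply: subset_closure; exists t.
rewrite mem_enum => oki.
have /choice[P PE] t : exists p : mpoly.mpoly D K, forall x, f t (phi i x) = mpoly.meval x p.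
  by apply: pull.
pose B := (\sum_(t < d) mpoly.mmeasure mpoly.mdeg (P t))%N.
suff key s : (s ^ d <= (s * B).+1 ^ D)%N.
  rewrite leqNgt; apply/negP => Dd.
  (* If D < d, then s^(D+1) <= s^d <= (s B + 1)^D <= s^D (B + 1)^D, hence s <= (B + 1)^D; this s is
     the first to violate it. *)
  pose s := (B.+1 ^ D).+1.
  have : (s ^ D.+1 <= s ^ D * B.+1 ^ D)%N.
    apply: (@leq_trans (s ^ d)); first by rewrite leq_pexp2l.
    apply: leq_trans (key s) _; rewrite -expnMn; case: (D) => // D'.
    by rewrite leq_exp2r // mulnS -addn1 addnC leq_add.
  by rewrite expnS mulnC leq_pmul2l ?expn_gt0 // ltnn.
have [J [E [JE Es ig]]] := indf s d (leqnn d).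
rewrite -JE leqNgt; apply/negP => lt.
pose p j := \prod_(t < d) P t ^+ E j t.
have [|c [[j cj] c0]] := @mpoly_dependent K D _ J p _ lt.
  move=> j; rewrite /p /B.
  have ex (q : mpoly.mpoly D K) k : (mpoly.mmeasure mpoly.mdeg (q ^+ k) <= (k * mpoly.mmeasure mpoly.mdeg q).+1)%N.
    elim: k => [|k IHk]; first by rewrite expr0 mpoly.msize1.
    rewrite exprS; have [->|q0] := eqVneq q 0; first by rewrite mul0r mpoly.msize0.
    have qk0 : q ^+ k != 0 by rewrite expf_neq0.
    rewrite mpoly.msizeM // -subn1 leq_subLR; apply: leq_trans (leq_add (leqnn _) IHk) _.
    by rewrite addnS mulSn.
  elim: (d) => [|d' IHd]; first by rewrite !big_ord0 mpoly.msize1.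
  rewrite !big_ord_recr /=.
  set a := \prod_(_ < _) _; set b := P d' ^+ _.
  have [->|a0] := eqVneq a 0; first by rewrite mul0r mpoly.msize0.
  have [->|b0] := eqVneq b 0; first by rewrite mulr0 mpoly.msize0.
  rewrite mpoly.msizeM // mulnDr -subn1 leq_subLR.
  have h : (mpoly.mmeasure mpoly.mdeg b <= (s * mpoly.mmeasure mpoly.mdeg (P d')).+1)%N.
    by apply: leq_trans (ex _ _) _; rewrite ltnS leq_mul2r Es orbT.
  by apply: leq_trans (leq_add IHd h) _; rewrite addnS addSn.
case/eqP: cj; apply: (ig c) => x Zx.
(* The relation found on the chart extends to the closure of its image because a good function has a
   closed zero set in N. *)
have gh : good (fun x => \sum_j c j * \prod_(t < d) f t x ^+ E j t).
  apply: fr_sum => // j' _; apply: fr_mul => //; first exact: fr_const.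
  by apply: fr_prod => // t _; exact: fr_exp.
have [G Gc GE] := good_closed gh.
apply/(GE x (ZN _ Zx)).
suff : C i `<=` G by apply; exact: ZC.
rewrite [X in _ `<=` X](proj1 (closure_id _) Gc); apply: closureS => _ [t _ <-].
apply/GE; first exact: phiN.
transitivity (mpoly.meval t (\sum_j c j *: p j)); last by rewrite c0 mpoly.meval0.
rewrite raddf_sum /=; apply: eq_bigr => j' _; rewrite mpoly.mevalZ rmorph_prod /=.
by congr (_ * _); apply: eq_bigr => t' _; rewrite rmorphXn /= PE.
Qed.

(** The member k of the chain is the closure in N of the image of the parameters that agree with t0
    from index k on. If two closed sets each miss a point of that image, the line joining the two
    parameters yields a point outside both. For strictness, g s need only recover t s while the
    later parameters have their base values. *)
Lemma krull_lower D (phi : ('I_D -> K) -> T) (t0 : 'I_D -> K) (g : 'I_D -> T -> K) :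
  (forall t, N (phi t)) ->
  (forall f, good f -> polyfun (fun t => f (phi t))) ->
  (forall s, good (g s)) ->
  (forall (s : 'I_D) t, (forall s' : 'I_D, (s < s')%N -> t s' = t0 s') -> g s (phi t) = t s) ->
  irreducible_chain N D.
Proof.
move=> phiN pull gg gE.
pose Tk k := [set t : 'I_D -> K | forall s : 'I_D, (k <= s)%N -> t s = t0 s].
pose Z k := N `&` closure (phi @` Tk k).
have t0T k : Tk k t0 by [].
exists Z; split=> [k _|k kD].
  split; first by exists (closure (phi @` Tk k)) => //; exact: closed_closure.
  split; first by exists (phi t0); split=> //; apply: subset_closure; exists t0.
  move=> F1 F2 F1c F2c ZF.
  have sub F : closed F -> ~ Z k `<=` F -> exists2 t, Tk k t & ~ F (phi t).
    move=> Fc; apply: contra_notP => /forall2NP h x [Nx].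
    suff : closure (phi @` Tk k) `<=` F by apply.
    rewrite [X in _ `<=` X](proj1 (closure_id _) Fc); apply: closureS => _ [t Tt <-].
    by have [//|/contrapT] := h t.
  have [|n1] := pselect (Z k `<=` F1); first by left.
  have [|n2] := pselect (Z k `<=` F2); first by right.
  have [t1 T1 nF1] := sub _ F1c n1; have [t2 T2 nF2] := sub _ F2c n2.
  have [f1 [gf1 f1F f1t]] := good_sep F1c (phiN t1) nF1.
  have [f2 [gf2 f2F f2t]] := good_sep F2c (phiN t2) nF2.
  have [p1 p1E] := pull _ gf1; have [p2 p2E] := pull _ gf2.
  pose line (x : K) (s : 'I_D) := t1 s + x * (t2 s - t1 s).
  have lineT x : Tk k (line x).
    by move=> s ks; rewrite /line T1 // T2 // subrr mulr0 addr0.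
  have uline s : unifun (fun x => line x s).
    apply: fr_add (fr_const _ _) _; try exact: unifun_ring.
    by apply: fr_mul (fr_const _ _); try exact: unifun_ring; exact: unifun_id.
  have := @unifun_mul_eq0 K (fun x => mpoly.meval (line x) p1) (fun x => mpoly.meval (line x) p2).
  case.
  - by apply: fr_meval => //; exact: unifun_ring.
  - by apply: fr_meval => //; exact: unifun_ring.
  - move=> x; rewrite -p1E -p2E.
    have : Z k (phi (line x)) by split=> //; apply: subset_closure; exists (line x).
    by case/ZF => [/f1F|/f2F] -> //; rewrite ?mul0r ?mulr0.
  - move=> /(_ 0) h; case: f1t; rewrite p1E -[RHS]h; congr (mpoly.meval _ p1).
    by apply/funext => s; rewrite /line mul0r addr0.
  - move=> /(_ 1) h; case: f2t; rewrite p2E -[RHS]h; congr (mpoly.meval _ p2).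
    by apply/funext => s; rewrite /line mul1r addrC subrK.
pose s := Ordinal kD.
have gs : good (fun x => g s x - t0 s) by apply: fr_sub => //; exact: fr_const.
have [F Fc FE] := good_closed gs.
split.
  move=> x [Nx cx]; split=> //; apply: closureS cx => _ [t Tt <-]; exists t => //.
  by move=> s' ks'; apply: Tt; exact: ltnW.
move=> sub.
(* On [Z k] the function g of index k is constantly [t0 s]; moving this one parameter by 1 leaves
   [Z k]. *)
pose t s' := if s' == s then t0 s + 1 else t0 s'.
have tT : Tk k.+1 t by move=> s' ks'; rewrite /t -val_eqE /= (gtn_eqF ks').
have : Z k.+1 (phi t) by split=> //; apply: subset_closure; exists t.
move/sub => [_ ct].
have cF : closure (phi @` Tk k) `<=` F.
  rewrite [X in _ `<=` X](proj1 (closure_id _) Fc); apply: closureS => _ [t' Tt' <-].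
  apply/FE => //; rewrite gE => [|s' ks']; last by apply: Tt'; exact: ltnW.
  by rewrite Tt' ?subrr.
have /FE := cF _ ct; rewrite gE => [|s' ks']; last by rewrite /t -val_eqE /= (gtn_eqF ks').
by move=> /(_ (phiN t))/eqP; rewrite /t eqxx addrAC subrr add0r oner_eq0.
Qed.

Lemma krull_dimE (R : realType) D (I : finType) (ok : pred I) (phi : I -> ('I_D -> K) -> T)
    (i0 : I) (t0 : 'I_D -> K) (g : 'I_D -> T -> K) :
  (forall x, N x -> exists i t, ok i /\ phi i t = x) ->
  (forall i t, ok i -> N (phi i t)) ->
  (forall i f, ok i -> good f -> polyfun (fun t => f (phi i t))) ->
  ok i0 -> (forall s, good (g s)) ->
  (forall (s : 'I_D) t, (forall s' : 'I_D, (s < s')%N -> t s' = t0 s') -> g s (phi i0 t) = t s) ->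
  krull_dim R N = D%:R%:E.
Proof.
move=> cov phiN pull ok0 gg gE; apply/eqP; rewrite eq_le; apply/andP; split.
  apply: ge_ereal_sup => _ [d cd <-]; rewrite lee_fin ler_nat.
  exact: krull_upper cov phiN pull _ cd.
apply: ereal_sup_ubound; exists D => //.
by apply: (@krull_lower D (phi i0) t0 g) => // [t|f]; [exact: phiN|exact: pull].
Qed.

End AbstractKrull.

(** * The flag variety *)

Section Borel.
Variables (K : fieldType) (n : nat).
Implicit Types A b g h : 'M[K]_n.

Lemma borelP b : borel b <-> b \in unitmx /\ forall i j : 'I_n, (j < i)%N -> b i j = 0.
Proof.
split=> [[bu /is_trig_mxP bt]|[bu bt]]; split=> //.
  by move=> i j ji; have := bt j i ji; rewrite mxE.
by apply/is_trig_mxP => i j ij; rewrite mxE bt.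
Qed.

Lemma borel_det b : (forall i j : 'I_n, (j < i)%N -> b i j = 0) -> \det b = \prod_i b i i.
Proof.
move=> bt; rewrite -det_tr det_trig; first by apply: eq_bigr => i _; rewrite mxE.
by apply/is_trig_mxP => i j ij; rewrite mxE bt.
Qed.

Lemma borel_diag b i : borel b -> b i i != 0.
Proof.
move/borelP=> [bu bt]; move: bu; rewrite unitmxE borel_det // unitfE => /prodf_neq0; exact.
Qed.

Lemma borelI b : (forall i j : 'I_n, (j < i)%N -> b i j = 0) ->
  (forall i, b i i != 0) -> borel b.
Proof.
move=> bt bd; apply/borelP; split=> //; rewrite unitmxE borel_det // unitfE.
exact/prodf_neq0.
Qed.

Lemma borel1 : borel (1%:M : 'M[K]_n).
Proof. by split; [exact: unitmx1 | rewrite trmx1 scalar_mx_is_trig]. Qed.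

Lemma borelM b1 b2 : borel b1 -> borel b2 -> borel (b1 *m b2).
Proof.
move=> /borelP[u1 t1] /borelP[u2 t2]; apply/borelP; split; first by rewrite unitmx_mul u1.
move=> i j ji; rewrite mxE big1 // => k _.
have [ki|ik] := ltnP k i; first by rewrite t1 ?mul0r.
by rewrite t2 ?mulr0 // (leq_trans ji).
Qed.

Lemma borelV b : borel b -> borel (invmx b).
Proof.
move=> bB; have /borelP[bu bt] := bB; apply/borelP; split; first by rewrite unitmx_inv.
suff H s (j i : 'I_n) : (j < s)%N -> (j < i)%N -> invmx b i j = 0 by move=> i j; apply: (H j.+1).
elim: s j i => // s IH j i js ji.
have /matrixP/(_ i j) := mulVmx bu; rewrite !mxE (bigD1 j) //= big1 => [|k kj].
  rewrite addr0 -val_eqE (gtn_eqF ji) => /eqP.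
  by rewrite mulf_eq0 (negPf (borel_diag j bB)) orbF => /eqP.
have [kltj|jk] := ltnP k j; last by rewrite bt ?mulr0 // ltn_neqAle jk eq_sym kj.
by rewrite (IH k i (leq_trans kltj js) (ltn_trans kltj ji)) mul0r.
Qed.

(** An upper triangular left factor adds to a row only lower ones, so the rows from a on stay among
    themselves; likewise for the columns up to c on the right. One inequality suffices, the inverses
    giving the other. *)
Lemma rank_borel (b1 b2 A : 'M[K]_n) (a c : 'I_n) : borel b1 -> borel b2 ->
  \rank (mask_mx K [set i : 'I_n | (a <= i)%N] *m (b1 *m A *m b2) *m mask_mx K [set j : 'I_n | (j <= c)%N]) =
  \rank (mask_mx K [set i : 'I_n | (a <= i)%N] *m A *m mask_mx K [set j : 'I_n | (j <= c)%N]).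
Proof.
set X := [set _ | _]; set Y := [set _ | _].
have le (b1' b2' A' : 'M[K]_n) : borel b1' -> borel b2' ->
    (\rank (mask_mx K X *m (b1' *m A' *m b2') *m mask_mx K Y) <=
     \rank (mask_mx K X *m A' *m mask_mx K Y))%N.
  move=> /borelP[_ t1] /borelP[_ t2].
  have -> : mask_mx K X *m (b1' *m A' *m b2') *m mask_mx K Y =
      mask_mx K X *m b1' *m (mask_mx K X *m A' *m mask_mx K Y) *m (b2' *m mask_mx K Y).
    have E1 : mask_mx K X *m b1' = mask_mx K X *m b1' *m mask_mx K X.
      apply/matrixP => i k; rewrite mask_mxr mask_mxl; case: ifP => iX.
        case: ifP => // kX; apply: t1; move: iX kX; rewrite !inE => ai /negbT.
        by rewrite -ltnNge => /leq_trans; apply.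
      by case: ifP.
    have E2 : b2' *m mask_mx K Y = mask_mx K Y *m (b2' *m mask_mx K Y).
      apply/matrixP => k j; rewrite mask_mxl mask_mxr; case: ifP => jY; last by case: ifP.
      case: ifP => // kY; apply: t2; move: jY kY; rewrite !inE => jc /negbT.
      by rewrite -ltnNge; apply: leq_ltn_trans.
    transitivity (mask_mx K X *m b1' *m mask_mx K X *m A' *m (mask_mx K Y *m (b2' *m mask_mx K Y))).
      by rewrite -E1 -E2 !mulmxA.
    by rewrite !mulmxA.
  by apply: leq_trans (mxrankM_maxl _ _) _; exact: mxrankM_maxr.
move=> B1 B2; apply/eqP; rewrite eqn_leq le //=.
have {1}-> : A = invmx b1 *m (b1 *m A *m b2) *m invmx b2.
  have [[u1 _] [u2 _]] := (B1, B2).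
  by rewrite -!mulmxA mulmxV // mulmx1 mulmxA mulVmx // mul1mx.
by apply: le; exact: borelV.
Qed.

Lemma clear_row (A : 'M[K]_n) (i0 k : 'I_n) : A i0 k != 0 -> exists b, borel b /\
  forall i j, (A *m b) i j = if (j < k)%N then A i j else
    if j == k then A i k / A i0 k else A i j - A i0 j / A i0 k * A i k.
Proof.
move=> A0.
pose b : 'M[K]_n := \matrix_(c, j) if c == k then
   (if (j < k)%N then 0 else if j == k then (A i0 k)^-1 else - (A i0 j / A i0 k))
   else (c == j)%:R.
exists b; split.
  apply: borelI => [i j ji|i]; rewrite mxE.
    case: eqP => [ik|_]; first by rewrite -ik ji.
    by rewrite -val_eqE (gtn_eqF ji).
  have [->|_] := eqVneq i k; last by rewrite eqxx oner_eq0.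
  by rewrite ltnn invr_eq0.
move=> i j; rewrite mxE (bigD1 k) //= mxE eqxx.
have [->|jk] := eqVneq j k.
  rewrite ltnn big1 ?addr0 // => c ck; by rewrite mxE (negPf ck) mulr0.
rewrite (bigD1 j) //= [b j j]mxE (negPf jk) eqxx mulr1 big1 => [|c /andP[ck cj]].
  by case: ifP => _; rewrite ?mulr0 ?add0r ?addr0 // mulrN mulrC addrC.
by rewrite mxE (negPf ck) (negPf cj) mulr0.
Qed.

Lemma clear_col (A : 'M[K]_n) (i0 k : 'I_n) : A i0 k = 1 -> exists b, borel b /\
  forall i j, (b *m A) i j = if (i < i0)%N then A i j - A i k * A i0 j else A i j.
Proof.
move=> A1.
pose b : 'M[K]_n := \matrix_(i, c) ((i == c)%:R - (if (c == i0) && (i < i0)%N then A i k else 0)).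
exists b; split.
  apply: borelI => [i j ji|i]; rewrite mxE.
    rewrite -val_eqE (gtn_eqF ji); case: eqP => [E|]; last by rewrite subrr.
    by rewrite -E ltnNge (ltnW ji) subrr.
  by have [->|_] := eqVneq i i0; rewrite ?ltnn eqxx subr0 oner_eq0.
move=> i j; rewrite mxE; under eq_bigr do rewrite mxE mulrBl.
rewrite sumrB (bigD1 i) //= eqxx mul1r big1 => [|c ci]; last by rewrite eq_sym (negPf ci) mul0r.
rewrite addr0 (bigD1 i0) //= eqxx big1 => [|c ci]; last by rewrite (negPf ci) mul0r.
by rewrite addr0 /=; case: ifP => _; rewrite ?mul0r ?subr0.
Qed.

(** Elimination column by column. An upper triangular left factor can clear only upwards, so the
    pivot is the lowest nonzero entry of the column. *)
Lemma bruhat_decomposition (g : 'M[K]_n) : g \in unitmx ->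
  exists b1 b2 (u : 'S_n), [/\ borel b1, borel b2 & b1 *m g *m b2 = pmx K u].
Proof.
move=> gu.
suff H k : (k <= n)%N -> exists b1 b2 (f : 'I_n -> 'I_n), [/\ borel b1, borel b2 &
    forall j : 'I_n, (j < k)%N -> (forall i, (b1 *m g *m b2) i j = (i == f j)%:R) /\
       (forall j', (b1 *m g *m b2) (f j) j' = (j' == j)%:R)].
  have [b1 [b2 [f [B1 B2 E]]]] := H n (leqnn n).
  have fi : injective f.
    move=> j j' ff; have [_ h] := E j (ltn_ord j); have [_ h'] := E j' (ltn_ord j').
    have := h j; rewrite ff h' eqxx.
    by have [//|_ /eqP] := eqVneq j j'; rewrite eq_sym oner_eq0.
  exists b1, b2, (perm fi); split=> //; apply/matrixP => i j.
  by have [-> _] := E j (ltn_ord j); rewrite mxE permE eq_sym.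
elim: k => [_|k IH kn].
  by exists 1%:M, 1%:M, id; split=> //; exact: borel1.
have [b1 [b2 [f [B1 B2 E]]]] := IH (ltnW kn).
set A := b1 *m g *m b2 in E.
pose k' := Ordinal kn.
have Au : A \in unitmx by rewrite !unitmx_mul B1.1 gu B2.1.
have [i1 i1k] : exists i, A i k' != 0.
  apply/existsP; apply: contraLR Au => /existsPn A0.
  rewrite unitmxE unitfE negbK (expand_det_col _ k') big1 // => i _.
  by have /negPn/eqP -> := A0 i; rewrite mul0r.
case: (@arg_maxnP _ i1 (fun i => A i k' != 0) (fun i : 'I_n => i : nat) i1k) => i0 Ai0 maxi0.
have Alow (i : 'I_n) : (i0 < i)%N -> A i k' = 0.
  by move=> lt; apply/eqP; apply: contraTT lt => /maxi0; rewrite -leqNgt.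
(* A nonzero entry of the pivot row in an earlier column would make it an earlier pivot row, whose
   entry in column k is already cleared. *)
have Arow (j : 'I_n) : (j < k)%N -> A i0 j = 0.
  move=> jk; have [h h'] := E j jk; rewrite h; case: eqP => // i0f.
  by move: Ai0; rewrite i0f h' -val_eqE (gtn_eqF jk) eqxx.
have [b [Bb bE]] := clear_row Ai0.
have Ab1 : (A *m b) i0 k' = 1 by rewrite bE ltnn eqxx divff.
have [c [Bc cE]] := clear_col Ab1.
exists (c *m b1), (b2 *m b), (fun j => if j == k' then i0 else f j).
split; [exact: borelM|exact: borelM|] => j.
have -> : c *m b1 *m g *m (b2 *m b) = c *m (A *m b) by rewrite /A !mulmxA.
have row0 j' : (A *m b) i0 j' = (j' == k')%:R.
  rewrite bE; case: ltnP => [h|_].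
    by rewrite Arow // -val_eqE (ltn_eqF h).
  by case: eqP => _; [rewrite divff | rewrite divfK // subrr].
have colk i : (c *m (A *m b)) i k' = (i == i0)%:R.
  rewrite cE bE ltnn eqxx row0 eqxx mulr1 subrr.
  case: (ltngtP i i0) => [lt|gt|/val_inj ->].
  - by rewrite -val_eqE (ltn_eqF lt).
  - by rewrite Alow // mul0r -val_eqE (gtn_eqF gt).
  - by rewrite divff // eqxx.
rewrite ltnS leq_eqVlt => /orP[/eqP jk|jk].
  have -> : j = k' by apply: val_inj.
  rewrite eqxx; split; first exact: colk.
  by move=> j'; rewrite cE ltnn row0.
have jk' : (j == k') = false by rewrite -val_eqE (ltn_eqF jk).
rewrite jk'; have [hc hr] := E j jk; split.
  move=> i; rewrite cE !row0 !bE ltnn eqxx jk jk' mulr0 subr0 if_same; exact: hc.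
move=> j'; have fk : A (f j) k' = 0 by rewrite hr -val_eqE (gtn_eqF jk).
rewrite cE !bE ltnn eqxx fk !mul0r subr0 if_same mulr0 subr0 -hr.
by case: ifP => // _; case: eqP => [->|_ //]; rewrite fk.
Qed.

(** Unipotent lower triangular matrices L with L v in the slice: column v(j)
    of L is column j of L v, so that the free entries are those of D°(v). *)
Definition slice_mx (v : 'S_n) (L : 'M[K]_n) : Prop :=
  (forall c, L c c = 1) /\
  (forall i c, i != c -> L i c != 0 -> (c < i)%N && (v^-1%g c < v^-1%g i)%N).

Lemma slice_mx_lt v L (i c : 'I_n) : slice_mx v L -> (i < c)%N -> L i c = 0.
Proof.
move=> [_ h] ic; apply/eqP; apply: contraTT ic => /h.
by case: eqP => [-> _|_ /(_ isT) /andP[ci _]]; rewrite -leqNgt // ltnW.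
Qed.

Lemma slice_mx_det v L : slice_mx v L -> \det L = 1.
Proof.
move=> sL; rewrite det_trig; first by rewrite big1 // => i _; apply: sL.1.
by apply/is_trig_mxP => i j; exact: slice_mx_lt sL.
Qed.

Lemma slice_mx_opp v L : slice_mx v L -> borel_opp L.
Proof.
move=> sL; split; first by rewrite unitmxE (slice_mx_det sL) unitr1.
by apply/is_trig_mxP => i j; exact: slice_mx_lt sL.
Qed.

(** In h v the entry (v j, j) is nonzero with zeros above it. Column operations from left to right
    make it 1 and clear row v j to its right, without disturbing those zeros. *)
Lemma slice_mxP v (h : 'M[K]_n) : borel_opp h ->
  exists b L, [/\ borel b, slice_mx v L & h *m pmx K v *m b = L *m pmx K v].
Proof.
move=> [hu /is_trig_mxP ht].
suff H k : (k <= n)%N -> exists b, borel b /\ let A := h *m pmx K v *m b in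
    [/\ forall i j : 'I_n, (i < v j)%N -> A i j = 0,
        forall j, A (v j) j != 0,
        forall j : 'I_n, (j < k)%N -> A (v j) j = 1 &
        forall j j' : 'I_n, (j < k)%N -> (j < j')%N -> A (v j) j' = 0].
  have [b [B]] := H n (leqnn n); set A := _ *m b => -[Alt A0 A1 Agt].
  exists b, (\matrix_(i, c) A i (v^-1%g c)); split=> //; last first.
    by apply/matrixP => i j; rewrite [RHS]mul_pmx [RHS]mxE permK.
  split=> [c|i c ic]; rewrite mxE.
    by have := A1 (v^-1%g c) (ltn_ord _); rewrite permKV.
  move=> Anz; apply/andP; split.
    rewrite ltnNge; apply: contraNN Anz => ic'; apply/eqP/Alt; rewrite permKV.
    by rewrite ltn_neqAle ic' andbT val_eqE.
  have := Agt (v^-1%g i) (v^-1%g c) (ltn_ord _); rewrite permKV => h'.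
  case: (ltngtP (v^-1%g c) (v^-1%g i)) => // [lt|/val_inj/perm_inj ci].
    by rewrite h' // eqxx in Anz.
  by rewrite ci eqxx in ic.
elim: k => [_|k IH kn].
  exists 1%:M; split; first exact: borel1.
  rewrite mulmx1; split=> // [i j ij|j]; rewrite mul_pmx; first exact: ht.
  move: hu; rewrite unitmxE det_trig ?unitfE; last exact/is_trig_mxP.
  by move/prodf_neq0; apply.
have [b [B]] := IH (ltnW kn); set A := _ *m b => -[Alt A0 A1 Agt].
pose k' := Ordinal kn.
have [c [C cE]] := clear_row (A0 k').
exists (b *m c); split; first exact: borelM.
rewrite mulmxA -/A; cbv zeta; split.
- move=> i j ij; rewrite cE Alt //; case: ltnP => // kj.
  case: eqP => [jk|_]; first by rewrite Alt ?mul0r // -jk.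
  rewrite sub0r; have [ik|ki] := ltnP i (v k'); first by rewrite (Alt i) ?mulr0 ?oppr0.
  by rewrite (Alt (v k') j) ?mul0r ?oppr0 // (leq_ltn_trans ki).
- move=> j; rewrite cE; case: ltnP => // kj; have [->|jk] := eqVneq j k'.
    by rewrite divff // oner_eq0.
  have [lt|gt|/val_inj/perm_inj E] := ltngtP (v k') (v j).
  - by rewrite (Alt (v k') j) // !mul0r subr0.
  - by rewrite (Alt (v j) k') // mulr0 subr0.
  - by rewrite E eqxx in jk.
- move=> j; rewrite ltnS leq_eqVlt => /orP[/eqP jk|jk]; rewrite cE.
    have -> : j = k' by apply: val_inj.
    by rewrite ltnn eqxx divff.
  by rewrite jk A1.
- move=> j j'; rewrite ltnS leq_eqVlt => /orP[/eqP jk|jk] jj'; rewrite cE.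
    have -> : j = k' by apply: val_inj.
    have kj' : (k < j')%N by rewrite -jk.
    by rewrite ltnNge (ltnW kj') /= -val_eqE (gtn_eqF kj') divfK // subrr.
  case: ltnP => [_|kj']; first exact: Agt.
  rewrite (Agt j k' jk jk) mul0r mulr0 subr0 (Agt j j' jk jj').
  by case: eqP.
Qed.

End Borel.

(** * Semi-invariant functions and closed subsets of G/B *)

Section FlagTopology.
Local Open Scope classical_set_scope.
Variables (K : numFieldType) (n : nat).
Implicit Types (g : GL K n) (v w u : 'S_n).

Definition matfun : set ('M[K]_n -> K) :=
  [set h | exists p : mpoly.mpoly (n * n) K,
     forall A, h A = mpoly.meval (fun k => mxvec A 0 k) p].

Lemma matfun_ring : function_ring matfun.
Proof.
split=> [c|f g [p pE] [q qE]|f g [p pE] [q qE]].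
- by exists (mpoly.mpolyC _ c) => x; rewrite mpoly.mevalC.
- by exists (p + q) => x; rewrite mpoly.mevalD pE qE.
- by exists (p * q) => x; rewrite mpoly.mevalM pE qE.
Qed.

Lemma matfun_entry i j : matfun (fun A => A i j).
Proof.
by exists (mpoly.mpolyX _ (mpoly.mnm1 (mxvec_index i j))) => A; rewrite mpoly.mevalXU mxvecE.
Qed.

Lemma closed_GLP (F : set (GL K n)) : closed F <->
  exists S : set (mpoly.mpoly (n * n) K), F = [set g | forall p, S p -> poly_eval p g = 0].
Proof.
rewrite -openC; split=> -[S FE]; exists S; last by rewrite FE.
by rewrite -[LHS]setCK FE setCK.
Qed.

Lemma closed_GBP (F : set (GB K n)) : closed F <-> closed (@piB K n @^-1` F).
Proof. by rewrite -!openC; exact: iff_refl. Qed.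

Lemma closed_matfun h : matfun h -> closed [set g : GL K n | h (val g) = 0].
Proof.
move=> [p pE]; apply/closed_GLP; exists [set p]; apply/seteqP; split=> g /=.
  by move=> h0 q ->; rewrite /poly_eval -pE.
by move=> /(_ p erefl); rewrite /poly_eval -pE.
Qed.

Lemma piBP g g' : piB g = piB g' <-> exists2 b, borel b & val g' = val g *m b.
Proof.
split=> [/eqmodP/asboolP E|[b B E]].
  have : lcosetB g' (val g') by exists 1%:M; [exact: borel1 | rewrite mulmx1].
  by rewrite -E => -[b B <-]; exists b.
apply/eqmodP/asboolP/seteqP; split=> _ [c C <-].
  exists (invmx b *m c); first by apply: borelM => //; exact: borelV.
  by rewrite E -mulmxA (mulmxA b) mulmxV ?mul1mx //; case: B.
by exists (b *m c); [exact: borelM | rewrite E mulmxA].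
Qed.

Definition GL1 : GL K n := exist _ 1%:M (unitmx1 K n).

(** Agrees with the inclusion on invertible matrices; other matrices go to 1. *)
Definition to_GL (A : 'M[K]_n) : GL K n := insubd GL1 A.

Lemma val_to_GL A : A \in unitmx -> val (to_GL A) = A.
Proof. by move=> Au; rewrite val_insubd Au. Qed.

Definition rep (x : GB K n) : GL K n := generic_quotient.repr x.

Lemma repK x : piB (rep x) = x.
Proof. exact: generic_quotient.reprK. Qed.

Lemma rep_piB g : exists2 b, borel b & val (rep (piB g)) = val g *m b.
Proof. by apply/piBP; rewrite repK. Qed.

Section SemiInvariants.
Variable v : 'S_n.

Definition wd (j : 'I_n) (s : 'I_j.+1) : 'I_n := widen_ord (ltn_ord j) s.

(** For g = L v b with L v in the slice and b in B, the minor of g in the rows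
    v(0), ..., v(j-1), v(i) and the columns 0, ..., j is (L v)_{v(i), j} times
    the product of the first j + 1 diagonal entries of b. *)
Definition row_minor (i j : 'I_n) (g : 'M[K]_n) : K :=
  \det (\matrix_(s < j.+1, t < j.+1) g (v (if s == ord_max then i else wd s)) (wd t)).

Definition chi (j : 'I_n) (b : 'M[K]_n) : K := \prod_(s < j.+1) b (wd s) (wd s).

Lemma chi_neq0 j b : borel b -> chi j b != 0.
Proof. by move=> B; apply/prodf_neq0 => s _; exact: borel_diag. Qed.

(** The first j + 1 columns of g b are those of g times the leading block of b, as b is upper
    triangular. *)
Lemma row_minorM i j (g b : 'M[K]_n) : borel b -> row_minor i j (g *m b) = row_minor i j g * chi j b.
Proof.
move=> /borelP[_ bt].
pose N : 'M[K]_j.+1 := \matrix_(s, t) b (wd s) (wd t).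
have -> : chi j b = \det N.
  rewrite borel_det => [|s t ts]; first by apply: eq_bigr => s _; rewrite mxE.
  by rewrite mxE bt.
rewrite /row_minor -det_mulmx; congr (\det _); apply/matrixP => s t; rewrite !mxE.
under [RHS]eq_bigr do rewrite !mxE.
rewrite (bigID (fun k : 'I_n => (k < j.+1)%N)) /= [X in _ + X]big1 ?addr0.
  by rewrite (big_ord_narrow (ltn_ord j)).
move=> k; rewrite -leqNgt => jk; rewrite bt ?mulr0 //.
exact: leq_trans (ltn_ord t) jk.
Qed.

Lemma slice_mx_perm0 (x y : 'I_n) (L : 'M[K]_n) : slice_mx v L -> (x < y)%N ->
  L (v x) (v y) = 0.
Proof.
move=> sL xy; apply/eqP; apply: contraTT xy => /sL.2; rewrite !permK (inj_eq perm_inj).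
by case: eqP => [-> _|_ /(_ isT)/andP[_]]; rewrite ?ltnn // -leqNgt => /ltnW.
Qed.

(** With the rows in the order v(0), v(1), ... the matrix L v is unipotent lower triangular, so only
    the last diagonal entry of the minor can differ from 1. *)
Lemma row_minor_slice (i j : 'I_n) L : slice_mx v L -> (j <= i)%N ->
  row_minor i j (L *m pmx K v) = L (v i) (v j).
Proof.
move=> sL ji; rewrite /row_minor.
rewrite det_trig; last first.
  apply/is_trig_mxP => s t st; rewrite mxE mul_pmx.
  have smax : (s == ord_max) = false.
    by apply/negbTE; rewrite -val_eqE /= neq_ltn (leq_trans st) // -ltnS ltn_ord.
  by rewrite smax slice_mx_perm0.
rewrite big_ord_recr /= big1 => [|s _].
  rewrite mul1r mxE mul_pmx eqxx; congr (L _ (v _)); exact: val_inj.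
rewrite mxE mul_pmx ifF ?sL.1 //; last by rewrite -val_eqE /= (ltn_eqF (ltn_ord s)).
Qed.

Lemma matfun_row_minor i j : matfun (row_minor i j).
Proof.
apply: (fr_det matfun_ring) => s t.
apply: (eq_ind _ matfun (matfun_entry (v (if s == ord_max then i else wd s)) (wd t))).
by apply/funext => x; rewrite mxE.
Qed.

(** It is nonzero exactly over v B_- B / B, the translate by v of the opposite big cell, which
    contains the slice. *)
Definition Delta (g : 'M[K]_n) : K := \prod_j row_minor j j g.
Definition Chi (b : 'M[K]_n) : K := \prod_j chi j b.

Lemma Chi_neq0 b : borel b -> Chi b != 0.
Proof. by move=> B; apply/prodf_neq0 => j _; exact: chi_neq0. Qed.

Lemma DeltaM (g b : 'M[K]_n) : borel b -> Delta (g *m b) = Delta g * Chi b.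
Proof. by move=> B; rewrite -big_split; apply: eq_bigr => j _; rewrite row_minorM. Qed.

Lemma Delta_slice L : slice_mx v L -> Delta (L *m pmx K v) = 1.
Proof. by move=> sL; apply: big1 => j _; rewrite row_minor_slice // sL.1. Qed.

Lemma matfun_Delta : matfun Delta.
Proof. by apply: (fr_prod matfun_ring) => j _; exact: matfun_row_minor. Qed.

(** Quotients of semi-invariants of equal weight where Delta is nonzero, with
    arbitrary values elsewhere. *)
Definition good : set (GB K n -> K) :=
  [set f | exists h e, [/\ matfun h,
     forall g b : 'M[K]_n, borel b -> h (g *m b) = h g * Chi b ^+ e &
     forall y : GL K n, Delta (val y) != 0 -> f (piB y) = h (val y) / Delta (val y) ^+ e]].

Lemma good_function_ring : function_ring good.
Proof.
split=> [c|f1 f2 [h1 [e1 [m1 i1 E1]]] [h2 [e2 [m2 i2 E2]]]|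
         f1 f2 [h1 [e1 [m1 i1 E1]]] [h2 [e2 [m2 i2 E2]]]].
- exists (fun=> c), 0%N; split=> [|g b _|y _]; last by rewrite expr0 divr1.
    exact: (fr_const matfun_ring).
  by rewrite expr0 mulr1.
- exists (fun g : 'M[K]_n => h1 g * Delta g ^+ e2 + h2 g * Delta g ^+ e1), (e1 + e2)%N; split.
  + apply: (fr_add matfun_ring); apply: (fr_mul matfun_ring) => //;
    apply: (fr_exp matfun_ring); exact: matfun_Delta.
  + move=> g b B; rewrite i1 // i2 // DeltaM // !exprMn exprD mulrDl.
    by congr (_ + _); rewrite mulrACA // [Chi b ^+ e2 * _]mulrC.
  + move=> y D; rewrite E1 // E2 // exprD mulrDl; congr (_ + _).
      by rewrite -mulf_div divff ?expf_neq0 // mulr1.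
    by rewrite (mulrC (Delta (val y) ^+ e1)) -mulf_div divff ?expf_neq0 // mulr1.
- exists (fun g : 'M[K]_n => h1 g * h2 g), (e1 + e2)%N; split.
  + exact: (fr_mul matfun_ring).
  + by move=> g b B; rewrite i1 // i2 // exprD mulrACA.
  + by move=> y D; rewrite E1 // E2 // exprD mulf_div.
Qed.

Definition slice_pt (L : 'M[K]_n) : GB K n := piB (to_GL (L *m pmx K v)).

Lemma val_slice_pt L : slice_mx v L -> val (to_GL (L *m pmx K v)) = L *m pmx K v.
Proof.
by move=> sL; rewrite val_to_GL // unitmx_mul pmx_unit andbT unitmxE (slice_mx_det sL) unitr1.
Qed.

Lemma good_slice f : good f -> exists2 h, matfun h &
  forall L, slice_mx v L -> f (slice_pt L) = h (L *m pmx K v).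
Proof.
move=> [h [e [mh ih fE]]]; exists h => // L sL.
by rewrite fE val_slice_pt // Delta_slice ?oner_neq0 // expr1n divr1.
Qed.

Lemma good_semi_invariant h e : matfun h ->
  (forall g b : 'M[K]_n, borel b -> h (g *m b) = h g * Chi b ^+ e) ->
  good (fun x => h (val (rep x)) / Delta (val (rep x)) ^+ e).
Proof.
move=> mh ih; exists h, e; split=> // y _; have [b B ->] := rep_piB y.
by rewrite ih // DeltaM // exprMn -mulf_div divff ?mulr1 // expf_neq0 // Chi_neq0.
Qed.

Lemma good_coord (r c : 'I_n) : exists f, good f /\
  forall L, slice_mx v L -> f (slice_pt L) = (L *m pmx K v) r c.
Proof.
have [cr|rc] := leqP c (v^-1%g r); last first.
  exists (fun=> 0); split=> [|L sL]; first exact: (fr_const good_function_ring).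
  by rewrite mul_pmx -{1}(permKV v r) slice_mx_perm0.
(* The other principal minors complete the weight [chi c] to [Chi], the weight of [Delta]. *)
pose h A := row_minor (v^-1%g r) c A * \prod_(j | j != c) row_minor j j A.
have mh : matfun h.
  apply: (fr_mul matfun_ring); first exact: matfun_row_minor.
  by apply: (fr_prod matfun_ring) => j _; exact: matfun_row_minor.
have ih (g b : 'M[K]_n) : borel b -> h (g *m b) = h g * Chi b ^+ 1.
  move=> B; have -> : Chi b ^+ 1 = chi c b * \prod_(j | j != c) chi j b.
    by rewrite expr1 /Chi (bigD1 c).
  rewrite /h row_minorM // [RHS]mulrACA; congr (_ * _).
  by rewrite -big_split; apply: eq_bigr => j _; rewrite row_minorM.
exists (fun x => h (val (rep x)) / Delta (val (rep x)) ^+ 1).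
have gf := good_semi_invariant mh ih; split=> // L sL.
have [b B E] := rep_piB (to_GL (L *m pmx K v)).
rewrite /slice_pt E val_slice_pt // ih // DeltaM // Delta_slice // mul1r !expr1.
rewrite mulfK ?Chi_neq0 // /h row_minor_slice // permKV mul_pmx big1 ?mulr1 // => j _.
by rewrite row_minor_slice // sL.1.
Qed.

Section OnSubset.
Variable N : set (GB K n).
Hypothesis N_slice : forall x, N x -> exists2 L, slice_mx v L & x = slice_pt L.

Lemma good_closed_on f : good f ->
  exists2 F, closed F & forall x, N x -> (F x <-> f x = 0).
Proof.
move=> [h [e [mh ih fE]]]; exists [set x | h (val (rep x)) = 0].
  apply/closed_GBP; apply: (eq_ind _ closed (closed_matfun mh)).
  apply/seteqP; split=> g /=; have [b B ->] := rep_piB g; rewrite ih //.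
    by move=> ->; rewrite mul0r.
  by move/eqP; rewrite mulf_eq0 expf_eq0 (negPf (Chi_neq0 B)) andbF orbF => /eqP.
move=> x /N_slice[L sL ->]; rewrite fE val_slice_pt // Delta_slice ?oner_neq0 //.
rewrite expr1n divr1 /=; have [b B ->] := rep_piB (to_GL (L *m pmx K v)).
rewrite val_slice_pt // ih //; split=> [/eqP|->]; last by rewrite mul0r.
by rewrite mulf_eq0 expf_eq0 (negPf (Chi_neq0 B)) andbF orbF => /eqP.
Qed.

(** A polynomial vanishing on the preimage of F but not at L v is a function on GL_n only.
    Substituting the functions of [good_coord] for the entries makes it good without changing its
    values on the slice. *)
Lemma good_sep_on F x : closed F -> N x -> ~ F x ->
  exists f, [/\ good f, forall y, N y -> F y -> f y = 0 & f x <> 0].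
Proof.
move=> /closed_GBP/closed_GLP[S FS] /N_slice[L sL ->] nF.
have inF L' : slice_mx v L' -> F (slice_pt L') <->
    forall p, S p -> mpoly.meval (fun k => mxvec (L' *m pmx K v) 0 k) p = 0.
  move=> sL'; have : (@piB K n @^-1` F) (to_GL (L' *m pmx K v)) <->
      forall p, S p -> poly_eval p (to_GL (L' *m pmx K v)) = 0 by rewrite FS.
  by rewrite /poly_eval val_slice_pt.
have [p /not_implyP[Sp px]] : exists p, ~ (S p -> mpoly.meval (fun k => mxvec (L *m pmx K v) 0 k) p = 0).
  by apply/existsNP; apply: contra_not nF => /(inF _ sL).
have /choice[c cE] (k : 'I_(n * n)) : exists f, good f /\
    forall L', slice_mx v L' -> f (slice_pt L') = mxvec (L' *m pmx K v) 0 k.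
  case/mxvec_indexP: k => i j; have [f [gf fE]] := good_coord i j.
  by exists f; split=> // L' /fE ->; rewrite mxvecE.
exists (fun y => mpoly.meval (fun k => c k y) p); split.
- by apply: (fr_meval good_function_ring) => k; have [] := cE k.
- move=> y /N_slice[L' sL' ->] /(inF _ sL')/(_ p Sp) <-.
  by congr mpoly.meval; apply/funext => k; have [_ ->] := cE k.
- rewrite (_ : (fun k => _) = fun k => mxvec (L *m pmx K v) 0 k) //.
  by apply/funext => k; have [_ ->] := cE k.
Qed.

End OnSubset.
End SemiInvariants.

Lemma orbit_oppP v x : orbit_in_GB (@borel_opp K n) v x <->
  exists2 L, slice_mx v L & x = slice_pt v L.
Proof.
split=> [[g [h H [b B gE]] <-]|[L sL ->]].
  have [c [L [C sL E]]] := slice_mxP v H.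
  exists L => //; apply/piBP; rewrite val_slice_pt //.
  exists (invmx b *m c); first by apply: borelM => //; exact: borelV.
  by rewrite -E gE !mulmxA mulmxK //; case: B.
exists (to_GL (L *m pmx K v)) => //; exists L; first exact: slice_mx_opp sL.
by exists 1%:M; [exact: borel1 | rewrite mulmx1 val_slice_pt].
Qed.

Section Schubert.
Variables (w : 'S_n) (a b : 'I_n).
Hypothesis cw : crossing w a b.

Definition sw_block (A : 'M[K]_n) : 'M[K]_n :=
  mask_mx K [set i : 'I_n | (a <= i)%N] *m A *m mask_mx K [set j : 'I_n | (j <= b)%N].

Lemma sw_block_pmx u : \rank (sw_block (pmx K u)) = sw_count u a b.
Proof. by rewrite rank_mask_pmx; apply: eq_card => x; rewrite !inE andbC. Qed.

Lemma rank_le_minors m (A : 'M[K]_n) : (\rank A <= m)%N <->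
  forall r (f1 f2 : 'I_r -> 'I_n), (m < r)%N -> \det (mxsub f1 f2 A) = 0.
Proof.
split=> [Am r f1 f2 mr|h].
  apply/eqP; apply: contraTT mr; rewrite -leqNgt => d0; apply: leq_trans Am.
  have : mxsub f1 f2 A \in unitmx by rewrite unitmxE unitfE.
  rewrite -row_free_unit -row_leq_rank => /leq_trans; apply.
  have -> : mxsub f1 f2 A = rowsub f1 1%:M *m A *m (rowsub f2 1%:M)^T.
    rewrite -rowsubE; apply/matrixP => i j; rewrite !mxE (bigD1 (f2 j)) //=.
    rewrite !mxE eqxx mulr1 big1 ?addr0 // => k kj.
    by rewrite !mxE eq_sym (negPf kj) mulr0.
  by apply: leq_trans (mxrankM_maxl _ _) _; exact: mxrankM_maxr.
rewrite leqNgt; apply/negP => lt.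
pose A1 := rowsub (maxrankfun A) A.
have rA1 : \rank A1^T = \rank A by rewrite mxrank_tr (eqP (maxrowsub_free A)).
have := maxrowsub_free A1^T; move: (maxrankfun A1^T); rewrite rA1 => g fr.
have := h _ (maxrankfun A) g lt.
have -> : mxsub (maxrankfun A) g A = (rowsub g A1^T)^T by apply/matrixP => i j; rewrite !mxE.
by move/eqP; apply/negP; rewrite det_tr -unitfE -unitmxE -row_free_unit fr.
Qed.

Lemma closed_sw_rank m : closed [set g : GL K n | (\rank (sw_block (val g)) <= m)%N].
Proof.
have -> : [set g : GL K n | (\rank (sw_block (val g)) <= m)%N] =
    \bigcap_(q in [set q : {r : nat & (('I_r -> 'I_n) * ('I_r -> 'I_n))%type} | (m < tag q)%N])
      [set g : GL K n | \det (mxsub (tagged q).1 (tagged q).2 (sw_block (val g))) = 0].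
  apply/seteqP; split=> g /=.
    by move=> /rank_le_minors h [r [f1 f2]] /= mr; exact: h.
  move=> h; apply/rank_le_minors => r f1 f2 mr.
  exact: (h (existT _ r (f1, f2)) mr).
apply: closed_bigI => -[r [f1 f2]] _ /=.
apply: (@closed_matfun (fun A => \det (mxsub f1 f2 (sw_block A)))).
apply: (fr_det matfun_ring) => i j.
apply: (eq_ind _ matfun (fr_mulmx matfun_ring (M := fun A => mask_mx K [set i : 'I_n | (a <= i)%N] *m A)
  (N := fun=> mask_mx K [set j : 'I_n | (j <= b)%N]) _ _ (f1 i) (f2 j))).
- move=> i' j'; apply: fr_mulmx; [exact: matfun_ring| |exact: matfun_entry].
  by move=> x y; exact: (fr_const matfun_ring).
- by move=> x y; exact: (fr_const matfun_ring).
by apply/funext => A; rewrite [RHS]mxE.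
Qed.

(** As s tends to 0 the left side tends to u, which puts BuB in the closure of
    Bu'B. *)
Lemma pmx_degeneration u (i j : 'I_n) (s : K) : (i < j)%N -> (u i < u j)%N -> s != 0 ->
  exists b1 b2, [/\ borel b1, borel b2 &
    pmx K u *m (1%:M + s *: delta_mx j i) =
    b1 *m pmx K (u * tperm (u i) (u j))%g *m b2].
Proof.
move=> ij uij s0; set u' := (_ * _)%g.
have nij : i != j by rewrite -val_eqE neq_ltn ij.
have nuij : u i != u j by rewrite (inj_eq perm_inj).
(* The identity [[1, 0], [s, 1]] = [[1, 1/s], [0, 1]] [[0, 1], [1, 0]] [[s, 1], [0, -1/s]], with b1
   placed at the indices u i, u j and b2 at i, j. *)
pose b1 : 'M[K]_n := \matrix_(r, c) ((r == c)%:R + ((r == u i) && (c == u j))%:R / s).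
pose b2 : 'M[K]_n := \matrix_(r, c) (if c == i then (r == i)%:R * s
  else if c == j then (r == i)%:R - (r == j)%:R / s else (r == c)%:R).
exists b1, b2; split.
- apply: borelI => [r c cr|r]; rewrite mxE.
    rewrite -val_eqE (gtn_eqF cr) add0r; case: eqP => [rE|_]; last by rewrite mul0r.
    case: eqP => [cE|_]; last by rewrite mul0r.
    by move: cr; rewrite rE cE ltnNge ltnW.
  rewrite eqxx; have [->|_] := eqVneq r (u i); rewrite ?(negPf nuij) mul0r addr0 oner_neq0 //.
- apply: borelI => [r c cr|r]; rewrite mxE.
    have rc : (r == c) = false by rewrite -val_eqE (gtn_eqF cr).
    case: (eqVneq c i) => [ci|_]; first by rewrite -ci rc mul0r.
    case: (eqVneq c j) => [cj|_]; last by rewrite rc.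
    rewrite -cj rc mul0r subr0; case: (eqVneq r i) => // ri.
    by move: cr; rewrite ri cj ltnNge ltnW.
  case: (eqVneq r i) => [_|ri]; first by rewrite mul1r.
  case: (eqVneq r j) => [_|_]; last by rewrite eqxx oner_neq0.
  by rewrite sub0r mul1r oppr_eq0 invr_eq0.
apply/matrixP => r c.
have -> : (b1 *m pmx K u' *m b2) r c = \sum_k b1 r (u (tperm i j k)) * b2 k c.
  by rewrite mxE; apply: eq_bigr => k _; rewrite mul_pmx mul_tperm_perm.
rewrite mulmxDr mulmx1 -scalemxAr !mxE.
under [X in _ + s * X]eq_bigr do rewrite !mxE.
rewrite (bigD1 j) //= eqxx /= big1 => [|k /negPf kj]; last by rewrite kj mulr0.
rewrite addr0.
have ui_ : (u i == u j) = false by apply/negbTE.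
case: (eqVneq c i) => [ci|ci].
  rewrite (bigD1 i) //= [b2 i c]mxE ci eqxx mul1r tpermL big1 => [|k /negPf ki]; last first.
    by rewrite [b2 _ _]mxE eqxx ki mul0r mulr0.
  rewrite mxE eqxx andbT !mulr1 addr0 mulrDl divfK // addrC ![r == _]eq_sym.
  by congr (_ + _); rewrite mulrC.
rewrite mulr0 mulr0 addr0.
case: (eqVneq c j) => [cj|cj].
  rewrite (bigD1 i) //= (bigD1 j) /=; last by rewrite eq_sym.
  rewrite [b2 i c]mxE [b2 j c]mxE (negPf ci) cj eqxx (eq_sym j i) (negPf nij) !eqxx.
  rewrite tpermL tpermR big1 => [|k /andP[/negPf ki /negPf kj]]; last first.
    by rewrite [b2 _ _]mxE (eq_sym j i) (negPf nij) eqxx ki kj mul0r subr0 mulr0.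
  rewrite addr0 !mxE eqxx andbT (eq_sym (u j) _) ?ui_ ?andbF.
  have -> : (false%:R : K) = 0 by [].
  have -> : (true%:R : K) = 1 by [].
  by rewrite !mul0r subr0 mulr1 addr0 sub0r mul1r mulrN addrK.
rewrite (bigD1 c) //= [b2 c c]mxE (negPf ci) (negPf cj) eqxx mulr1 big1 => [|k /negPf kc]; last first.
  by rewrite [b2 _ _]mxE (negPf ci) (negPf cj) kc mulr0.
rewrite tpermD 1?eq_sym // mxE addr0 (inj_eq perm_inj) (negPf cj) andbF mul0r addr0.
by rewrite eq_sym.
Qed.

(** Descent along a Bruhat chain from w: a polynomial vanishing over F vanishes on the family of
    [pmx_degeneration] for s nonzero, hence also at s = 0. *)
Lemma bruhat_closed_cell F u : closed F -> orbit_in_GB (@borel K n) w `<=` F ->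
  bruhat u w -> forall g b1 b2, borel b1 -> borel b2 -> val g = b1 *m pmx K u *m b2 ->
  F (piB g).
Proof.
move=> Fc wF /connectP[p + wE]; elim: p u wE => [|u' p IH] u /=.
  move=> wu _ g b1 b2 B1 B2 gE; apply: wF; exists g => //.
  by exists b1 => //; exists b2; rewrite // wu.
move=> wE /andP[/bruhat_stepP[i [j [ij uij u'E]]] up] g b1 b2 B1 B2 gE.
have /closed_GBP/closed_GLP[S FS] := Fc.
suff : (@piB K n @^-1` F) g by [].
rewrite FS => q Sq.
pose A s := b1 *m (pmx K u *m (1%:M + s *: delta_mx j i)) *m b2.
have Au s : A s \in unitmx.
  rewrite !unitmx_mul B1.1 B2.1 pmx_unit andbT /= unitmxE det_trig; last first.
    apply/is_trig_mxP => r c rc; rewrite !mxE -val_eqE (ltn_eqF rc) add0r.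
    case: eqP => [rj|_]; last by rewrite mulr0.
    case: eqP => [ci|_]; last by rewrite mulr0.
    by move: rc; rewrite rj ci ltnNge ltnW.
  rewrite big1 ?unitr1 // => r _; rewrite !mxE eqxx.
  case: eqP => [->|_]; last by rewrite mulr0 addr0.
  by rewrite -val_eqE (gtn_eqF ij) mulr0 addr0.
pose f s := mpoly.meval (fun k => mxvec (A s) 0 k) q.
have uf : unifun f.
  apply: (fr_meval (unifun_ring K)) => k; case/mxvec_indexP: k => r c.
  apply: (eq_ind _ (@unifun K) (fr_mulmx (unifun_ring K) (M := fun s => b1 *m (pmx K u *m (1%:M + s *: delta_mx j i)))
    (N := fun=> b2) _ _ r c)).
  - move=> r' c'; apply: fr_mulmx; first exact: unifun_ring.
      by move=> x y; exact: (fr_const (unifun_ring K)).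
    move=> x y; apply: fr_mulmx; first exact: unifun_ring.
      by move=> *; exact: (fr_const (unifun_ring K)).
    move=> x' y'; apply: (eq_ind (fun s => 1%:M x' y' + s * (delta_mx j i : 'M[K]_n) x' y') (@unifun K)).
      apply: (fr_add (unifun_ring K)); first exact: (fr_const (unifun_ring K)).
      by apply: (fr_mul (unifun_ring K)); [exact: unifun_id|exact: (fr_const (unifun_ring K))].
    by apply/funext => s; rewrite !mxE.
  - by move=> x y; exact: (fr_const (unifun_ring K)).
  by apply/funext => s; rewrite mxvecE.
have f0 s : s != 0 -> f s = 0.
  move=> s0; have [c1 [c2 [C1 C2 E]]] := pmx_degeneration ij uij s0.
  have : F (piB (to_GL (A s))).
    apply: (IH u' wE up _ (b1 *m c1) (c2 *m b2)); try exact: borelM.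
    by rewrite val_to_GL // /A E -u'E !mulmxA.
  have -> : F (piB (to_GL (A s))) = (@piB K n @^-1` F) (to_GL (A s)) by [].
  by rewrite FS => /(_ q Sq); rewrite /poly_eval val_to_GL.
have := unifun_eq0 uf f0 0; rewrite /f /A scale0r addr0 mulmx1 -gE.
by [].
Qed.

(** The rank condition is closed, stable under B on both sides, and true on the cell of w.
    Conversely g lies in some BuB; its rank is [sw_count u a b], and [bruhatE] turns the bound into
    u <= w. *)
Lemma schubertP g : schubert w (piB g) <-> (\rank (sw_block (val g)) <= sw_count w a b)%N.
Proof.
split=> [|le].
  pose F := [set x : GB K n | (\rank (sw_block (val (rep x))) <= sw_count w a b)%N].
  have FE g' : F (piB g') <-> (\rank (sw_block (val g')) <= sw_count w a b)%N.
    rewrite /F /=; have [c C ->] := rep_piB g'.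
    by rewrite -[val g' *m c]mul1mx mulmxA /sw_block rank_borel //; exact: borel1.
  have Fc : closed F.
    apply/closed_GBP.
    have -> : @piB K n @^-1` F = [set g' | (\rank (sw_block (val g')) <= sw_count w a b)%N].
      by apply/seteqP; split=> g' /FE.
    exact: closed_sw_rank.
  move=> gS; apply/FE; have : closure (orbit_in_GB (@borel K n) w) `<=` F; last exact.
  rewrite [X in _ `<=` X](proj1 (closure_id _) Fc); apply: closureS => _ [g' [h H [c C gE]] <-].
  by apply/FE; rewrite gE /sw_block rank_borel // -/(sw_block _) sw_block_pmx.
rewrite /schubert closureEbigcap => F [Fc wF].
have [b1 [b2 [u [B1 B2 E]]]] := bruhat_decomposition (valP g).
apply: (@bruhat_closed_cell F u Fc wF _ g (invmx b1) (invmx b2)); try exact: borelV.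
  by rewrite (bruhatE _ cw) -(sw_block_pmx u) -E /sw_block rank_borel.
by rewrite -E -!mulmxA mulmxV ?B2.1 // mulmx1 mulmxA mulVmx ?mul1mx //; case: B1.
Qed.

Lemma KLvarietyP v x : KLvariety (K := K) v w x <-> exists L, [/\ slice_mx v L,
  x = slice_pt v L & (\rank (sw_block (L *m pmx K v)) <= sw_count w a b)%N].
Proof.
split=> [[xS /orbit_oppP[L sL xE]]|[L [sL xE rk]]].
  by exists L; split=> //; move: xS; rewrite xE => /schubertP; rewrite val_slice_pt.
split; last by apply/orbit_oppP; exists L.
by rewrite xE; apply/schubertP; rewrite val_slice_pt.
Qed.

End Schubert.
End FlagTopology.

(** * Charts of the Kazhdan-Lusztig variety *)

Section SchurComplement.
Variables (K : fieldType) (n : nat) (R1 R2 V2 : {set 'I_n}).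
Hypotheses (R12 : [disjoint R1 & R2]) (R1V : [disjoint R1 & V2]).
Local Notation P1 := (mask_mx K R1).
Local Notation P2 := (mask_mx K R2).
Local Notation PV := (mask_mx K V2).
Implicit Types L : 'M[K]_n.

(** Padding the R1 block by the identity makes its inverse the inverse of an n by n matrix commuting
    with [P1]. *)
Definition corner L : 'M[K]_n := 1%:M - P1 + P1 *m L *m P1.

(** C A^-1 B for the blocks A, B, C of L in rows R1, R1, R2 and columns R1, V2,
    R1: the corner has determinant 1 in the applications, so that the adjugate
    is a polynomial form of its inverse. *)
Definition schur_corr L : 'M[K]_n := P2 *m L *m P1 *m \adj (corner L) *m (P1 *m L *m PV).

Lemma mask_mx0 : mask_mx K finset.set0 = 0 :> 'M[K]_n.
Proof. by apply/matrixP => i j; rewrite !mxE inE mul0rn. Qed.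

Lemma mask_disjoint (X Y : {set 'I_n}) : [disjoint X & Y] -> mask_mx K X *m mask_mx K Y = 0.
Proof. by rewrite -setI_eq0 mask_mxM => /eqP ->; exact: mask_mx0. Qed.

Lemma mask_idem (X : {set 'I_n}) : mask_mx K X *m mask_mx K X = mask_mx K X.
Proof. by rewrite mask_mxM finset.setIid. Qed.

Let P12 : P1 *m P2 = 0. Proof. exact: mask_disjoint. Qed.
Let P21 : P2 *m P1 = 0. Proof. by apply: mask_disjoint; rewrite disjoint_sym. Qed.
Let PV1 : PV *m P1 = 0. Proof. by apply: mask_disjoint; rewrite disjoint_sym. Qed.

(** Block elimination: the matrix is (1 + C E)(P1 A + D - C E B)(1 + E B), where C E and E B square
    to zero, so that the outer factors are invertible. The two parts of the middle factor have
    disjoint supports, and their ranks add. *)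
Lemma schur_rank_block (A E B C D : 'M[K]_n) :
  E *m A = 1%:M -> A *m E = 1%:M -> P1 *m A = A *m P1 ->
  C *m P1 = C -> P2 *m C = C -> P1 *m B = B -> B *m PV = B ->
  P2 *m D = D -> D *m PV = D ->
  \rank (P1 *m A + B + (C + D))%R = (#|R1| + \rank (D - C *m E *m B)%R)%N.
Proof.
move=> EA AE PA CP P2C PB BV P2D DV; pose S := D - C *m E *m B.
have PE : P1 *m E = E *m P1.
  by rewrite -[LHS]mul1mx -EA -(mulmxA E) (mulmxA A) -PA -(mulmxA P1) AE mulmx1.
have P2S : P2 *m S = S.
  by rewrite /S mulmxBr P2D -(mulmxA C) (mulmxA P2) P2C.
have SV : S *m PV = S.
  by rewrite /S mulmxBl DV -(mulmxA _ B) BV.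
have CEX X : P2 *m X = X -> C *m E *m X = 0.
  move=> <-; rewrite (mulmxA _ P2) -CP -(mulmxA C P1) PE -(mulmxA C) -(mulmxA E) P12.
  by rewrite !mulmx0 mul0mx.
have XEB X : X *m PV = X -> X *m (E *m B) = 0.
  move=> <-; rewrite -(mulmxA X) -PB (mulmxA E) -PE -(mulmxA P1) (mulmxA PV) PV1.
  by rewrite mul0mx mulmx0.
have S1 : S *m E *m P1 = 0.
  by rewrite -mulmxA -PE -SV -(mulmxA S) (mulmxA PV) PV1 mul0mx mulmx0.
have -> : P1 *m A + B + (C + D) = (1%:M + C *m E) *m (P1 *m A + S) *m (1%:M + E *m B).
  have -> : (1%:M + C *m E) *m (P1 *m A + S) = P1 *m A + S + C.
    rewrite mulmxDl mul1mx; congr (_ + _).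
    rewrite mulmxDr (CEX _ S P2S) addr0 PA -(mulmxA C) (mulmxA E) EA mul1mx.
    exact: CP.
  rewrite mulmxDr mulmx1 mulmxDl mulmxDl (XEB _ S SV) addr0.
  rewrite -(mulmxA P1) (mulmxA A) AE mul1mx PB (mulmxA C) /S.
  rewrite -!addrA; congr (_ + _); move: (C *m E *m B) => e.
  by rewrite (addrA C B e) (addrCA (- e)) addNr addr0 (addrC D) (addrC C B) addrA.
have unit_nil (N : 'M[K]_n) : N *m N = 0 -> 1%:M + N \in unitmx.
  move=> NN; suff : (1%:M + N) *m (1%:M - N) = 1%:M by case/mulmx1_unit.
  by rewrite mulmxDl mul1mx mulmxBr mulmx1 NN subr0 subrK.
rewrite mxrankMfree; last first.
  rewrite row_free_unit; apply: unit_nil.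
  by rewrite -mulmxA (XEB _ B BV) mulmx0.
rewrite eqmxMfull; last first.
  rewrite row_full_unit; apply: unit_nil.
  by rewrite (mulmxA (C *m E)) (CEX _ C P2C) mul0mx.
have Eu : E \in unitmx by case/mulmx1_unit: EA.
rewrite -(@mxrankMfree _ _ _ _ (P1 *m A + S) E) ?row_free_unit //.
rewrite mulmxDl -(mulmxA P1) AE mulmx1.
have P1SE : P1 *m (S *m E) = 0 by rewrite mulmxA -P2S mulmxA P12 !mul0mx.
have -> : \rank (P1 + S *m E)%R = \rank (P1 + S *m E)%MS.
  apply/eqmx_rank/andP; split; first exact: addmx_sub_adds.
  rewrite addsmx_sub; apply/andP; split.
    have {1}<- : P1 *m (P1 + S *m E) = P1 by rewrite mulmxDr mask_idem P1SE addr0.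
    exact: submxMl.
  have {1}<- : P2 *m (P1 + S *m E) = S *m E by rewrite mulmxDr P21 add0r mulmxA P2S.
  exact: submxMl.
rewrite mxrank_disjoint_sum; last first.
  apply/eqP; rewrite -submx0; apply/rV_subP => u; rewrite sub_capmx => /andP[/submxP[x xE] /submxP[y yE]].
  have : u *m P1 = u by rewrite xE -mulmxA mask_idem.
  by rewrite {1}yE -mulmxA S1 mulmx0 => <-; exact: sub0mx.
by rewrite rank_mask mxrankMfree ?row_free_unit.
Qed.

Lemma schur_rank L : \det (corner L) = 1 ->
  \rank (mask_mx K (R1 :|: R2) *m L *m mask_mx K (R1 :|: V2)) =
  (#|R1| + \rank (P2 *m L *m PV - schur_corr L)%R)%N.
Proof.
move=> dA.
have corner_l : P1 *m corner L = P1 *m L *m P1.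
  by rewrite /corner mulmxDr mulmxBr mulmx1 mask_idem subrr add0r !mulmxA mask_idem.
have corner_r : corner L *m P1 = P1 *m L *m P1.
  by rewrite /corner mulmxDl mulmxBl mul1mx mask_idem subrr add0r -[LHS]mulmxA mask_idem.
rewrite -(@schur_rank_block (corner L)); last first.
- by rewrite -[LHS]mulmxA mask_idem.
- by rewrite !mulmxA mask_idem.
- by rewrite -[LHS]mulmxA mask_idem.
- by rewrite !mulmxA mask_idem.
- by rewrite !mulmxA mask_idem.
- by rewrite -[LHS]mulmxA mask_idem.
- exact: etrans corner_l (esym corner_r).
- by rewrite mul_mx_adj dA.
- by rewrite mul_adj_mx dA.
have maskU (X Y : {set 'I_n}) : [disjoint X & Y] -> mask_mx K (X :|: Y) = mask_mx K X + mask_mx K Y.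
  move=> dXY; apply/matrixP => i j; rewrite !mxE inE -mulrnDl; congr (_ *+ _).
  have [iX|iX] := boolP (i \in X); last by rewrite add0r.
  by rewrite (disjointFr dXY iX) addr0.
rewrite !maskU // mulmxDl mulmxDr !mulmxDl; congr (\rank _).
rewrite addrACA; congr (_ + _ + _).
exact: esym corner_l.
Qed.

End SchurComplement.

Section SpanningRows.
Variables (K : fieldType) (n : nat).

Lemma subset_card_ex (T : finType) (A C : {set T}) k : A \subset C ->
  (#|A| <= k <= #|C|)%N -> exists B : {set T}, [/\ A \subset B, B \subset C & #|B| = k].
Proof.
move=> AC /andP[Ak kC].
pose s := take (k - #|A|) (enum (C :\: A)).
have sC x : x \in s -> (x \in C) && (x \notin A).
  by move/mem_take; rewrite mem_enum finset.in_setD andbC.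
have us : uniq s by rewrite take_uniq ?enum_uniq.
have szs : size s = (k - #|A|)%N.
  by rewrite size_takel // -cardE cardsD (finset.setIidPr AC) leq_sub2r.
exists (A :|: [set x in s]); split; first exact: finset.subsetUl.
  by rewrite finset.subUset AC; apply/fintype.subsetP => x; rewrite inE => /sC/andP[].
rewrite cardsU (_ : A :&: [set x in s] = finset.set0) ?cards0; last first.
  apply/setP => x; rewrite !inE; apply/negP => /andP[xA /sC/andP[_]].
  by rewrite xA.
by rewrite cardsE (card_uniqP us) szs subn0 subnKC.
Qed.

(** The rank may be less than [#|J|]: a maximal independent set of rows is completed inside R to
    exactly [#|J|] rows, so that one family of charts covers all ranks. J only labels these rows. *)
Lemma spanning_rows (S : 'M[K]_n) (R J : {set 'I_n}) :
  mask_mx K R *m S = S -> (\rank S <= #|J| <= #|R|)%N ->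
  exists (beta : {ffun 'I_n -> 'I_n}) (Z : 'M[K]_n),
    [/\ {in J &, injective beta}, [set beta j | j in J] \subset R &
        forall i c, S i c = \sum_(j in J) Z i j * S (beta j) c].
Proof.
move=> RS /andP[SJ JR].
have R0 x c : x \notin R -> S x c = 0 by move=> xR; rewrite -RS mask_mxl (negPf xR).
pose f := maxrankfun S; pose I0 := [set f k | k in 'I_(\rank S)].
have I0R : I0 \subset R.
  apply/fintype.subsetP => _ /imsetP[k _ ->]; apply: contraT => kR.
  have := maxrowsub_free S; rewrite -kermx_eq0 => /eqP ker0.
  have : delta_mx 0 k *m rowsub (maxrankfun S) S = 0 :> 'rV_n.
    by rewrite -rowE; apply/rowP => c; rewrite !mxE R0.
  move/sub_kermxP; rewrite ker0 submx0 => /eqP/matrixP/(_ 0 k)/eqP.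
  by rewrite !mxE !eqxx oner_eq0.
have cI0 : #|I0| = \rank S by rewrite card_imset ?card_ord //; exact: maxrankfun_inj.
have [|I [I0I IR cI]] := @subset_card_ex _ I0 R #|J| I0R; first by rewrite cI0 SJ.
have := submx_refl S; rewrite -{1}(eq_maxrowsub S) => SS.
have SI : (S <= mask_mx K I *m S)%MS.
  rewrite -{1}(eq_maxrowsub S); apply/row_subP => k.
  have -> : row k (rowsub (maxrankfun S) S) = row (f k) (mask_mx K I *m S).
    apply/rowP => c; rewrite !mxE; symmetry; rewrite -[RHS]/(S (f k) c).
    have := mask_mxl I S (f k) c; rewrite (fintype.subsetP I0I) ?imset_f // => <-.
    by rewrite mxE.
  exact: row_sub.
have [Z0 Z0E] := submxP SI.
have [J0|[j0 j0J]] := set_0Vmem J.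
  exists [ffun x => x], 0; split=> [x y|//|i c].
  - by rewrite J0 inE.
  - by rewrite J0 imset0 finset.sub0set.
  rewrite J0 big_set0; have I00 : I = finset.set0 by apply/eqP; rewrite -cards_eq0 cI J0 cards0.
  by rewrite Z0E I00 (mask_mx0 K n) mul0mx mulmx0 mxE.
have szJ : size (enum J) = size (enum I) by rewrite -!cardE cI.
pose beta : {ffun 'I_n -> 'I_n} := [ffun j => nth j0 (enum I) (index j (enum J))].
have ltJ j : j \in J -> (index j (enum J) < size (enum I))%N.
  by move=> jJ; rewrite -szJ index_mem mem_enum.
have injb : {in J &, injective beta}.
  move=> x y xJ yJ; rewrite !ffunE => /eqP; rewrite nth_uniq ?ltJ ?enum_uniq // => /eqP E.
  by rewrite -(nth_index j0 (_ : x \in enum J)) ?mem_enum // E nth_index ?mem_enum.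
have imb : [set beta j | j in J] = I.
  apply/eqP; rewrite eqEcard card_in_imset // cI leqnn andbT.
  by apply/fintype.subsetP => _ /imsetP[j jJ ->]; rewrite ffunE -mem_enum mem_nth ?ltJ.
exists beta, (\matrix_(i, j) Z0 i (beta j)); split=> // [|i c]; first by rewrite imb.
rewrite {1}Z0E mxE; under eq_bigr do rewrite mask_mxl (fun_if (GRing.mul _)) mulr0.
rewrite -big_mkcond -imb big_imset //=; apply: eq_bigr => j jJ; rewrite mxE //.
Qed.

End SpanningRows.

Section Parametrization.
Variables (K : numFieldType) (n : nat) (v : 'S_n) (a b : 'I_n) (m : nat).
Hypotheses (rm : (sw_count v a b <= m)%N) (mr : (m <= n - a)%N).
Local Notation vi := (v^-1)%g.

(** Columns of L being indexed by values, the south-west block of L v has rows R1, R2 and columns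
    R1, V2; R1 carries the 1s of v in the block. [rho] is the rank left to the Schur complement. *)
Let R1 := [set i : 'I_n | (a <= i)%N && (vi i <= b)%N].
Let R2 := [set i : 'I_n | (a <= i)%N && (b < vi i)%N].
Let V2 := [set c : 'I_n | (c < a)%N && (vi c <= b)%N].
Let rho := (m - sw_count v a b)%N.
Local Notation P1 := (mask_mx K R1).
Local Notation P2 := (mask_mx K R2).
Local Notation PV := (mask_mx K V2).

(** D°(v) with columns indexed by the values v(j). *)
Definition value_boxes : {set 'I_n * 'I_n} :=
  [set q : 'I_n * 'I_n | (q.2 < q.1)%N && (vi q.2 < vi q.1)%N].

Let R12 : [disjoint R1 & R2].
Proof.
rewrite -setI_eq0; apply/eqP/setP => i; rewrite !inE.
by rewrite [(vi i <= b)%N]leqNgt; case: (b < vi i)%N; rewrite ?andbF.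
Qed.

Let R1V : [disjoint R1 & V2].
Proof.
rewrite -setI_eq0; apply/eqP/setP => i; rewrite !inE.
by rewrite leqNgt; case: (i < a)%N; rewrite ?andbF.
Qed.

Let R2V : [disjoint R2 & V2].
Proof.
rewrite -setI_eq0; apply/eqP/setP => i; rewrite !inE.
by rewrite leqNgt; case: (i < a)%N; rewrite ?andbF.
Qed.

Let card_R1 : #|R1| = sw_count v a b.
Proof.
rewrite /sw_count -(card_perm_pre v (fun i : 'I_n => (a <= i)%N && (vi i <= b)%N)).
by apply: eq_card => x; rewrite !inE permK andbC.
Qed.

Let card_R2 : #|R2| = (n - a - sw_count v a b)%N.
Proof. by rewrite -card_free_rows; apply: eq_card => x; rewrite !inE. Qed.

Let card_V2 : #|V2| = (b.+1 - sw_count v a b)%N.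
Proof.
rewrite -card_free_cols -(card_perm_pre v (fun i : 'I_n => (i < a)%N && (vi i <= b)%N)).
by apply: eq_card => x; rewrite !inE permK andbC.
Qed.

Lemma card_value_boxes : #|value_boxes| = #|oRothe v|.
Proof.
have inj : injective (fun q : 'I_n * 'I_n => (q.1, v q.2)) by move=> [i j] [i' j'] [-> /perm_inj ->].
rewrite -[RHS](card_imset _ inj); apply: eq_card => -[i c]; rewrite inE /=.
apply/idP/imsetP => [/andP[h1 h2]|[[i' j'] + [-> ->]]].
  by exists (i, vi c); rewrite ?permKV // in_oRothe permKV h1.
by rewrite in_oRothe permK.
Qed.

Lemma block_value_box i c : i \in R2 -> c \in V2 -> (i, c) \in value_boxes.
Proof.
rewrite !inE /= => /andP[ai bi] /andP[ca cb].
by rewrite (leq_trans ca ai) (leq_ltn_trans cb bi).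
Qed.

Lemma slice_corner (L : 'M[K]_n) : slice_mx v L -> \det (corner R1 L) = 1.
Proof.
move=> sL; have E i c : corner R1 L i c = if (i \in R1) && (c \in R1) then L i c else (i == c)%:R.
  rewrite /corner [LHS]mxE mask_mxr mask_mxl !mxE.
  have [->|ic] := eqVneq i c; last first.
    by rewrite !mulr0n subrr add0r; case: (i \in R1); case: (c \in R1).
  by rewrite !mulr1n; case: (c \in R1); rewrite /= ?subrr ?add0r // subr0 addr0.
rewrite det_trig.
  by apply: big1 => i _; rewrite E sL.1 eqxx; case: ifP.
apply/is_trig_mxP => i c ic; rewrite E (slice_mx_lt sL ic) -val_eqE (ltn_eqF ic).
by case: ifP.
Qed.

Lemma rank_slice (L : 'M[K]_n) : slice_mx v L -> \rank (sw_block a b (L *m pmx K v)) =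
  (sw_count v a b + \rank (P2 *m L *m PV - schur_corr R1 R2 V2 L)%R)%N.
Proof.
move=> sL; rewrite -card_R1 -schur_rank //; last exact: slice_corner.
have <- : mask_mx K (R1 :|: R2) *m L *m mask_mx K (R1 :|: V2) *m pmx K v =
    sw_block a b (L *m pmx K v).
  apply/matrixP => i j; rewrite mul_pmx /sw_block !mask_mxr !mask_mxl mul_pmx !inE permK.
  have -> : (a <= i)%N && (vi i <= b)%N || (a <= i)%N && (b < vi i)%N = (a <= i)%N.
    by case: (leqP (vi i) b); rewrite ?andbT ?andbF ?orbF.
  suff -> : (a <= v j)%N && (j <= b)%N || (v j < a)%N && (j <= b)%N = (j <= b)%N by [].
  by case: (leqP a (v j)); rewrite ?orbF.
by rewrite mxrankMfree // row_free_unit pmx_unit.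
Qed.

Variable J : {set 'I_n}.
Hypotheses (JV : J \subset V2) (cJ : #|J| = rho).

Let rho_R2 : (rho <= #|R2|)%N. Proof. by rewrite card_R2 leq_sub2r. Qed.

Section Chart.
Variable beta : {ffun 'I_n -> 'I_n}.

Definition chart_ok : bool :=
  (#|[set beta j | j in J]| == #|J|) && ([set beta j | j in J] \subset R2).

(** The rows beta(j), j in J, of a matrix tau with support in chart_boxes
    determine the other rows i of R2, as the combinations with coefficients
    tau i j. *)
Definition chart_boxes : {set 'I_n * 'I_n} :=
  value_boxes :\: finset.setX (R2 :\: [set beta j | j in J]) (V2 :\: J).

Definition chart_X (tau : 'M[K]_n) : 'M[K]_n := \matrix_(i, j)
  if j \in J then (if i \in [set beta j | j in J] then (i == beta j)%:R else tau i j) else 0.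

Definition chart_Y (tau : 'M[K]_n) : 'M[K]_n := \matrix_(j, c)
  if j \in J then tau (beta j) c else 0.

Definition chart_off (tau : 'M[K]_n) : 'M[K]_n := 1%:M + tau - P2 *m tau *m PV.

(** The correction is added inside the block R2 x V2 so that the Schur complement of the result is
    the product X Y, of rank at most [rho]. *)
Definition chart (tau : 'M[K]_n) : 'M[K]_n :=
  chart_off tau + P2 *m (chart_X tau *m chart_Y tau) *m PV + schur_corr R1 R2 V2 (chart_off tau).

Lemma schur_corrE (L : 'M[K]_n) : schur_corr R1 R2 V2 L =
  P2 *m (L *m P1 *m \adj (corner R1 L) *m P1 *m L) *m PV.
Proof. by rewrite /schur_corr !mulmxA. Qed.

Lemma block_mask (Z : 'M[K]_n) i c :
  (P2 *m Z *m PV) i c = if (i \in R2) && (c \in V2) then Z i c else 0.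
Proof. by rewrite mask_mxr mask_mxl; case: (i \in R2); case: (c \in V2). Qed.

Lemma chart_offE tau i c : chart_off tau i c =
  if (i \in R2) && (c \in V2) then 0 else (i == c)%:R + tau i c.
Proof.
rewrite /chart_off [LHS]mxE [X in _ + X]mxE block_mask !mxE; case: ifP => [/andP[iR cV]|_].
  have -> : (i == c) = false by apply/negP => /eqP ic; rewrite ic (disjointFl R2V cV) in iR.
  by rewrite add0r subrr.
by rewrite subr0.
Qed.

Lemma chartE tau i c : chart tau i c =
  if (i \in R2) && (c \in V2) then
    (chart_X tau *m chart_Y tau) i c + schur_corr R1 R2 V2 (chart_off tau) i c
  else (i == c)%:R + tau i c.
Proof.
rewrite /chart [LHS]mxE [X in X + _]mxE chart_offE block_mask schur_corrE block_mask.
by case: ifP => _; rewrite ?add0r ?addr0.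
Qed.

(** The correction reads L only outside the block R2 x V2, so it is known before the block is
    filled. *)
Lemma schur_corr_block (L : 'M[K]_n) (Z : 'M[K]_n) :
  schur_corr R1 R2 V2 (L + P2 *m Z *m PV) = schur_corr R1 R2 V2 L.
Proof.
have P12 : P1 *m P2 = 0 by exact: mask_disjoint.
have PV1 : PV *m P1 = 0 by apply: mask_disjoint; rewrite disjoint_sym.
have l X : X *m P1 *m (L + P2 *m Z *m PV) = X *m P1 *m L :> 'M_n.
  by rewrite mulmxDr !mulmxA -(mulmxA X P1 P2) P12 mulmx0 !mul0mx addr0.
have r : (L + P2 *m Z *m PV) *m P1 = L *m P1.
  by rewrite mulmxDl -(mulmxA _ PV P1) PV1 mulmx0 addr0.
have cE : corner R1 (L + P2 *m Z *m PV) = corner R1 L.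
  rewrite /corner; congr (_ + _).
  by rewrite -[P1 in LHS]mul1mx l mul1mx.
rewrite !schur_corrE cE; congr (_ *m _ *m _).
by rewrite l r.
Qed.

Lemma chart_slice (tau : 'M[K]_n) : (forall q, q \notin value_boxes -> tau q.1 q.2 = 0) ->
  slice_mx v (chart tau).
Proof.
move=> t0; split=> [c|i c ic]; rewrite chartE.
  case: ifP => [/andP[cR cV]|_]; first by rewrite (disjointFr R2V cR) in cV.
  by rewrite eqxx (t0 (c, c)) ?addr0 // inE ltnn.
case: ifP => [/andP[iR cV] _|_]; first by have := block_value_box iR cV; rewrite inE.
rewrite (negPf ic) add0r; apply: contraNT => h.
by rewrite (t0 (i, c)) // inE.
Qed.

Lemma chart_block tau : P2 *m chart tau *m PV - schur_corr R1 R2 V2 (chart tau) =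
  P2 *m (chart_X tau *m chart_Y tau) *m PV.
Proof.
have -> : chart tau = chart_off tau + P2 *m (chart_X tau *m chart_Y tau +
    chart_off tau *m P1 *m \adj (corner R1 (chart_off tau)) *m P1 *m chart_off tau) *m PV.
  by rewrite /chart schur_corrE -addrA -mulmxDl -mulmxDr.
rewrite schur_corr_block schur_corrE.
apply/matrixP => i c; rewrite [LHS]mxE [X in _ + X]mxE !block_mask mxE block_mask chart_offE.
case: ifP => iR; rewrite ?subr0 //.
by rewrite iR add0r mxE addrK.
Qed.

Lemma rank_chart (tau : 'M[K]_n) : (forall q, q \notin value_boxes -> tau q.1 q.2 = 0) ->
  (\rank (sw_block a b (chart tau *m pmx K v)) <= m)%N.
Proof.
move=> t0; rewrite (rank_slice (chart_slice t0)) chart_block.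
rewrite -[X in (_ <= X)%N](subnKC rm) leq_add2l.
apply: leq_trans (mxrankM_maxl _ _) _; apply: leq_trans (mxrankM_maxr _ _) _.
apply: leq_trans (mxrankM_maxr _ _) _.
have -> : chart_Y tau = mask_mx K J *m chart_Y tau.
  by apply/matrixP => j c; rewrite mask_mxl mxE; case: ifP.
by apply: leq_trans (mxrankM_maxl _ _) _; rewrite rank_mask cJ.
Qed.

Lemma chart_boxes_sub : chart_boxes \subset value_boxes.
Proof. exact: finset.subsetDl. Qed.

Lemma card_chart_boxes : chart_ok ->
  #|chart_boxes| = (#|oRothe v| - (n - a - m) * (b.+1 - m))%N.
Proof.
case/andP=> /eqP cb sb; rewrite cardsD card_value_boxes (finset.setIidPr _).
  rewrite cardsX !cardsD (finset.setIidPr sb) (finset.setIidPr JV) cb cJ.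
  by rewrite card_R2 card_V2 /rho -!subnDA subnKC.
apply/fintype.subsetP => -[i c]; rewrite finset.in_setX => /andP[].
rewrite !finset.in_setD => /andP[_ iR] /andP[_ cV]; exact: block_value_box.
Qed.

End Chart.

Lemma chart_surj (L : 'M[K]_n) : slice_mx v L -> (\rank (sw_block a b (L *m pmx K v)) <= m)%N ->
  exists beta (tau : 'M[K]_n), [/\ chart_ok beta,
    forall q, q \notin chart_boxes beta -> tau q.1 q.2 = 0 & chart beta tau = L].
Proof.
move=> sL; rewrite (rank_slice sL) -[X in (_ <= X)%N](subnKC rm) leq_add2l -/rho.
set S := _ - _ => rS.
have RS : P2 *m S = S.
  by rewrite /S mulmxBr schur_corrE !mulmxA !mask_idem.
have [|beta [Z [injb bR SE]]] := @spanning_rows K n S R2 J RS.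
  by rewrite cJ rS rho_R2.
(* In the block, the rows beta(J) keep the entries of S; the other rows store the coefficients Z in
   the columns J, and their remaining entries are determined. *)
pose tau : 'M[K]_n := \matrix_(i, c) if (i \in R2) && (c \in V2) then
   (if i \in [set beta j | j in J] then S i c else if c \in J then Z i c else 0)
   else if i == c then 0 else L i c.
have L0 q : q \notin value_boxes -> q.1 != q.2 -> L q.1 q.2 = 0.
  case: q => i c /= nD ic; apply/eqP; apply: contraNT nD => h.
  by rewrite inE; exact: sL.2.
exists beta, tau; split.
- by rewrite /chart_ok card_in_imset // eqxx.
- case=> i c nS /=; rewrite mxE; case: ifP => [/andP[iR cV]|nb].
    move: nS; rewrite finset.in_setD (block_value_box iR cV) andbT negbK.
    by rewrite finset.in_setX !finset.in_setD => /andP[/andP[/negPf -> _] /andP[/negPf -> _]].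
  case: eqVneq => // ic; apply: (L0 (i, c)) => //; apply: contraNN nS => D.
  rewrite finset.in_setD D andbT finset.in_setX !finset.in_setD.
  by apply/negP => /andP[/andP[_ iR] /andP[_ cV]]; rewrite iR cV in nb.
have offE : L = chart_off tau + P2 *m L *m PV.
  apply/matrixP => i c; rewrite [RHS]mxE chart_offE block_mask mxE.
  case: ifP => h; first by rewrite add0r.
  rewrite h; case: eqVneq => [->|_]; first by rewrite !addr0 sL.1.
  by rewrite addr0 add0r.
have corrE : schur_corr R1 R2 V2 (chart_off tau) = schur_corr R1 R2 V2 L.
  by rewrite [in RHS]offE schur_corr_block.
apply/matrixP => i c; rewrite chartE corrE; case: ifP => [/andP[iR cV]|nb]; last first.
  by rewrite mxE nb; case: eqVneq => [->|_]; rewrite ?addr0 ?sL.1 ?add0r.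
suff -> : (chart_X beta tau *m chart_Y beta tau) i c = S i c.
  by rewrite /S [X in X + _]mxE [X in _ + X + _]mxE block_mask iR cV subrK.
have tauS j : j \in J -> tau (beta j) c = S (beta j) c.
  move=> jJ; have bI : beta j \in [set beta j | j in J] by exact: imset_f.
  by rewrite mxE cV (fintype.subsetP bR) // bI.
rewrite mxE [LHS](bigID (mem J)) /= [X in _ + X]big1 ?addr0; last first.
  by move=> j /negPf jJ; rewrite mxE jJ mul0r.
have [iB|iB] := boolP (i \in [set beta j | j in J]).
  case/imsetP: (iB) => j0 j0J iE.
  rewrite (bigD1 j0) //= big1 => [|j /andP[jJ jj0]].
    by rewrite [X in X * _]mxE [X in _ * X]mxE j0J iB iE eqxx mul1r addr0 tauS.
  rewrite [X in X * _]mxE jJ iB iE; case: eqP => [/injb E|_]; last by rewrite mul0r.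
  by rewrite E // eqxx in jj0.
rewrite SE; apply: eq_bigr => j jJ.
have jV : j \in V2 by exact: (fintype.subsetP JV).
rewrite [X in X * _]mxE [X in _ * X]mxE jJ (negPf iB) tauS //; congr (_ * _).
by rewrite mxE iR jV (negPf iB) jJ.
Qed.

Section Coordinates.
Variables (D : nat) (beta : {ffun 'I_n -> 'I_n}).
Hypotheses (okb : chart_ok beta) (cD : #|chart_boxes beta| = D).

(** The chain of subvarieties releases the parameters in this order: those of
    the block at beta(J) x J come after the other ones of the block, so that
    the products in [chart] reduce to single parameters, and those outside the
    block come last, so that the Schur correction vanishes until then. *)
Definition stage (q : 'I_n * 'I_n) : nat :=
  if (q.1 \in R2) && (q.2 \in V2) then (q.1 \in [set beta j | j in J]) && (q.2 \in J) : nat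
  else 2.

Definition box_seq := sort (fun p q => stage p <= stage q)%N (enum (chart_boxes beta)).

Definition box_at (x : nat) : 'I_n * 'I_n := nth (a, a) box_seq x.

Definition coords_mx (t : 'I_D -> K) : 'M[K]_n :=
  \matrix_(i, c) \sum_(x < D) (if box_at x == (i, c) then t x else 0).

Lemma size_box_seq : size box_seq = D.
Proof. by rewrite size_sort -cardE. Qed.

Lemma mem_box_seq q : (q \in box_seq) = (q \in chart_boxes beta).
Proof. by rewrite mem_sort mem_enum. Qed.

Lemma box_at_in (x : 'I_D) : box_at x \in chart_boxes beta.
Proof. by rewrite -mem_box_seq mem_nth // size_box_seq. Qed.

Lemma coords_mx_off t q : q \notin chart_boxes beta -> coords_mx t q.1 q.2 = 0.
Proof.
move=> nq; rewrite mxE big1 // => x _; case: eqP => // E.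
by case/negP: nq; case: q E => q1 q2 <-; exact: box_at_in.
Qed.

Lemma coords_mx_out t q : q \notin value_boxes -> coords_mx t q.1 q.2 = 0.
Proof.
by move=> h; apply: coords_mx_off; apply: contraNN h; apply: (fintype.subsetP (chart_boxes_sub _)).
Qed.

Lemma coords_mx_at t (x : 'I_D) : coords_mx t (box_at x).1 (box_at x).2 = t x.
Proof.
rewrite mxE (bigD1 x) //= -surjective_pairing eqxx big1 ?addr0 // => y yx.
rewrite ifF //; apply/negbTE; rewrite nth_uniq ?size_box_seq ?sort_uniq ?enum_uniq //.
Qed.

Lemma coords_mx_surj (tau : 'M[K]_n) : (forall q, q \notin chart_boxes beta -> tau q.1 q.2 = 0) ->
  exists t, coords_mx t = tau.
Proof.
move=> t0; exists (fun x => tau (box_at x).1 (box_at x).2); apply/matrixP => i c.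
have [ic|nic] := boolP ((i, c) \in chart_boxes beta); last first.
  by rewrite (coords_mx_off _ nic) (t0 (i, c)).
have lt : (index (i, c) box_seq < D)%N by rewrite -size_box_seq index_mem mem_box_seq.
have := coords_mx_at (fun x => tau (box_at x).1 (box_at x).2) (Ordinal lt).
by rewrite /box_at /= nth_index ?mem_box_seq.
Qed.

Lemma stage_box_at (x y : 'I_D) : (stage (box_at x) < stage (box_at y))%N -> (x < y)%N.
Proof.
apply: contraTT; rewrite -!leqNgt => yx.
have tr : transitive (fun p q => stage p <= stage q)%N.
  by move=> ? ? ?; exact: leq_trans.
have tot : total (fun p q => stage p <= stage q)%N by move=> ? ?; exact: leq_total.
have rf : reflexive (fun p q => stage p <= stage q)%N by move=> ?; exact: leqnn.
have := sorted_leq_nth tr rf (a, a) (sort_sorted tot (enum (chart_boxes beta))).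
by apply; rewrite // inE size_box_seq.
Qed.

(** At this point the rows beta(J) and columns J of the block form an identity matrix. *)
Definition base_mx : 'M[K]_n := \matrix_(i, c) ((c \in J) && (i == beta c))%:R.

(** Outside the block the chart is 1 + tau. For a box inside, everything outside is still at its
    base value 0, so the correction vanishes. Then a row of beta(J) is copied by [chart_X]; in
    another row, with c in J, the sum over j collapses to j = c because tau at (beta j, c) has its
    base value. *)
Lemma chart_at_box t (x : 'I_D) :
  (forall y : 'I_D, (x < y)%N -> t y = base_mx (box_at y).1 (box_at y).2) ->
  chart beta (coords_mx t) (box_at x).1 (box_at x).2 = t x.
Proof.
move=> tE; have := box_at_in x; set tau := coords_mx t.
have tau_base q : (stage (box_at x) < stage q)%N -> tau q.1 q.2 = base_mx q.1 q.2.
  move=> lt; have [qS|qS] := boolP (q \in chart_boxes beta).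
    have qD : (index q box_seq < D)%N by rewrite -size_box_seq index_mem mem_box_seq.
    have qE : box_at (Ordinal qD) = q by rewrite /box_at /= nth_index ?mem_box_seq.
    rewrite -qE coords_mx_at tE // stage_box_at // qE //.
  rewrite coords_mx_off // mxE; case: (boolP (q.2 \in J)) => // qJ; case: eqP => // qb.
  case/negP: qS; rewrite finset.in_setD.
  have b2 : beta q.2 \in [set beta j | j in J] by exact: imset_f.
  have bR : beta q.2 \in R2 by case/andP: okb => _ /fintype.subsetP; apply.
  case: q {lt} qJ qb b2 bR => q1 q2 /= qJ -> b2 bR.
  by rewrite finset.in_setX !finset.in_setD b2 /= block_value_box // (fintype.subsetP JV).
rewrite -(coords_mx_at t x) -/tau; case: (box_at x) tau_base => i c /= tau_base icS.
have icD : (i, c) \in value_boxes by exact: (fintype.subsetP (chart_boxes_sub _) _ icS).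
have ic : (i == c) = false.
  by apply/negP => /eqP E; move: icD; rewrite E inE ltnn.
rewrite chartE; case: ifP => [/andP[iR cV]|_]; last by rewrite ic add0r.
have injb : {in J &, injective beta} by case/andP: okb => /imset_injP.
have st1 : (stage (i, c) <= 1)%N by rewrite /stage /= iR cV leq_b1.
have off1 : chart_off tau = 1%:M.
  apply/matrixP => i' c'; rewrite chart_offE [RHS]mxE; case: ifP => [/andP[iR' cV']|nb].
    by case: eqP => // E; move: cV'; rewrite -E (disjointFr R2V).
  rewrite (tau_base (i', c')) /=; last by rewrite /stage /= nb ltnS.
  rewrite mxE; case: (boolP (c' \in J)) => cJ' /=; last by rewrite addr0.
  case: (i' =P beta c') => [iE|_]; last by rewrite addr0.
  move: nb; rewrite (fintype.subsetP JV) // iE.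
  by case/andP: okb => _ /fintype.subsetP ->; rewrite ?imset_f.
have -> : schur_corr R1 R2 V2 (chart_off tau) = 0.
  have P21 : P2 *m P1 = 0 by apply: mask_disjoint; rewrite disjoint_sym.
  by rewrite off1 /schur_corr mulmx1 P21 !mul0mx.
rewrite [X in _ + X]mxE addr0 mxE.
rewrite [LHS](bigID (mem J)) /= [X in _ + X]big1 ?addr0; last first.
  by move=> j /negPf jJ; rewrite mxE jJ mul0r.
have [iB|iB] := boolP (i \in [set beta j | j in J]).
  case/imsetP: (iB) => j0 j0J iE.
  rewrite (bigD1 j0) //= big1 => [|j /andP[jJ jj0]].
    by rewrite [X in X * _]mxE [X in _ * X]mxE j0J iB iE eqxx mul1r addr0.
  rewrite [X in X * _]mxE jJ iB iE; case: eqP => [/injb E|_]; last by rewrite mul0r.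
  by rewrite E // eqxx in jj0.
have cJ' : c \in J.
  move: icS; rewrite finset.in_setD finset.in_setX !finset.in_setD iB iR cV /=.
  by rewrite andbT negbK => /andP[].
have st0 : stage (i, c) = 0%N by rewrite /stage /= iR cV (negPf iB).
rewrite (bigD1 c) //= big1 => [|j /andP[jJ jc]].
  rewrite [X in X * _]mxE [X in _ * X]mxE cJ' (negPf iB) addr0.
  rewrite (tau_base (beta c, c)) /=; first by rewrite [base_mx _ _]mxE cJ' eqxx mulr1.
  rewrite st0 /stage /= cV cJ'.
  have bI : beta c \in [set beta j | j in J] by exact: imset_f.
  by case/andP: okb => _ /fintype.subsetP/(_ _ bI) ->; rewrite bI.
rewrite [X in X * _]mxE [X in _ * X]mxE jJ (negPf iB).
have bI : beta j \in [set beta j | j in J] by exact: imset_f.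
rewrite (tau_base (beta j, c)) /=.
  rewrite [base_mx _ _]mxE cJ' /=; case: eqP => [/injb E|_]; last by rewrite mulr0.
  by rewrite E // eqxx in jc.
rewrite st0 /stage /= cV cJ'.
by case/andP: okb => _ /fintype.subsetP/(_ _ bI) ->; rewrite bI.
Qed.

Lemma polyfun_chart i c : polyfun (fun t => chart beta (coords_mx t) i c).
Proof.
have PR := polyfun_ring K D.
pose pm (M : ('I_D -> K) -> 'M[K]_n) := forall i c, polyfun (fun t => M t i c).
have pmC A : pm (fun=> A) by move=> ? ?; exact: (fr_const PR).
have pmD M M' : pm M -> pm M' -> pm (fun t => M t + M' t).
  move=> h h' i' c'; apply: (eq_ind _ (@polyfun K D) (fr_add PR (h i' c') (h' i' c'))).
  by apply/funext => t; rewrite mxE.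
have pmN M : pm M -> pm (fun t => - M t).
  move=> h i' c'; apply: (eq_ind _ (@polyfun K D) (fr_mul PR (fr_const PR (-1)) (h i' c'))).
  by apply/funext => t; rewrite mxE mulN1r.
have pmM M M' : pm M -> pm M' -> pm (fun t => M t *m M' t).
  by move=> h h' i' c'; exact: (fr_mulmx PR h h').
have pmA M : pm M -> pm (fun t => \adj (M t)) by move=> h i' c'; exact: (fr_adj PR h).
have pmT : pm coords_mx.
  move=> i' c'; apply: (eq_ind (fun t : 'I_D -> K => \sum_(x < D) (if box_at x == (i', c') then t x else 0)) (@polyfun K D)).
    apply: (fr_sum PR) => x _; case: eqP => _; first exact: polyfun_coord.
    exact: (fr_const PR).
  by apply/funext => t; rewrite [RHS]mxE.
have pmX : pm (fun t => chart_X beta (coords_mx t)).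
  move=> i' c'; apply: (eq_ind (fun t => if c' \in J then
     (if i' \in [set beta j | j in J] then (i' == beta c')%:R else coords_mx t i' c') else 0) (@polyfun K D)).
    case: (c' \in J); last exact: (fr_const PR).
    by case: (i' \in _); [exact: (fr_const PR) | exact: pmT].
  by apply/funext => t; rewrite [RHS]mxE.
have pmY : pm (fun t => chart_Y beta (coords_mx t)).
  move=> i' c'; apply: (eq_ind (fun t => if i' \in J then coords_mx t (beta i') c' else 0) (@polyfun K D)).
    by case: (i' \in J); [exact: pmT | exact: (fr_const PR)].
  by apply/funext => t; rewrite [RHS]mxE.
have pmO : pm (fun t => chart_off (coords_mx t)).
  by apply: (pmD _ _); [apply: (pmD _ _) | apply: (pmN _); apply: (pmM (fun t => P2 *m coords_mx t)); first apply: (pmM _ _)].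
have pmCo : pm (fun t => corner R1 (chart_off (coords_mx t))).
  by apply: (pmD _ _) => //; apply: (pmM (fun t => P1 *m chart_off (coords_mx t))); first apply: (pmM _ _).
suff : pm (fun t => chart beta (coords_mx t)) by apply.
apply: (pmD _ _); first apply: (pmD _ _) => //.
  apply: (pmM (fun t => P2 *m (chart_X beta (coords_mx t) *m chart_Y beta (coords_mx t)))) => //.
  by apply: (pmM _ _) => //; exact: (pmM _ _).
apply: (pmM (fun t => P2 *m chart_off (coords_mx t) *m P1 *m \adj (corner R1 (chart_off (coords_mx t))))
  (fun t => P1 *m chart_off (coords_mx t) *m PV)).
  apply: (pmM (fun t => P2 *m chart_off (coords_mx t) *m P1)); last exact: (pmA _).
  by apply: (pmM (fun t => P2 *m chart_off (coords_mx t))) => //; exact: (pmM _ _).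
by apply: (pmM (fun t => P1 *m chart_off (coords_mx t))) => //; exact: (pmM _ _).
Qed.

End Coordinates.
End Parametrization.

Lemma krull_dim_KLvariety (R : realType) (K : numFieldType) n (v w : 'S_n) (a b : 'I_n) :
  crossing w a b -> (sw_count v a b <= sw_count w a b)%N ->
  krull_dim R (KLvariety (K := K) v w) =
  (#|oRothe v| - (n - a - sw_count w a b) * (b.+1 - sw_count w a b))%N%:R%:E.
Proof.
move=> cw vw; set m := sw_count w a b; set D := (_ - _ * _)%N.
have mr : (m <= n - a)%N.
  by rewrite -(card_ge_perm w a); apply: subset_leq_card; apply/fintype.subsetP => x; rewrite !inE => /andP[].
have mc : (m <= b.+1)%N.
  rewrite -(card_ord_lt (ltn_ord b)); apply: subset_leq_card; apply/fintype.subsetP => x.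
  by rewrite !inE => /andP[].
pose V2 := [set c : 'I_n | (c < a)%N & (v^-1%g c <= b)%N].
pose R2 := [set i : 'I_n | (a <= i)%N & (b < v^-1%g i)%N].
have cV : #|V2| = (b.+1 - sw_count v a b)%N.
  rewrite -card_free_cols -(card_perm_pre v (fun i : 'I_n => (i < a)%N && (v^-1%g i <= b)%N)).
  by apply: eq_card => x; rewrite !inE permK andbC.
have cR : #|R2| = (n - a - sw_count v a b)%N.
  by rewrite -card_free_rows; apply: eq_card => x; rewrite !inE.
have [|J [_ JV cJ]] := @subset_card_ex _ finset.set0 V2 (m - sw_count v a b) (finset.sub0set _).
  by rewrite cards0 cV leq_sub2r.
have N_slice x : KLvariety (K := K) v w x -> exists2 L, slice_mx v L & x = slice_pt v L.
  by move=> /(KLvarietyP cw)[L [sL xE _]]; exists L.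
(* For the zero matrix, [spanning_rows] merely supplies an injection of J into R2, which is one
   chart. *)
have [beta0 [Z [injb bR _]]] : exists (beta : {ffun 'I_n -> 'I_n}) (Z : 'M[K]_n),
    [/\ {in J &, injective beta}, [set beta j | j in J] \subset R2 &
        forall i c, (0 : 'M[K]_n) i c = \sum_(j in J) Z i j * (0 : 'M[K]_n) (beta j) c].
  apply: spanning_rows; first by rewrite mulmx0.
  by rewrite mxrank0 cJ cR leq_sub2r.
have ok0 : chart_ok v a b J beta0 by rewrite /chart_ok card_in_imset // eqxx.
have cD beta : chart_ok v a b J beta -> #|chart_boxes v a b J beta| = D.
  by move=> ok; rewrite (card_chart_boxes vw JV cJ ok).
pose T beta (t : 'I_D -> K) := coords_mx v a b J beta t.
pose phi beta t : GB K n := slice_pt v (chart v a b J beta (T beta t)).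
have T0 beta t : chart_ok v a b J beta -> forall q, q \notin value_boxes v -> T beta t q.1 q.2 = 0.
  by move=> ok q; apply: coords_mx_out; exact: cD.
have sl beta t : chart_ok v a b J beta -> slice_mx v (chart v a b J beta (T beta t)).
  by move=> ok; apply: chart_slice; exact: T0.
have /choice[g gP] (x : 'I_D) : exists g : GB K n -> K, good v g /\ forall L, slice_mx v L ->
    g (slice_pt v L) = L (box_at v a b J beta0 x).1 (box_at v a b J beta0 x).2.
  have [g [gg gE]] := good_coord K v (box_at v a b J beta0 x).1 (v^-1%g (box_at v a b J beta0 x).2).
  by exists g; split=> // L /gE ->; rewrite mul_pmx permKV.
apply: (@krull_dimE K (GB K n) (KLvariety v w) (good v) (@good_function_ring K n v)
  (good_closed_on N_slice) (good_sep_on N_slice) R D {ffun 'I_n -> 'I_n} (chart_ok v a b J) phi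
  beta0 (fun x => base_mx K J beta0 (box_at v a b J beta0 x).1 (box_at v a b J beta0 x).2) g).
- move=> x /(KLvarietyP cw)[L [sL -> rk]].
  have [beta [tau [ok t0 <-]]] := chart_surj vw mr JV cJ sL rk.
  have [t tE] := coords_mx_surj (cD _ ok) t0.
  by exists beta, t; split; [exact: ok | rewrite /phi /T tE].
- move=> beta t ok; apply/(KLvarietyP cw); exists (chart v a b J beta (T beta t)).
  by split=> //; [exact: sl | apply: (rank_chart vw cJ); exact: T0].
- move=> beta f ok gf; have [h [p pE] hE] := good_slice gf.
  rewrite (_ : (fun t => _) = (fun t => mpoly.meval (fun k => mxvec (chart v a b J beta (T beta t) *m pmx K v) 0 k) p)).
    apply: (fr_meval (polyfun_ring K D)) => k; case/mxvec_indexP: k => i j.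
    apply: (eq_ind _ (@polyfun K D) (@polyfun_chart K n v a b J D beta i (v j))).
    by apply/funext => t; rewrite mxvecE mul_pmx.
  by apply/funext => t; rewrite /phi hE ?pE //; exact: sl.
- exact: ok0.
- by move=> x; have [] := gP x.
- move=> x t tE; have [_ ->] := gP x; last exact: sl.
  by apply: (chart_at_box JV ok0 (cD _ ok0)).
Qed.

Section ComplexityFormula.
Variables (R : realType) (n l k : nat) (v w : 'S_n) (a b : 'I_n).
Hypotheses (hrect : is_rectangle l k (oRothe w)) (hess : Ess w = [set (a, b)]).
Hypothesis vw : (sw_count v a b <= sw_count w a b)%N.

(** Since r_v(a, b) <= r_w(a, b), the free block of v is at least as large as that of w. This makes
    the natural subtraction in the dimension exact. *)
Lemma rectangle_le_boxes : (l * k <= #|oRothe v|)%N.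
Proof.
apply: leq_trans (subset_leq_card (free_block_sub v a b)).
rewrite card_free_block -(rectangle_rows hrect hess) -(rectangle_cols hrect hess).
by rewrite leq_mul // leq_sub2l.
Qed.

Lemma complexityE : complexity R v w =
  ((#|oRothe v|%:Z - (l * k)%:Z - (cone_dim (@weight_cone R n v w))%:Z)%:~R)%:E.
Proof.
rewrite /complexity.
rewrite (@krull_dim_KLvariety R (R[i] : numFieldType) n v w a b (rectangle_crossing hrect hess) vw).
rewrite (rectangle_rows hrect hess) (rectangle_cols hrect hess).
by rewrite -EFinB !rmorphB /= natrB ?rectangle_le_boxes // !pmulrn.
Qed.

End ComplexityFormula.

Theorem proposition4p13 (R : realType) (n l k : nat) (w : 'S_n)
    (hrect : is_rectangle l k (oRothe w))
    (a b : 'I_n) (hess : Ess w = [set (a, b)]%SET)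
    (m : nat) (hm : m = sw_rank w a b)
    (v : 'S_n) (hvw : bruhat v w)
    (p : \bar R) (hp : p = complexity R v w) :
  ((sw_rank v a b < m)%N ->
     p = ((cyclomatic (KLgraph v w) - #|oRothe w|%:Z)%:~R)%:E /\
     p = ((#|Pset v|%:Z - (k * l)%:Z)%:~R)%:E) /\
  (sw_rank v a b = m ->
     p = ((cyclomatic (KLgraph v w))%:~R)%:E /\
     (is_toric R v w <-> is_forest (KLgraph v w))).
Proof.
have cw := rectangle_crossing hrect hess.
have vw : (sw_count v a b <= sw_count w a b)%N by exact: sw_count_bruhat.
have admE := adm_boxesE cw vw.
rewrite hp hm !sw_rankE (complexityE R hrect hess vw); split=> [lt|rkE].
  rewrite lt in admE; rewrite (cyclomatic_cone R) admE (card_rectangle hrect hess).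
  rewrite (card_Pset_rank v R) cone_dimE admE mulnC.
  by split; rewrite addrAC.
rewrite rkE ltnn in admE.
have cardE : #|adm_boxes v w|%:Z = #|oRothe v|%:Z - (l * k)%:Z.
  rewrite admE cardsD (finset.setIidPr (free_block_sub _ _ _)) card_free_block rkE.
  rewrite (rectangle_rows hrect hess) (rectangle_cols hrect hess) subzn //.
  exact: rectangle_le_boxes hrect hess vw.
rewrite -cardE -(cyclomatic_cone R); split=> //.
rewrite /is_toric (complexityE R hrect hess vw) -cardE -(cyclomatic_cone R) (forest_cyclomatic R).
by split=> [[/eqP]|->]; rewrite ?intr_eq0 // => /eqP.
Qed.
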